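(* Let $\gamma(t)$ be a unit speed geodesic of a contact sub-Riemannian manifold $(M,\omega,g)$ of dimension $2d+1$, with initial covector $\lambda$ and extremal $\lambda(t)=e^{t\vec H}(\lambda)$. Then the canonical splitting $T_{\gamma(t)}M=S^a_{\gamma(t)}\oplus S^b_{\gamma(t)}\oplus S^c_{\gamma(t)}$ is given by $$S^a_{\gamma(t)}=\mathrm{span}\{X_0+2Q(\dot\gamma,\dot\gamma)-h_0\dot\gamma\},\qquad \dim S^a_{\gamma(t)}=1,$$ $$S^b_{\gamma(t)}=\mathrm{span}\{J\dot\gamma\},\qquad \dim S^b_{\gamma(t)}=1,$$ $$S^c_{\gamma(t)}=(J\dot\gamma)^\perp\cap\mathscr{D}_{\gamma(t)},\qquad \dim S^c_{\gamma(t)}=2d-1,$$ where $X_0$ is the Reeb field, $Q$ is the Tanno tensor, $h_0=\langle\lambda(t),X_0\rangle$, and everything is computed along the extremal. In particular $\mathscr{D}_{\gamma(t)}=S^b_{\gamma(t)}\oplus S^c_{\gamma(t)}$ and $\dot\gamma(t)\in S^c_{\gamma(t)}$.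
   Context: Contact setting. $M$ is a smooth connected manifold of dimension $2d+1$, $\omega$ a one-form with $\omega\wedge(d\omega)^d\neq0$ everywhere, $\mathscr{D}=\ker\omega$, $g$ a smooth scalar product on $\mathscr{D}$. The Reeb field $X_0$ satisfies $\omega(X_0)=1$, $d\omega(X_0,\cdot)=0$; $g$ is extended to $TM$ by making $X_0$ a unit vector orthogonal to $\mathscr{D}$. $J:TM\to TM$ is defined by $g(X,JY)=d\omega(X,Y)$, with the convention $d\omega(X,Y)=X(\omega(Y))-Y(\omega(X))-\omega([X,Y])$. The metric is always assumed compatible: $J^2=-\mathbb{I}$ on $\mathscr{D}$ (and $JX_0=0$). Tanno connection and tensor. The Tanno connection $\nabla$ is the unique linear connection, with torsion $T$, such that $\nabla\omega=0$, $\nabla X_0=0$, $\nabla g=0$, $T(X,Y)=d\omega(X,Y)X_0$ for horizontal $X,Y$, and $T(X_0,JX)=-JT(X_0,X)$ for all $X$. Tanno's tensor is $Q(X,Y):=(\nabla_YJ)X$. Geodesics. $H(\lambda)=\frac12\sum_{i=1}^{2d}\langle\lambda,X_i\rangle^2$ on $T^*M$ for any local orthonormal frame $X_1,\dots,X_{2d}$ of $\mathscr{D}$; $\sigma=\sum dp_i\wedge dq_i$ is the canonical symplectic form and $dH=\sigma(\cdot,\vec H)$. Extremals are $\lambda(t)=e^{t\vec H}(\lambda)$, geodesics are $\gamma(t)=\pi(\lambda(t))$ with $\pi:T^*M\to M$; unit speed means $2H(\lambda)=1$. Canonical frame and splitting. For a vector field $X(t)$ along $\lambda(t)$, set $\dot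 X(t):=\frac{d}{d\varepsilon}\big|_{\varepsilon=0}e^{-\varepsilon\vec H}_*X(t+\varepsilon)$. It is known that along $\lambda(t)$ there is a smooth moving frame $E(t)=(E_0,\dots,E_{2d})^*$, $F(t)=(F_0,\dots,F_{2d})^*$ of $T_{\lambda(t)}(T^*M)$ such that: (i) $\mathrm{span}\{E_0,\dots,E_{2d}\}=\ker\pi_*|_{\lambda(t)}$; (ii) $\sigma(E_\mu,E_\nu)=\sigma(F_\mu,F_\nu)=\sigma(E_\mu,F_\nu)-\delta_{\mu\nu}=0$; (iii) $\dot E=C_1E-C_2F$ and $\dot F=R(t)E-C_1^*F$, where, in blocks of sizes $1,1,2d-1$, $$C_1=\begin{pmatrix}0&1&0\\0&0&0\\0&0&0\end{pmatrix},\quad C_2=\begin{pmatrix}0&0&0\\0&1&0\\0&0&\mathbb{I}_{2d-1}\end{pmatrix},\quad R(t)=\begin{pmatrix}R_{aa}&0&R_{ac}\\0&R_{bb}&R_{bc}\\R_{ca}&R_{cb}&R_{cc}\end{pmatrix}$$ with $R(t)$ a smooth family of symmetric matrices. The frame is unique up to constant orthogonal transformations of the form $\pm\mathrm{diag}(1,1,U)$, $U\in O(2d-1)$. With $f_\mu(t):=\pi_*F_\mu(t)\in T_{\gamma(t)}M$, the canonical splitting is defined by $S^a_{\gamma(t)}:=\mathrm{span}\{f_0\}$, $S^b_{\gamma(t)}:=\mathrm{span}\{f_1\}$, $S^c_{\gamma(t)}:=\mathrm{span}\{f_2,\dots,f_{2d}\}$. *)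

(* Defs.v *)
Set Warnings "-notation-overridden,-notation-incompatible-prefix".
From HB Require Import structures.
From mathcomp Require Import all_boot all_order all_algebra perm.
From mathcomp Require Import all_classical all_reals all_analysis.
Import Order.TTheory GRing.Theory Num.Theory.
Import numFieldNormedType.Exports.

Set Implicit Arguments.
Unset Strict Implicit.
Unset Printing Implicit Defensive.

Local Open Scope classical_set_scope.
Local Open Scope ring_scope.

(** ** Smooth maps between normed spaces *)

Fixpoint iter_derive (R : realType) (V W : normedModType R) (s : seq V)
    (f : V -> W) : V -> W :=
  if s is v :: s' then 'D_v (iter_derive s' f) else f.

(* [f] is C^oo in a neighbourhood of [x] ([V] is meant to be finite
   dimensional, so directional derivatives suffice). *)
Definition smooth_near (R : realType) (V W : normedModType R) (f : V -> W)
    (x : V) : Prop :=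
  \forall y \near x, forall s : seq V, differentiable (iter_derive s f) y.

(** ** Manifolds, tangent vectors and differentials *)

(* An atlas on [X], given by a chart around each point of [X]: [cdom x] is the
   domain of the chart chosen at [x], [cmap x] its coordinate map, [cinv x] the
   inverse of [cmap x].

   The tangent space [T_xX] is ['rV[R]_n]: a tangent vector at [x] is the row of
   its components in the chart chosen at [x]. A covector at [x] is likewise the
   row of its components in the dual basis. *)
Record atlas (R : realType) (n : nat) (X : Type) := Atlas {
  cdom : X -> set X;
  cmap : X -> X -> 'rV[R]_n;
  cinv : X -> 'rV[R]_n -> X }.

(* Components in the chart [b] of the tangent vector at [x] whose components in
   the chart [a] are [v]. *)
Definition change (R : realType) n X (A : atlas R n X) (a b x : X)
    (v : 'rV[R]_n) : 'rV[R]_n :=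
  'D_v (cmap A b \o cinv A a) (cmap A a x).

Record is_smooth_manifold (R : realType) n (M : topologicalType)
    (A : atlas R n M) : Prop := {
  man_hausdorff : hausdorff_space M;
  man_countable : @second_countable M;
  man_connected : connected [set: M];
  man_center : forall a, cdom A a a;
  man_open : forall a, open (cdom A a);
  man_image_open : forall a, open (cmap A a @` cdom A a);
  man_coordK : forall a x, cdom A a x -> cinv A a (cmap A a x) = x;
  man_coord_cont : forall a, {within cdom A a, continuous (cmap A a)};
  man_cinv_cont :
    forall a, {within cmap A a @` cdom A a, continuous (cinv A a)};
  man_smooth : forall a b x, cdom A a x -> cdom A b x ->
    smooth_near (cmap A b \o cinv A a) (cmap A a x) }.

Definition differential (R : realType) n m X Y (A : atlas R n X)
    (B : atlas R m Y) (F : X -> Y) (x : X) (v : 'rV[R]_n) : 'rV[R]_m :=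
  'D_v (cmap B (F x) \o F \o cinv A x) (cmap A x x).

(* [v f] for [f : X -> R] and [v] in [T_xX] *)
Definition dfun (R : realType) n X (A : atlas R n X) (f : X -> R) (x : X)
    (v : 'rV[R]_n) : R :=
  'D_v (f \o cinv A x) (cmap A x x).

Definition smooth_fun_at (R : realType) n X (A : atlas R n X) (f : X -> R)
    (x : X) : Prop :=
  smooth_near (f \o cinv A x) (cmap A x x).

(** ** Vector fields, one-forms *)

Definition field_in_chart (R : realType) n X (A : atlas R n X) (a : X)
    (V : X -> 'rV[R]_n) (y : 'rV[R]_n) : 'rV[R]_n :=
  change A (cinv A a y) a (cinv A a y) (V (cinv A a y)).

Definition smooth_field_at (R : realType) n X (A : atlas R n X)
    (V : X -> 'rV[R]_n) (x : X) : Prop :=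
  smooth_near (field_in_chart A x V) (cmap A x x).

Definition bracket (R : realType) n X (A : atlas R n X)
    (V W : X -> 'rV[R]_n) (x : X) : 'rV[R]_n :=
  'D_(V x) (field_in_chart A x W) (cmap A x x)
  - 'D_(W x) (field_in_chart A x V) (cmap A x x).

(* The local vector field around [x] with constant components [v] in the chart
   at [x]; it is used to evaluate tensorial expressions on tangent vectors. *)
Definition const_field (R : realType) n X (A : atlas R n X) (x : X)
    (v : 'rV[R]_n) : X -> 'rV[R]_n :=
  fun y => change A x y y v.

Definition pairing (R : realType) n (p v : 'rV[R]_n) : R := (p *m v^T) 0 0.

(* Components in the chart [a] of the covector [p] at [x]. *)
Definition covector_in_chart (R : realType) n X (A : atlas R n X) (a x : X)
    (p : 'rV[R]_n) : 'rV[R]_n :=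
  \row_i pairing p (change A a x x (delta_mx 0 i)).

Definition smooth_form_at (R : realType) n X (A : atlas R n X)
    (w : X -> 'rV[R]_n) (x : X) : Prop :=
  smooth_near (fun y => covector_in_chart A x (cinv A x y) (w (cinv A x y)))
    (cmap A x x).

Definition ext_deriv_fields (R : realType) n X (A : atlas R n X)
    (w V W : X -> 'rV[R]_n) (x : X) : R :=
  dfun A (fun y => pairing (w y) (W y)) x (V x)
  - dfun A (fun y => pairing (w y) (V y)) x (W x)
  - pairing (w x) (bracket A V W x).

Definition ext_deriv (R : realType) n X (A : atlas R n X) (w : X -> 'rV[R]_n)
    (x : X) (u v : 'rV[R]_n) : R :=
  ext_deriv_fields A w (const_field A x u) (const_field A x v) x.

(** ** Contact sub-Riemannian structures *)

(* [(w /\ (dw)^d)_x (v_0, ..., v_2d)], with the normalization for which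
   [(a /\ b) (u, v) = a u * b v - a v * b u] for one-forms [a], [b] *)
Definition contact_volume (R : realType) (d : nat) X
    (A : atlas R d.*2.+1 X) (w : X -> 'rV[R]_(d.*2.+1)) (x : X)
    (v : 'I_d.*2.+1 -> 'rV[R]_(d.*2.+1)) : R :=
  2^-1 ^+ d * \sum_(s : 'S_d.*2.+1) (-1) ^+ s * pairing (w x) (v (s ord0)) *
    \prod_(i < d) ext_deriv A w x (v (s (inord i.*2.+1)))
                                  (v (s (inord i.*2.+2))).

Definition is_contact_form (R : realType) (d : nat) X
    (A : atlas R d.*2.+1 X) (w : X -> 'rV[R]_(d.*2.+1)) : Prop :=
  (forall x, smooth_form_at A w x) /\
  (forall x, exists v, contact_volume A w x v != 0).

(* [ker w] at [x] *)
Definition horizontal (R : realType) n X (w : X -> 'rV[R]_n) (x : X) :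
    set 'rV[R]_n :=
  [set v | pairing (w x) v = 0].

(* [g x u v] is only relevant for [u] and [v] in [ker w] at [x]. *)
Record is_horizontal_metric (R : realType) n (M : topologicalType)
    (A : atlas R n M) (w : M -> 'rV[R]_n)
    (g : M -> 'rV[R]_n -> 'rV[R]_n -> R) : Prop := {
  hm_sym : forall x u v, horizontal w x u -> horizontal w x v ->
    g x u v = g x v u;
  hm_lin : forall x a u u' v, horizontal w x u -> horizontal w x u' ->
    horizontal w x v -> g x (a *: u + u') v = a * g x u v + g x u' v;
  hm_pos : forall x u, horizontal w x u -> u != 0 -> 0 < g x u u;
  hm_smooth : forall x V W, smooth_field_at A V x -> smooth_field_at A W x ->
    (\forall y \near x, horizontal w y (V y) /\ horizontal w y (W y)) ->
    smooth_fun_at A (fun y => g y (V y) (W y)) x }.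

Record is_reeb (R : realType) n X (A : atlas R n X)
    (w X0 : X -> 'rV[R]_n) : Prop := {
  reeb_smooth : forall x, smooth_field_at A X0 x;
  reeb_unit : forall x, pairing (w x) (X0 x) = 1;
  reeb_ker : forall x v, ext_deriv A w x (X0 x) v = 0 }.

(* Extension of [g] to [TM] making [X0] a unit vector orthogonal to [ker w]. *)
Definition extended_metric (R : realType) n X (w X0 : X -> 'rV[R]_n)
    (g : X -> 'rV[R]_n -> 'rV[R]_n -> R) (x : X) (u v : 'rV[R]_n) : R :=
  g x (u - pairing (w x) u *: X0 x) (v - pairing (w x) v *: X0 x)
  + pairing (w x) u * pairing (w x) v.

Definition is_contact_endomorphism (R : realType) n X (A : atlas R n X)
    (w X0 : X -> 'rV[R]_n) (g : X -> 'rV[R]_n -> 'rV[R]_n -> R)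
    (J : X -> 'rV[R]_n -> 'rV[R]_n) : Prop :=
  forall x u v, extended_metric w X0 g x u (J x v) = ext_deriv A w x u v.

Definition is_compatible (R : realType) n X (w X0 : X -> 'rV[R]_n)
    (J : X -> 'rV[R]_n -> 'rV[R]_n) : Prop :=
  (forall x v, horizontal w x v -> J x (J x v) = - v) /\
  (forall x, J x (X0 x) = 0).

(** ** Tanno connection *)

(* [D x u V] is the covariant derivative at [x] of the vector field [V] in the
   direction [u]; it is only relevant for [V] smooth near [x]. *)
Record is_linear_connection (R : realType) n X (A : atlas R n X)
    (D : X -> 'rV[R]_n -> (X -> 'rV[R]_n) -> 'rV[R]_n) : Prop := {
  lc_dir : forall x a u v V, smooth_field_at A V x ->
    D x (a *: u + v) V = a *: D x u V + D x v V;
  lc_add : forall x u V W, smooth_field_at A V x -> smooth_field_at A W x ->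
    D x u (fun y => V y + W y) = D x u V + D x u W;
  lc_leibniz : forall x u f V, smooth_fun_at A f x -> smooth_field_at A V x ->
    D x u (fun y => f y *: V y) = dfun A f x u *: V x + f x *: D x u V;
  lc_smooth : forall x V W, smooth_field_at A V x -> smooth_field_at A W x ->
    smooth_field_at A (fun y => D y (V y) W) x }.

Definition torsion (R : realType) n X (A : atlas R n X)
    (D : X -> 'rV[R]_n -> (X -> 'rV[R]_n) -> 'rV[R]_n)
    (V W : X -> 'rV[R]_n) (x : X) : 'rV[R]_n :=
  D x (V x) W - D x (W x) V - bracket A V W x.

Record is_tanno_connection (R : realType) n (M : topologicalType)
    (A : atlas R n M) (w X0 : M -> 'rV[R]_n)
    (g : M -> 'rV[R]_n -> 'rV[R]_n -> R) (J : M -> 'rV[R]_n -> 'rV[R]_n)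
    (D : M -> 'rV[R]_n -> (M -> 'rV[R]_n) -> 'rV[R]_n) : Prop := {
  tanno_linear : is_linear_connection A D;
  tanno_form : forall x u V, smooth_field_at A V x ->
    dfun A (fun y => pairing (w y) (V y)) x u - pairing (w x) (D x u V) = 0;
  tanno_reeb : forall x u, D x u X0 = 0;
  tanno_metric : forall x u V W,
    smooth_field_at A V x -> smooth_field_at A W x ->
    dfun A (fun y => extended_metric w X0 g y (V y) (W y)) x u
    - extended_metric w X0 g x (D x u V) (W x)
    - extended_metric w X0 g x (V x) (D x u W) = 0;
  tanno_torsion_hor : forall x V W,
    smooth_field_at A V x -> smooth_field_at A W x ->
    (\forall y \near x, horizontal w y (V y) /\ horizontal w y (W y)) ->
    torsion A D V W x = ext_deriv A w x (V x) (W x) *: X0 x;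
  tanno_torsion_reeb : forall x V, smooth_field_at A V x ->
    torsion A D X0 (fun y => J y (V y)) x = - J x (torsion A D X0 V x) }.

(* [Q(u, v) = (D_v J) u] *)
Definition tanno_tensor (R : realType) n X (A : atlas R n X)
    (J : X -> 'rV[R]_n -> 'rV[R]_n)
    (D : X -> 'rV[R]_n -> (X -> 'rV[R]_n) -> 'rV[R]_n)
    (x : X) (u v : 'rV[R]_n) : 'rV[R]_n :=
  D x v (fun y => J y (const_field A x u y)) - J x (D x v (const_field A x u)).

(** ** Cotangent bundle and symplectic form *)

(* A point of [T^*M] is a pair [(x, p)] with [p] in [T_x^*M]. The chart at
   [(x, p)] is the canonical chart [(q_i, p_i)] induced by the chart of [M]
   at [x]. *)
Definition cotangent_atlas (R : realType) n M (A : atlas R n M) :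
    atlas R (n + n) (M * 'rV[R]_n) :=
  {| cdom := fun l => [set m | cdom A l.1 m.1];
     cmap := fun l m =>
       row_mx (cmap A l.1 m.1) (covector_in_chart A l.1 m.1 m.2);
     cinv := fun l z =>
       let y := cinv A l.1 (lsubmx z) in
       (y, \row_i pairing (rsubmx z) (change A y l.1 y (delta_mx 0 i))) |}.

(* [sum_i dp_i /\ dq_i] on [T_l(T^*M)]. As tangent vectors at [l] are written in
   the canonical chart at [l], the expression does not depend on [l]. *)
Definition symplectic (R : realType) n (Z W : 'rV[R]_(n + n)) : R :=
  pairing (rsubmx Z) (lsubmx W) - pairing (rsubmx W) (lsubmx Z).

Definition is_orthonormal_frame (R : realType) (d : nat) X
    (w : X -> 'rV[R]_(d.*2.+1))
    (g : X -> 'rV[R]_(d.*2.+1) -> 'rV[R]_(d.*2.+1) -> R)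
    (x : X) (e : 'I_d.*2 -> 'rV[R]_(d.*2.+1)) : Prop :=
  (forall i, horizontal w x (e i)) /\
  (forall i j, g x (e i) (e j) = (i == j)%:R).

Definition is_hamiltonian (R : realType) (d : nat) X
    (w : X -> 'rV[R]_(d.*2.+1))
    (g : X -> 'rV[R]_(d.*2.+1) -> 'rV[R]_(d.*2.+1) -> R)
    (H : X * 'rV[R]_(d.*2.+1) -> R) : Prop :=
  forall x p e, is_orthonormal_frame w g x e ->
    H (x, p) = 2^-1 * \sum_(i < d.*2) pairing p (e i) ^+ 2.

Definition is_hamiltonian_field (R : realType) n M (A : atlas R n M)
    (H : M * 'rV[R]_n -> R) (Hv : M * 'rV[R]_n -> 'rV[R]_(n + n)) : Prop :=
  forall l Z, dfun (cotangent_atlas A) H l Z = symplectic Z (Hv l).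

(** ** Curves and flows *)

Definition velocity (R : realType) n X (A : atlas R n X) (c : R -> X) (t : R) :
    'rV[R]_n :=
  derive1 (cmap A (c t) \o c) t.

Definition is_integral_curve (R : realType) n X (A : atlas R n X)
    (V : X -> 'rV[R]_n) (I : set R) (c : R -> X) : Prop :=
  forall t, I t ->
    (\forall s \near t, cdom A (c t) (c s)) /\
    is_derive t 1 (cmap A (c t) \o c) (V (c t)).

(* [flow t x = e^{tV}(x)] for [(t, x)] in [W], the maximal domain of the
   flow; [W] is open and the flow is smooth on [W]. *)
Record is_flow (R : realType) n X (A : atlas R n X) (V : X -> 'rV[R]_n)
    (W : set (R * X)) (flow : R -> X -> X) : Prop := {
  flow_dom0 : forall x, W (0, x);
  flow_interval : forall x, is_interval [set t | W (t, x)];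
  flow0 : forall x, flow 0 x = x;
  flow_curve :
    forall x, is_integral_curve A V [set t | W (t, x)] (flow^~ x);
  flow_maximal : forall (I : set R) c, open I -> is_interval I -> I 0 ->
    is_integral_curve A V I c ->
    forall t, I t -> W (t, c 0) /\ flow t (c 0) = c t;
  flow_open : forall t x, W (t, x) ->
    \forall z \near (t, cmap A x x),
      W (z.1, cinv A x z.2) /\
      cdom A (flow t x) (flow z.1 (cinv A x z.2));
  flow_smooth : forall t x, W (t, x) ->
    smooth_near (fun z : R * 'rV[R]_n =>
      cmap A (flow t x) (flow z.1 (cinv A x z.2))) (t, cmap A x x) }.

Definition smooth_along (R : realType) n X (A : atlas R n X) (c : R -> X)
    (V : R -> 'rV[R]_n) (t : R) : Prop :=
  smooth_near (fun s => change A (c s) (c t) (c s) (V s)) t.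

(* d/de (e^{-e V})_* Z(t + e) at e = 0, for [Z] a vector field along the integral
   curve [c] of [V]; the differentiated function takes its values in the fixed
   tangent space at [c t]. *)
Definition flow_derivative (R : realType) n X (A : atlas R n X)
    (flow : R -> X -> X) (c : R -> X) (Z : R -> 'rV[R]_n) (t : R) :
    'rV[R]_n :=
  derive1 (fun e : R =>
    differential A A (flow (- e)) (c (t + e)) (Z (t + e))) 0.

(** ** Canonical frame and canonical splitting *)

Definition frame_C1 (R : realType) n : 'M[R]_n :=
  \matrix_(i, j) ((i == 0%N :> nat) && (j == 1%N :> nat))%:R.

Definition frame_C2 (R : realType) n : 'M[R]_n :=
  \matrix_(i, j) ((i == j) && (i != 0%N :> nat))%:R.

(* [c] is an integral curve on [I] of the field whose flow is [flow]. *)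
Record is_canonical_frame (R : realType) n M (A : atlas R n M)
    (flow : R -> M * 'rV[R]_n -> M * 'rV[R]_n) (c : R -> M * 'rV[R]_n)
    (I : set R) (E F : R -> 'I_n -> 'rV[R]_(n + n)) (Rm : R -> 'M[R]_n) :
    Prop := {
  cf_smooth : forall t, I t -> forall mu,
    smooth_along (cotangent_atlas A) c (E^~ mu) t /\
    smooth_along (cotangent_atlas A) c (F^~ mu) t;
  cf_vertical : forall t, I t -> forall Z,
    Z \in <<[seq E t mu | mu : 'I_n]>>%VS <->
    differential (cotangent_atlas A) A fst (c t) Z = 0;
  cf_darboux : forall t, I t -> forall mu nu,
    [/\ symplectic (E t mu) (E t nu) = 0,
        symplectic (F t mu) (F t nu) = 0 &
        symplectic (E t mu) (F t nu) - (mu == nu)%:R = 0];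
  cf_dotE : forall t, I t -> forall mu,
    flow_derivative (cotangent_atlas A) flow c (E^~ mu) t =
    \sum_nu frame_C1 R n mu nu *: E t nu -
    \sum_nu frame_C2 R n mu nu *: F t nu;
  cf_dotF : forall t, I t -> forall mu,
    flow_derivative (cotangent_atlas A) flow c (F^~ mu) t =
    \sum_nu Rm t mu nu *: E t nu -
    \sum_nu (frame_C1 R n)^T mu nu *: F t nu;
  cf_curv_smooth : forall t, I t -> forall mu nu,
    smooth_near (fun s => Rm s mu nu) t;
  cf_curv_sym : forall t, I t -> (Rm t)^T = Rm t;
  cf_curv_normal : forall t, I t -> forall mu nu : 'I_n,
    mu = 0%N :> nat -> nu = 1%N :> nat -> Rm t mu nu = 0 }.

Definition split_a (R : realType) n (f : 'I_n.+1 -> 'rV[R]_n.+1) :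
    {vspace 'rV[R]_n.+1} :=
  <[f ord0]>%VS.

Definition split_b (R : realType) n (f : 'I_n.+1 -> 'rV[R]_n.+1) :
    {vspace 'rV[R]_n.+1} :=
  <[f (inord 1)]>%VS.

Definition split_c (R : realType) n (f : 'I_n.+1 -> 'rV[R]_n.+1) :
    {vspace 'rV[R]_n.+1} :=
  <<[seq f mu | mu : 'I_n.+1 <- enum 'I_n.+1 & (1 < mu)%N]>>%VS.

(* Main.v *)
Require Import Defs.
Set Warnings "-notation-overridden,-notation-incompatible-prefix".
From HB Require Import structures.
From mathcomp Require Import all_boot all_order all_algebra perm.
From mathcomp Require Import all_classical all_reals all_analysis.
From mathcomp Require Import ring lra zify.
Import Order.TTheory GRing.Theory Num.Theory.
Import numFieldNormedType.Exports.

Set Implicit Arguments.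
Unset Strict Implicit.
Unset Printing Implicit Defensive.

Local Open Scope classical_set_scope.
Local Open Scope ring_scope.

(** Why the theorem is true. Let [w] be the contact form, [S] the cometric (the
    symmetric matrix with [H (q, p) = p S p / 2], of kernel [w]) and [u = p S]
    the velocity of the geodesic. In canonical coordinates the derivative of a
    field [Y] along the extremal is the Lie bracket [Y' - D_Y V], where [V] is
    the Hamiltonian field ([flow_derivative_in_chart]), so that each equation of
    the canonical frame splits into a position part and a momentum part
    ([frame_equations]). These are solved one after the other.

    The field [E_1], the derivative of [E_0], is vertical, so the covector of
    [E_0] is in the kernel of [S]: it is [kappa w] for a function [kappa]
    ([momentum_E0]). Its derivative gives that the covector of [E_1] is [kappa]
    times the interior product of [dw] with [u], up to a multiple of [w]
    ([momentum_E1]). The position of [F_1] is the dual vector of this covector,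
    that is [- kappa J u] ([position_F1]). The normalization of the frame and the
    unit speed force [kappa ^ 2 = 1] at every time, so [kappa] is a constant
    sign ([frame_scale_constant]).

    The derivative of [F_1] then gives the position of [F_0]
    ([position_F0]). It contains the derivatives of [S], of [J u] and of [u]. The
    Tanno connection preserves the metric and the contact form, hence [S], so
    the derivatives of [S] can be traded for Christoffel symbols
    ([derive_sharp_mx]); those that are left only occur in the Tanno tensor and
    in torsions of horizontal vectors, which are multiples of the Reeb field
    ([christoffel_torsion]). The outcome is
    [kappa (X0 + 2 Q (u, u) - h0 u)] ([reeb_direction]).

    The covectors of the [E_mu] are dual to the positions of the [F_mu], which
    therefore form a basis. The vectors of [S^c] are those annihilated by the
    covectors of [E_0] and [E_1], that is by [w] and by the metric dual of
    [J u], and the vectors of [S^b + S^c] are those annihilated by [w]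
    ([mem_split_c], [mem_split_bc]).

    Two points need care. The charts are attached to the points, so the
    definitions of [dw], of the Hamiltonian field and of the symplectic form are
    independent of the chart only because second derivatives of changes of charts
    are symmetric ([derive_commute], [ext_deriv_change],
    [cotangent_change_symplectic]). And the Hamiltonian is given
    fibre by fibre: the smoothness of [S] is deduced from that of the Hamiltonian
    flow ([sharp_chart_smooth]). *)

(** * Directional derivatives *)

Section HasD.
Context {R : realType}.
Implicit Types V W X : normedModType R.

(** Differentiability together with the directional derivatives, [L] being any
    function and not the bundled differential: this form is stable under the
    composition of the rules below. *)
Definition has_D V W (f : V -> W) (x : V) (L : V -> W) : Prop :=
  differentiable f x /\ forall v, 'D_v f x = L v.

Lemma near_eq_differentiable V W (f g : V -> W) (x : V) :
  (\forall y \near x, f y = g y) -> differentiable f x -> differentiable g x.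
Proof.
move=> fg df; have [cdf fE] := (diff_locallyP x f).1 df.
have gE : g \o shift x = cst (g x) + 'd f x +o_ (0 : V) id.
  apply/eqaddoP; have /eqaddoP fo := fE.
  move=> e e0; have := fo e e0.
  have fg0 : \forall h \near (0 : V), f (h + x) = g (h + x).
    by have := fg; rewrite (near_shift 0) /= subr0.
  apply: filterS2 fg0 => h fgh.
  by rewrite /= !fctE /= fgh (nbhs_singleton fg).
have dE := diff_unique cdf gE.
by apply/diff_locallyP; rewrite dE.
Qed.

Lemma has_D_near V W (f g : V -> W) x L :
  (\forall y \near x, f y = g y) -> has_D f x L -> has_D g x L.
Proof.
move=> fg [df Df]; split; first exact: near_eq_differentiable df.
by move=> v; rewrite -(near_eq_derive v fg).
Qed.

Lemma has_D_ext V W (f g : V -> W) x L :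
  f =1 g -> has_D f x L -> has_D g x L.
Proof. by move=> /funext ->. Qed.

Lemma has_D_eq V W (f : V -> W) x L L' :
  has_D f x L -> (forall v, L v = L' v) -> has_D f x L'.
Proof. by move=> [df Df] e; split=> // v; rewrite Df. Qed.

Lemma has_D_self V W (f : V -> W) x :
  differentiable f x -> has_D f x (fun v => 'D_v f x).
Proof. by []. Qed.

Lemma is_diff_has_D V W (f : V -> W) x L : is_diff x f L -> has_D f x L.
Proof. by move=> [df <-]; split=> // v; rewrite deriveE. Qed.

Lemma has_D_is_diff V W (f : V -> W) x L : has_D f x L -> is_diff x f L.
Proof.
by move=> [df Df]; apply: DiffDef => //; apply/funext => v; rewrite -Df deriveE.
Qed.

Lemma has_D_cst V W (a : W) (x : V) : has_D (fun _ => a) x (fun _ => 0).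
Proof. by apply: is_diff_has_D; apply: (is_diff_cst a x). Qed.

Lemma has_D_id V (x : V) : has_D (fun y => y) x id.
Proof. by apply: is_diff_has_D; apply: is_diff_id. Qed.

Lemma has_D_add V W (f g : V -> W) x Lf Lg : has_D f x Lf -> has_D g x Lg ->
  has_D (fun y => f y + g y) x (fun v => Lf v + Lg v).
Proof.
move=> /has_D_is_diff Df /has_D_is_diff Dg; exact: is_diff_has_D.
Qed.

Lemma has_D_opp V W (f : V -> W) x Lf : has_D f x Lf ->
  has_D (fun y => - f y) x (fun v => - Lf v).
Proof. move=> /has_D_is_diff Df; exact: is_diff_has_D. Qed.

Lemma has_D_sub V W (f g : V -> W) x Lf Lg : has_D f x Lf -> has_D g x Lg ->
  has_D (fun y => f y - g y) x (fun v => Lf v - Lg v).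
Proof. by move=> Df Dg; apply: has_D_add => //; apply: has_D_opp. Qed.

Lemma has_D_scale V W (f : V -> W) k x Lf : has_D f x Lf ->
  has_D (fun y => k *: f y) x (fun v => k *: Lf v).
Proof. move=> /has_D_is_diff Df; exact: is_diff_has_D. Qed.

Lemma has_D_comp V W X (f : V -> W) (g : W -> X) x Lf Lg :
  has_D f x Lf -> has_D g (f x) Lg ->
  has_D (fun y => g (f y)) x (fun v => Lg (Lf v)).
Proof.
move=> /has_D_is_diff Df /has_D_is_diff Dg; exact: is_diff_has_D.
Qed.

Lemma has_D_comp_at V W X (f : V -> W) (g : W -> X) x y Lf Lg :
  f x = y -> has_D f x Lf -> has_D g y Lg ->
  has_D (fun y => g (f y)) x (fun v => Lg (Lf v)).
Proof. by move=> <-; apply: has_D_comp. Qed.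

Lemma has_D_mul V (f g : V -> R) x Lf Lg : has_D f x Lf -> has_D g x Lg ->
  has_D (fun y => f y * g y) x (fun v => Lf v * g x + f x * Lg v).
Proof.
move=> /has_D_is_diff Df /has_D_is_diff Dg.
apply: (@has_D_eq _ _ _ _ (f x *: Lg + g x *: Lf)).
  by apply: is_diff_has_D; apply: is_diffM.
by move=> v; rewrite !fctE addrC mulrC.
Qed.

Lemma has_D_sum V W (n : nat) (f : 'I_n -> V -> W) x L :
  (forall i, has_D (f i) x (L i)) ->
  has_D (fun y => \sum_i f i y) x (fun v => \sum_i L i v).
Proof.
move=> Df; split.
  suff -> : (fun y => \sum_i f i y) = \sum_i f i.
    by apply: differentiable_sum => i; case: (Df i).
  by apply/funext => y; rewrite fct_sumE.
move=> v; suff -> : (fun y => \sum_i f i y) = \sum_i f i.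
  rewrite derive_sum; first by apply: eq_bigr => i _; case: (Df i).
  by move=> i; apply: diff_derivable; case: (Df i).
by apply/funext => y; rewrite fct_sumE.
Qed.

Lemma has_D_scalel V W (f : V -> R) (w : W) x Lf : has_D f x Lf ->
  has_D (fun y => f y *: w) x (fun v => Lf v *: w).
Proof.
move=> Df.
have Dg : has_D (fun k : R => k *: w) (f x) (fun k => k *: w).
  exact: is_diff_has_D.
exact: has_D_comp Df Dg.
Qed.

Lemma has_D_mx V m n (f : V -> 'M[R]_(m, n)) x (L : V -> 'M[R]_(m, n)) :
  (forall i j, has_D (fun y => f y i j) x (fun v => L v i j)) -> has_D f x L.
Proof.
move=> Df.
apply: (@has_D_eq _ _ _ _ (fun v => \sum_i \sum_j (L v i j) *: delta_mx i j)).
  apply: (@has_D_ext _ _ (fun y => \sum_i \sum_j (f y i j) *: delta_mx i j)).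
    by move=> y; rewrite -matrix_sum_delta.
  by do 2 apply: has_D_sum => ?; apply: has_D_scalel.
by move=> v; rewrite -matrix_sum_delta.
Qed.

Lemma has_D_entry m n (x : 'M[R]_(m, n)) i j :
  has_D (fun y : 'M[R]_(m, n) => y i j) x (fun v => v i j).
Proof.
split; first exact: differentiable_coord.
move=> v; have [dx Dx] := has_D_id x.
have := derive_mx (diff_derivable (v := v) dx).
by rewrite Dx => /matrixP /(_ i j); rewrite mxE.
Qed.

(** A linear map on matrices is a finite sum of multiples of entries; this gives
    its continuity. *)
Lemma has_D_lin m n V (f : {linear 'M[R]_(m, n) -> V}) (x : 'M[R]_(m, n)) :
  has_D f x f.
Proof.
have fE (y : 'M[R]_(m, n)) :
    \sum_i \sum_j (y i j) *: f (delta_mx i j) = f y.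
  rewrite {2}(matrix_sum_delta y) linear_sum; apply: eq_bigr => i _.
  by rewrite linear_sum; apply: eq_bigr => j _; rewrite linearZ.
have D : has_D (fun y : 'M[R]_(m, n) =>
    \sum_i \sum_j (y i j) *: f (delta_mx i j)) x
    (fun v => \sum_i \sum_j (v i j) *: f (delta_mx i j)).
  by do 2 apply: has_D_sum => ?; apply: has_D_scalel; apply: has_D_entry.
by apply: has_D_eq (has_D_ext _ D) _; apply: fE.
Qed.

Lemma has_D_linear V m n W (f : V -> 'M[R]_(m, n))
    (g : {linear 'M[R]_(m, n) -> W}) x L :
  has_D f x L -> has_D (fun y => g (f y)) x (fun v => g (L v)).
Proof. by move=> Df; apply: has_D_comp Df _; apply: has_D_lin. Qed.

Lemma has_D_coord V m n (f : V -> 'M[R]_(m, n)) x L i j :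
  has_D f x L -> has_D (fun y => f y i j) x (fun v => L v i j).
Proof.
move=> Df; have @g : {linear 'M[R]_(m, n) -> R}.
  by exists (fun N : 'M[R]_(_, _) => N i j); do 2![eexists]; do ?[constructor];
     rewrite ?mxE// => ? *; rewrite ?mxE//; move=> ?; rewrite !mxE.
exact: (@has_D_linear _ _ _ _ f g).
Qed.

Lemma has_D_mulmx V m n p (f : V -> 'M[R]_(m, n)) (g : V -> 'M[R]_(n, p))
    x Lf Lg : has_D f x Lf -> has_D g x Lg ->
  has_D (fun y => f y *m g y) x (fun v => Lf v *m g x + f x *m Lg v).
Proof.
move=> Df Dg; apply: has_D_mx => i j.
apply: (@has_D_eq _ _ _ _ (fun v => \sum_k (Lf v i k * g x k j +
                                           f x i k * Lg v k j))).
  apply: (@has_D_ext _ _ (fun y => \sum_k (f y i k * g y k j))).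
    by move=> y; rewrite mxE.
  by apply: has_D_sum => k; apply: has_D_mul; apply: has_D_coord.
by move=> v; rewrite !mxE big_split.
Qed.

Lemma has_D_pairing V n (f g : V -> 'rV[R]_n) x Lf Lg :
  has_D f x Lf -> has_D g x Lg ->
  has_D (fun y => pairing (f y) (g y)) x
        (fun v => pairing (Lf v) (g x) + pairing (f x) (Lg v)).
Proof.
move=> Df Dg; rewrite /pairing.
have Dgt : has_D (fun y => (g y)^T) x (fun v => (Lg v)^T).
  exact: (@has_D_linear _ _ _ _ g trmx).
apply: has_D_eq (has_D_coord 0 0 (has_D_mulmx Df Dgt)) _ => v.
by rewrite mxE.
Qed.

Lemma has_D_row_mx V m n p (f : V -> 'M[R]_(m, n)) (g : V -> 'M[R]_(m, p))
    x Lf Lg : has_D f x Lf -> has_D g x Lg ->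
  has_D (fun y => row_mx (f y) (g y)) x (fun v => row_mx (Lf v) (Lg v)).
Proof.
move=> Df Dg; apply: has_D_mx => i j.
case: (split_ordP j) => k ->.
  have E (a : 'M[R]_(m, n)) (b : 'M[R]_(m, p)) :
     row_mx a b i (lshift p k) = a i k by rewrite row_mxEl.
  apply: has_D_eq (has_D_ext _ (has_D_coord i k Df)) _.
    by move=> y; rewrite E.
  by move=> v; rewrite E.
have E (a : 'M[R]_(m, n)) (b : 'M[R]_(m, p)) :
   row_mx a b i (rshift n k) = b i k by rewrite row_mxEr.
apply: has_D_eq (has_D_ext _ (has_D_coord i k Dg)) _.
  by move=> y; rewrite E.
by move=> v; rewrite E.
Qed.

Lemma has_D_pair V W X (f : V -> W) (g : V -> X) x Lf Lg :
  has_D f x Lf -> has_D g x Lg ->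
  has_D (fun y => (f y, g y)) x (fun v => (Lf v, Lg v)).
Proof.
move=> /has_D_is_diff Df /has_D_is_diff Dg; exact: is_diff_has_D.
Qed.

Lemma has_D_scaler V n m (f : V -> R) (g : V -> 'M[R]_(m, n)) x Lf Lg :
  has_D f x Lf -> has_D g x Lg ->
  has_D (fun y => f y *: g y) x (fun v => Lf v *: g x + f x *: Lg v).
Proof.
move=> Df Dg; apply: has_D_mx => i j.
apply: (@has_D_eq _ _ _ _ (fun v => Lf v * g x i j + f x * Lg v i j)).
  apply: (@has_D_ext _ _ (fun y => f y * g y i j)).
    by move=> y; rewrite mxE.
  by apply: has_D_mul => //; apply: has_D_coord.
by move=> v; rewrite !mxE.
Qed.

Lemma has_D_linear_part V W (f : V -> W) x : differentiable f x ->
  forall a u v, 'D_(a *: u + v) f x = a *: 'D_u f x + 'D_v f x.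
Proof. by move=> df a u v; rewrite !deriveE // linearP. Qed.

Lemma derive1_is_derive V (f : R -> V) (t : R) (l : V) :
  is_derive t 1 f l -> has_D f t (fun h => h *: l).
Proof.
move=> [df dl]; have dft : differentiable f t by apply/derivable1_diffP.
split=> // v; rewrite deriveE // -[v in LHS]mulr1 -[v * 1]/(v *: 1) linearZ /=.
by rewrite -deriveE // dl.
Qed.

End HasD.

(** * Symmetry of second derivatives *)

(** A directional derivative is the derivative of the restriction to a line,
    with no differentiability assumption. *)
Lemma derive_line {R : realType} (V : normedModType R) (f : V -> R) (a v : V) :
  'D_v f a = 'D_1 (fun h : R => f (h *: v + a)) 0.
Proof.
have E : (fun h : R => h^-1 *: ((f \o shift a) (h *: v) - f a)) =
    (fun h : R => h^-1 *: (((fun h : R => f (h *: v + a)) \o shift 0) (h *: 1)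
      - f ((0 : R) *: v + a))).
  by apply/funext => h /=; rewrite addr0 scale0r add0r [h *: 1]mulr1.
by rewrite /derive E.
Qed.

Section Schwarz.
Context {R : realType}.
Implicit Types V W : normedModType R.

(** By the mean value theorem along [u], the second difference is [h] times a
    difference of two values of ['D_u f] near [x], which the differentiability
    of ['D_u f] at [x] evaluates up to [o(h)]. *)
Lemma second_difference V (f : V -> R) (u v x : V) (e : R) : 0 < e ->
  (\forall y \near x, differentiable f y) -> differentiable ('D_u f) x ->
  exists2 r, 0 < r & forall h, 0 < h -> h < r ->
    `|f (h *: u + (x + h *: v)) - f (h *: u + x)
      - (f (x + h *: v) - f x) - h ^+ 2 * 'D_v ('D_u f) x|
    <= e * h ^+ 2 * (2 * `|u| + `|v|).
Proof.
move=> e0 df ddf.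
have [_ /eqaddoP /(_ e e0) dd0] := (diff_locallyP x ('D_u f)).1 ddf.
have dd : \forall y \near x,
    `|'D_u f y - 'D_u f x - 'd ('D_u f) x (y - x)| <= e * `|y - x|.
  rewrite (near_shift 0 x) /=; apply: filterS dd0 => h.
  by rewrite /= !fctE /= subr0 addrK opprD addrA.
have /nbhs_ballP [r1 /= r10 H] : \forall y \near x, differentiable f y /\
    `|'D_u f y - 'D_u f x - 'd ('D_u f) x (y - x)| <= e * `|y - x|.
  exact: filterI df dd.
pose K := `|u| + `|v| + 1; have K0 : 0 < K by rewrite ltr_wpDl ?addr_ge0.
exists (r1 / K) => [|h h0 hr]; first by rewrite divr_gt0.
have hK : h * K < r1 by rewrite -ltr_pdivlMr.
have inball (s : R) (w : V) : 0 <= s -> s <= h -> `|w| <= h * `|v| ->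
    ball x r1 (s *: u + (x + w)).
  move=> s0 sh wh; rewrite -ball_normE /ball_ /= addrCA opprD addrA subrr add0r.
  rewrite normrN; apply: le_lt_trans (ler_normD _ _) _; apply: le_lt_trans hK.
  rewrite normrZ (ger0_norm s0) !mulrDr mulr1 -addrA lerD ?ler_wpM2r//.
  by rewrite ler_wpDr // ltW.
have hv : `|h *: v| <= h * `|v| by rewrite normrZ gtr0_norm.
have zv : `|0 : V| <= h * `|v| by rewrite normr0 mulr_ge0 // ltW.
have Dline (w : V) (s : R) : 0 <= s -> s <= h -> `|w| <= h * `|v| ->
    has_D (fun s : R => f (s *: u + (x + w))) s
          (fun k : R => k * 'D_u f (s *: u + (x + w))).
  move=> s0 sh wh; have [dfy _] := H _ (inball s w s0 sh wh).
  have Dl : has_D (fun s : R => s *: u + (x + w)) s (fun k : R => k *: u).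
    apply: has_D_eq (has_D_add (has_D_scalel u (has_D_id s))
                               (has_D_cst (x + w) s)) _ => k.
    by rewrite addr0.
  apply: has_D_eq (has_D_comp Dl (has_D_self dfy)) _ => k.
  by rewrite /= !deriveE // linearZ.
pose phi (s : R) := f (s *: u + (x + h *: v)) - f (s *: u + (x + 0)).
pose dphi (s : R) := 'D_u f (s *: u + (x + h *: v)) - 'D_u f (s *: u + (x + 0)).
have Dphi (s : R) : 0 <= s -> s <= h -> has_D phi s (fun k : R => k * dphi s).
  move=> s0 sh.
  apply: has_D_eq (has_D_sub (Dline _ s s0 sh hv) (Dline _ s s0 sh zv)) _ => k.
  by rewrite mulrBr.
have [||c] := @MVT R phi dphi 0 h h0.
- move=> s /itvP sI; have s0 : 0 <= s by rewrite sI.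
  have sh : s <= h by rewrite sI.
  have [dp Dp] := Dphi s s0 sh.
  apply: DeriveDef; first exact: diff_derivable.
  by rewrite Dp mul1r.
- apply: derivable_within_continuous => s /itvP sI.
  have s0 : 0 <= s by rewrite sI.
  have sh : s <= h by rewrite sI.
  by apply: diff_derivable; have [] := Dphi s s0 sh.
move=> /itvP cI; rewrite subr0 /phi !scale0r !add0r !addr0 => ->.
have c0 : 0 <= c by rewrite cI.
have ch : c <= h by rewrite cI.
have [_ H1] := H _ (inball c _ c0 ch hv).
have [_ H2] := H _ (inball c _ c0 ch zv).
set a1 := c *: u + (x + h *: v) in H1 *; set a2 := c *: u + (x + 0) in H2 *.
have n1 : `|a1 - x| <= h * (`|u| + `|v|).
  rewrite /a1 addrCA addrAC subrr add0r (le_trans (ler_normD _ _)) // mulrDr.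
  by rewrite lerD // normrZ ger0_norm // ler_wpM2r.
have n2 : `|a2 - x| <= h * `|u|.
  by rewrite /a2 addr0 addrK normrZ ger0_norm // ler_wpM2r.
have -> : h ^+ 2 * 'D_v ('D_u f) x =
    ('d ('D_u f) x (a1 - x) - 'd ('D_u f) x (a2 - x)) * h.
  rewrite -linearB opprB addrA subrK /a1 /a2 addr0 opprD addrACA subrr add0r.
  by rewrite addrAC subrr add0r linearZ /= -deriveE // /GRing.scale /=; ring.
have -> : dphi c * h -
  ('d ('D_u f) x (a1 - x) - 'd ('D_u f) x (a2 - x)) * h =
  h * (('D_u f a1 - 'D_u f x - 'd ('D_u f) x (a1 - x)) -
       ('D_u f a2 - 'D_u f x - 'd ('D_u f) x (a2 - x))).
  by rewrite /dphi -/a1 -/a2; ring.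
rewrite normrM (gtr0_norm h0) expr2 [e * _]mulrCA -mulrA ler_pM2l //.
rewrite (le_trans (ler_normB _ _)) //.
rewrite (_ : e * h * (2 * `|u| + `|v|) =
   e * (h * (`|u| + `|v|)) + e * (h * `|u|)); last by ring.
by apply: lerD; [apply: le_trans H1 _|apply: le_trans H2 _];
  rewrite ler_wpM2l // ltW.
Qed.

(** Schwarz's theorem: the second difference of [second_difference] is symmetric
    in [u] and [v], and divided by [h ^+ 2] it approximates both mixed
    derivatives. *)
Lemma derive_commute_real V (f : V -> R) (u v x : V) :
  (\forall y \near x, differentiable f y) ->
  differentiable ('D_u f) x -> differentiable ('D_v f) x ->
  'D_u ('D_v f) x = 'D_v ('D_u f) x.
Proof.
move=> df du dv; apply/eqP; rewrite -subr_eq0 -normr_le0; apply/ler_addgt0Pr.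
move=> e e0; rewrite add0r.
pose K := (2 * `|u| + `|v|) + (2 * `|v| + `|u|) + 1.
have K0 : 0 < K by rewrite ltr_wpDl // !addr_ge0 // mulr_ge0.
have eK : 0 < e / K by rewrite divr_gt0.
have [r1 r10 H1] := second_difference v eK df du.
have [r2 r20 H2] := second_difference u eK df dv.
pose h := Num.min r1 r2 / 2.
have m0 : 0 < Num.min r1 r2 by rewrite lt_min r10.
have h0 : 0 < h by rewrite divr_gt0.
have hm : h < Num.min r1 r2 by rewrite /h ltr_pdivrMr // ltr_pMr // ltr1n.
move: (hm); rewrite lt_min => /andP[h1 h2].
have := H1 h h0 h1; have := H2 h h0 h2.
rewrite [h *: v + (x + h *: u)]addrCA [h *: v + x]addrC [x + h *: u]addrC.
rewrite [h *: u + (x + h *: v)]addrCA.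
rewrite -[x + (h *: u + h *: v)]/(x + (_ + _)) [h *: v + h *: u]addrC.
set F1 := f (x + _); set F2 := f (x + h *: v); set F3 := f (h *: u + x).
set A := 'D_u _ _; set B := 'D_v _ _ => HA HB.
have : `|h ^+ 2 * (A - B)| <= h ^+ 2 * e.
  have -> : h ^+ 2 * (A - B) = (F1 - F3 - (F2 - f x) - h ^+ 2 * B) -
     (F1 - F2 - (F3 - f x) - h ^+ 2 * A) by ring.
  rewrite (le_trans (ler_normB _ _)) // (le_trans (lerD HB HA)) //.
  rewrite (_ : h ^+ 2 * e = e / K * h ^+ 2 * K); last first.
    by field; rewrite gt_eqF.
  have eKh : 0 < e / K * h ^+ 2 by rewrite (mulr_gt0 eK) ?exprn_gt0.
  rewrite -mulrDr ler_pM2l //.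
  by rewrite /K lerDl.
by rewrite normrM gtr0_norm ?exprn_gt0 // ler_pM2l ?exprn_gt0.
Qed.

Lemma derive_entry V n (f : V -> 'rV[R]_n) (v x : V) i :
  differentiable f x -> 'D_v (fun y => f y 0 i) x = ('D_v f x) 0 i.
Proof. by move=> df; rewrite (has_D_coord 0 i (has_D_self df)).2. Qed.

Lemma derive_commute V n (f : V -> 'rV[R]_n) (u v x : V) :
  (\forall y \near x, differentiable f y) ->
  differentiable ('D_u f) x -> differentiable ('D_v f) x ->
  'D_u ('D_v f) x = 'D_v ('D_u f) x.
Proof.
move=> df du dv; apply/rowP => i.
have dvE := @derive_entry V n ('D_v f) u x i dv.
have duE := @derive_entry V n ('D_u f) v x i du.
rewrite -[LHS]dvE -[RHS]duE.
have E w : \forall y \near x, 'D_w f y 0 i = 'D_w (fun z => f z 0 i) y.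
  by apply: filterS df => y dfy; rewrite derive_entry.
apply: etrans (near_eq_derive u (E v)) _.
apply: etrans _ (esym (near_eq_derive v (E u))).
apply: derive_commute_real.
- by apply: filterS df => y /has_D_self /(has_D_coord 0 i) [].
- apply: near_eq_differentiable (E u) _.
  by have [] := has_D_coord 0 i (has_D_self du).
- apply: near_eq_differentiable (E v) _.
  by have [] := has_D_coord 0 i (has_D_self dv).
Qed.

End Schwarz.

(** * Smooth maps *)

Section Smooth.
Context {R : realType}.
Implicit Types V W X : normedModType R.

(** [smooth_near] asks for one neighbourhood that serves all the iterated
    derivatives, so closure properties are proved on a fixed open set. *)
Definition smooth_on V W (U : set V) (f : V -> W) : Prop :=
  forall y, U y -> forall s, differentiable (iter_derive s f) y.

Lemma smooth_nearP V W (f : V -> W) x :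
  smooth_near f x <-> exists U : set V, [/\ open U, U x & smooth_on U f].
Proof.
split; last first.
  by move=> [U [Uo Ux fU]]; apply: filterS (open_nbhs_nbhs (conj Uo Ux)).
rewrite /smooth_near /prop_near1 nbhsE => -[U [Uo Ux] Uf].
by exists U; split=> // y /Uf.
Qed.

Lemma open_near V (U : set V) x : open U -> U x -> \forall y \near x, U y.
Proof. by move=> Uo Ux; apply: open_nbhs_nbhs. Qed.

Lemma smooth_on_differentiable V W (U : set V) (f : V -> W) x :
  smooth_on U f -> U x -> differentiable f x.
Proof. by move=> fU Ux; exact: (fU x Ux [::]). Qed.

Lemma iter_derive_rcons V W (s : seq V) v (f : V -> W) :
  iter_derive s ('D_v f) = iter_derive (rcons s v) f.
Proof. by elim: s => //= u s ->. Qed.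

Lemma smooth_on_derive V W (U : set V) (f : V -> W) v :
  smooth_on U f -> smooth_on U ('D_v f).
Proof. by move=> fU y Uy s; rewrite iter_derive_rcons; apply: fU. Qed.

(** Coinduction principle: a class of functions that are differentiable on [U]
    and closed under directional derivatives consists of smooth functions. *)
Lemma smooth_on_coind V W (U : set V) (P : (V -> W) -> Prop) : open U ->
  (forall f, P f -> forall y, U y -> differentiable f y) ->
  (forall f v, P f -> exists2 g, P g & forall y, U y -> 'D_v f y = g y) ->
  forall f, P f -> smooth_on U f.
Proof.
move=> Uo Pd PD f Pf y Uy s.
suff [g Pg fg] : exists2 g, P g & forall y, U y -> iter_derive s f y = g y.
  apply: (@near_eq_differentiable _ _ _ g); last exact: Pd.
  by apply: filterS (open_near Uo Uy) => z Uz; rewrite fg.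
elim: s => [|v s [g Pg sg]] /=; first by exists f.
have [h Ph gh] := PD g v Pg; exists h => // z Uz.
rewrite -gh //; apply: near_eq_derive.
exact: filterS (open_near Uo Uz).
Qed.

Lemma smooth_on_eq V W (U : set V) (f g : V -> W) : open U ->
  (forall y, U y -> f y = g y) -> smooth_on U f -> smooth_on U g.
Proof.
move=> Uo fg fU.
apply: (@smooth_on_coind _ _ U
  (fun h => exists2 k, smooth_on U k & forall y, U y -> k y = h y)) => //.
- move=> h [k kU kh] y Uy.
  apply: near_eq_differentiable (smooth_on_differentiable kU Uy).
  exact: filterS (open_near Uo Uy).
- move=> h v [k kU kh]; exists ('D_v k).
    by exists ('D_v k) => //; exact: smooth_on_derive.
  move=> y Uy; apply: near_eq_derive.
  by apply: filterS (open_near Uo Uy) => z /kh.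
- by exists f.
Qed.

Lemma smooth_on_sub V W (U U' : set V) (f : V -> W) :
  U' `<=` U -> smooth_on U f -> smooth_on U' f.
Proof. by move=> UU fU y /UU Uy; apply: fU. Qed.

Lemma smooth_on_cst V W (U : set V) (w : W) : open U ->
  smooth_on U (fun _ : V => w).
Proof.
move=> Uo; apply: (@smooth_on_coind _ _ U
  (fun h => exists w, h = fun _ => w)) => //; last by exists w.
  by move=> f [a ->] y _; exact: (has_D_cst a y).1.
move=> f v [a ->]; exists (fun _ => 0); first by exists 0.
by move=> y _; rewrite (has_D_cst a y).2.
Qed.

Lemma smooth_on_linear V m n X (U : set V) (g : {linear 'M[R]_(m, n) -> X})
    (f : V -> 'M[R]_(m, n)) : open U ->
  smooth_on U f -> smooth_on U (fun y => g (f y)).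
Proof.
move=> Uo fU; apply: (@smooth_on_coind _ _ U
  (fun h => exists2 k, smooth_on U k & h = fun y => g (k y))) => //.
- move=> _ [k kU ->] y Uy.
  have kd := smooth_on_differentiable kU Uy.
  by have [] := has_D_linear g (has_D_self kd).
- move=> _ v [k kU ->]; exists (fun y => g ('D_v k y)).
    by exists ('D_v k) => //; exact: smooth_on_derive.
  move=> y Uy; have kd := smooth_on_differentiable kU Uy.
  by rewrite (has_D_linear g (has_D_self kd)).2.
- by exists f.
Qed.

(** The derivative of an affine map is constant, so the derivatives of the
    composite are again composites with the same map. *)
Lemma smooth_on_affine V W X (U : set W) (f : W -> X) (a : V -> W)
    (L : V -> W) : open U -> (forall y, has_D a y L) ->
  smooth_on U f -> smooth_on (a @^-1` U) (fun y => f (a y)).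
Proof.
move=> Uo aD fU.
have ac : continuous a by move=> y; apply: differentiable_continuous (aD y).1.
have U'o : open (a @^-1` U) by apply: open_comp => // y _; apply: ac.
apply: (@smooth_on_coind _ _ (a @^-1` U)
  (fun h => exists2 k, smooth_on U k & h = fun y => k (a y))) => //.
- move=> _ [k kU ->] y Uy.
  have kd := smooth_on_differentiable kU Uy.
  by have [] := has_D_comp (aD y) (has_D_self kd).
- move=> _ v [k kU ->]; exists (fun y => 'D_(L v) k (a y)).
    by exists ('D_(L v) k) => //; exact: smooth_on_derive.
  move=> y Uy; have kd := smooth_on_differentiable kU Uy.
  by rewrite (has_D_comp (aD y) (has_D_self kd)).2.
- by exists f.
Qed.

(** An iterated derivative of a product is a sum of products of iterated
    derivatives: this class of sums is closed under differentiation, while the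
    class of products is not. *)
Inductive product_span V m n (U : set V) : (V -> 'M[R]_(m, n)) -> Prop :=
| Span_scale (f : V -> R) (g : V -> 'M[R]_(m, n)) :
    smooth_on U f -> smooth_on U g -> product_span U (fun y => f y *: g y)
| Span_add (h k : V -> 'M[R]_(m, n)) :
    product_span U h -> product_span U k ->
    product_span U (fun y => h y + k y).

Lemma smooth_on_product_span V m n (U : set V) (f : V -> 'M[R]_(m, n)) :
  open U -> product_span U f -> smooth_on U f.
Proof.
move=> Uo Pf.
have dP (h : V -> 'M[R]_(m, n)) : product_span U h ->
    forall y, U y -> differentiable h y.
  elim=> [k l kU lU y Uy|k l _ dk _ dl y Uy].
    have kd := smooth_on_differentiable kU Uy.
    have ld := smooth_on_differentiable lU Uy.
    by have [] := has_D_scaler (has_D_self kd) (has_D_self ld).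
  by have [] := has_D_add (has_D_self (dk y Uy)) (has_D_self (dl y Uy)).
apply: (@smooth_on_coind _ _ U (@product_span V m n U)) => // h v.
elim=> [k l kU lU|k l Pk [k' Pk' kk'] Pl [l' Pl' ll']].
  exists (fun y => 'D_v k y *: l y + k y *: 'D_v l y).
    by apply: Span_add; apply: Span_scale => //; apply: smooth_on_derive.
  move=> y Uy.
  have kd := smooth_on_differentiable kU Uy.
  have ld := smooth_on_differentiable lU Uy.
  by rewrite (has_D_scaler (has_D_self kd) (has_D_self ld)).2.
exists (fun y => k' y + l' y); first exact: Span_add.
move=> y Uy; rewrite -kk' // -ll' //.
by rewrite (has_D_add (has_D_self (dP _ Pk y Uy)) (has_D_self (dP _ Pl y Uy))).2.
Qed.

Lemma smooth_on_scaler V m n (U : set V) (f : V -> R) (g : V -> 'M[R]_(m, n)) :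
  open U -> smooth_on U f -> smooth_on U g ->
  smooth_on U (fun y => f y *: g y).
Proof.
by move=> Uo fU gU; apply: smooth_on_product_span => //; apply: Span_scale.
Qed.

Lemma smooth_on_add V W (U : set V) (f g : V -> W) :
  open U -> smooth_on U f -> smooth_on U g ->
  smooth_on U (fun y => f y + g y).
Proof.
move=> Uo fU gU; apply: (@smooth_on_coind _ _ U (fun h => exists k l,
  [/\ smooth_on U k, smooth_on U l & h = fun y => k y + l y])) => //.
- move=> _ [k [l [kU lU ->]]] y Uy.
  have kd := smooth_on_differentiable kU Uy.
  have ld := smooth_on_differentiable lU Uy.
  by have [] := has_D_add (has_D_self kd) (has_D_self ld).
- move=> _ v [k [l [kU lU ->]]]; exists (fun y => 'D_v k y + 'D_v l y).
    by exists ('D_v k), ('D_v l); split=> //; exact: smooth_on_derive.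
  move=> y Uy; have kd := smooth_on_differentiable kU Uy.
  have ld := smooth_on_differentiable lU Uy.
  by rewrite (has_D_add (has_D_self kd) (has_D_self ld)).2.
- by exists f, g.
Qed.

Lemma smooth_near_eq V W (f g : V -> W) x :
  (\forall y \near x, f y = g y) -> smooth_near f x -> smooth_near g x.
Proof.
rewrite /prop_near1 nbhsE => -[U1 [U1o U1x] fg] /smooth_nearP [U2 [U2o U2x fU]].
apply/smooth_nearP; exists (U1 `&` U2); split=> //; first exact: openI.
apply: (@smooth_on_eq _ _ _ f) => [|y [U1y _]|]; first exact: openI.
  exact: fg.
by apply: smooth_on_sub fU => y [].
Qed.

Lemma smooth_near_derive V W (f : V -> W) x v :
  smooth_near f x -> smooth_near ('D_v f) x.
Proof.
move=> /smooth_nearP [U [Uo Ux fU]]; apply/smooth_nearP; exists U; split=> //.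
exact: smooth_on_derive.
Qed.

Lemma smooth_near_cst V W (w : W) x : smooth_near (fun _ : V => w) x.
Proof.
apply/smooth_nearP; exists setT; split=> //; first exact: openT.
by apply: smooth_on_cst; exact: openT.
Qed.

Lemma smooth_near_linear V m n X (g : {linear 'M[R]_(m, n) -> X})
    (f : V -> 'M[R]_(m, n)) x :
  smooth_near f x -> smooth_near (fun y => g (f y)) x.
Proof.
move=> /smooth_nearP [U [Uo Ux fU]]; apply/smooth_nearP; exists U; split=> //.
exact: smooth_on_linear.
Qed.

Lemma smooth_near_affine V W X (f : W -> X) (a : V -> W) (L : V -> W) x :
  (forall y, has_D a y L) -> smooth_near f (a x) ->
  smooth_near (fun y => f (a y)) x.
Proof.
move=> aD /smooth_nearP [U [Uo Ux fU]]; apply/smooth_nearP.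
exists (a @^-1` U); split=> //; last exact: smooth_on_affine fU.
apply: open_comp => // y _; apply: differentiable_continuous (aD y).1.
Qed.

Lemma smooth_near_scaler V m n (f : V -> R) (g : V -> 'M[R]_(m, n)) x :
  smooth_near f x -> smooth_near g x -> smooth_near (fun y => f y *: g y) x.
Proof.
move=> /smooth_nearP [U [Uo Ux fU]] /smooth_nearP [U2 [U2o U2x gU]].
apply/smooth_nearP; exists (U `&` U2); split=> //; first exact: openI.
apply: smooth_on_scaler; first exact: openI.
  by apply: smooth_on_sub fU => y [].
by apply: smooth_on_sub gU => y [].
Qed.

Lemma smooth_near_add V W (f g : V -> W) x :
  smooth_near f x -> smooth_near g x -> smooth_near (fun y => f y + g y) x.
Proof.
move=> /smooth_nearP [U [Uo Ux fU]] /smooth_nearP [U2 [U2o U2x gU]].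
apply/smooth_nearP; exists (U `&` U2); split=> //; first exact: openI.
apply: smooth_on_add; first exact: openI.
  by apply: smooth_on_sub fU => y [].
by apply: smooth_on_sub gU => y [].
Qed.

Lemma smooth_near_sum V W (I : Type) (r : seq I) (f : I -> V -> W) x :
  (forall i, smooth_near (f i) x) ->
  smooth_near (fun y => \sum_(i <- r) f i y) x.
Proof.
move=> fs; elim: r => [|i r IH].
  rewrite (_ : (fun _ => _) = fun _ => 0); first exact: smooth_near_cst.
  by apply/funext => y; rewrite big_nil.
rewrite (_ : (fun _ => _) = fun y => f i y + \sum_(j <- r) f j y).
  exact: smooth_near_add.
by apply/funext => y; rewrite big_cons.
Qed.

Lemma smooth_near_differentiable V W (f : V -> W) x :
  smooth_near f x -> \forall y \near x, differentiable f y.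
Proof. by apply: filterS => y H; exact: (H [::]). Qed.

Lemma smooth_near_coord V m n (f : V -> 'M[R]_(m, n)) x i j :
  smooth_near f x -> smooth_near (fun y => f y i j) x.
Proof.
move=> fs; have @g : {linear 'M[R]_(m, n) -> R}.
  by exists (fun N : 'M[R]_(_, _) => N i j); do 2![eexists]; do ?[constructor];
     rewrite ?mxE// => ? *; rewrite ?mxE//; move=> ?; rewrite !mxE.
exact: (@smooth_near_linear _ _ _ _ g f).
Qed.

End Smooth.

(** * Tangent vectors and curves in charts *)

Section Near.
Context {T : topologicalType}.

Lemma near_imp (P Q : T -> Prop) (x : T) :
  (\forall y \near x, P y) -> (forall y, P y -> Q y) -> \forall y \near x, Q y.
Proof. by move=> Px PQ; apply: filterS Px. Qed.

Lemma near_imp2 (P1 P2 Q : T -> Prop) (x : T) :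
  (\forall y \near x, P1 y) -> (\forall y \near x, P2 y) ->
  (forall y, P1 y -> P2 y -> Q y) -> \forall y \near x, Q y.
Proof. by move=> Px Px2 PQ; apply: filterS2 Px Px2. Qed.

Lemma near_imp3 (P1 P2 P3 Q : T -> Prop) (x : T) :
  (\forall y \near x, P1 y) -> (\forall y \near x, P2 y) ->
  (\forall y \near x, P3 y) ->
  (forall y, P1 y -> P2 y -> P3 y -> Q y) -> \forall y \near x, Q y.
Proof. by move=> Px Px2 Px3 PQ; apply: filterS3 Px Px2 Px3. Qed.

Lemma near_and (P Q : T -> Prop) (x : T) : (\forall y \near x, P y) ->
  (\forall y \near x, Q y) -> \forall y \near x, P y /\ Q y.
Proof. exact: filterI. Qed.

Lemma near_forall (k : nat) (P : 'I_k -> T -> Prop) (x : T) :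
  (forall i, \forall y \near x, P i y) -> \forall y \near x, forall i, P i y.
Proof. by move=> Pi; apply: filter_forall. Qed.

Lemma near_self (P : T -> Prop) (x : T) : (\forall y \near x, P y) -> P x.
Proof. exact: nbhs_singleton. Qed.

Lemma near_near (P : T -> Prop) (x : T) : (\forall y \near x, P y) ->
  \forall y \near x, \forall z \near y, P z.
Proof. by move=> /nbhs_interior. Qed.

Lemma near_continuous (U : topologicalType) (f : T -> U) (x : T)
    (P : U -> Prop) : {for x, continuous f} ->
  (\forall y \near f x, P y) -> \forall z \near x, P (f z).
Proof. by move=> fc Pf; apply: fc. Qed.

End Near.

Lemma near_has_D {R : realType} (V W : normedModType R) (f : V -> W) x L P :
  has_D f x L -> (\forall y \near f x, P y) -> \forall z \near x, P (f z).
Proof.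
by move=> [df _]; apply: near_continuous; apply: differentiable_continuous.
Qed.

Section Pairing.
Context {R : realType} {n : nat}.
Implicit Types p q u v : 'rV[R]_n.

Lemma pairingE p v : pairing p v = \sum_i p 0 i * v 0 i.
Proof. by rewrite /pairing mxE; apply: eq_bigr => i _; rewrite mxE. Qed.

Lemma pairingC p v : pairing p v = pairing v p.
Proof. by rewrite !pairingE; apply: eq_bigr => i _; rewrite mulrC. Qed.

Lemma pairingDl p q v : pairing (p + q) v = pairing p v + pairing q v.
Proof. by rewrite /pairing mulmxDl mxE. Qed.

Lemma pairingZl a p v : pairing (a *: p) v = a * pairing p v.
Proof. by rewrite /pairing -scalemxAl mxE. Qed.

Lemma pairingNl p v : pairing (- p) v = - pairing p v.
Proof. by rewrite -scaleN1r pairingZl mulN1r. Qed.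

Lemma pairingBl p q v : pairing (p - q) v = pairing p v - pairing q v.
Proof. by rewrite pairingDl pairingNl. Qed.

Lemma pairing0l v : pairing 0 v = 0.
Proof. by rewrite /pairing mul0mx mxE. Qed.

Lemma pairingDr p u v : pairing p (u + v) = pairing p u + pairing p v.
Proof. by rewrite pairingC pairingDl !(pairingC p). Qed.

Lemma pairingZr a p v : pairing p (a *: v) = a * pairing p v.
Proof. by rewrite pairingC pairingZl pairingC. Qed.

Lemma pairingNr p v : pairing p (- v) = - pairing p v.
Proof. by rewrite pairingC pairingNl pairingC. Qed.

Lemma pairingBr p u v : pairing p (u - v) = pairing p u - pairing p v.
Proof. by rewrite pairingDr pairingNr. Qed.

Lemma pairing0r p : pairing p 0 = 0.
Proof. by rewrite pairingC pairing0l. Qed.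

Lemma pairing_sumr (I : Type) (r : seq I) p (f : I -> 'rV[R]_n) :
  pairing p (\sum_(i <- r) f i) = \sum_(i <- r) pairing p (f i).
Proof.
elim: r => [|i r IH]; first by rewrite !big_nil pairing0r.
by rewrite !big_cons pairingDr IH.
Qed.

Lemma pairing_delta p i : pairing p (delta_mx 0 i) = p 0 i.
Proof.
rewrite pairingE (bigD1 i) //= big1 => [|j ji].
  by rewrite mxE !eqxx mulr1 addr0.
by rewrite mxE (negbTE ji) andbF mulr0.
Qed.

Lemma pairing_inj p q : (forall v, pairing p v = pairing q v) -> p = q.
Proof. by move=> pq; apply/rowP => i; rewrite -!pairing_delta. Qed.

Lemma linear_sum_delta (W : lmodType R) (f : 'rV[R]_n -> W) :
  (forall a u v, f (a *: u + v) = a *: f u + f v) ->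
  forall v, f v = \sum_i v 0 i *: f (delta_mx 0 i).
Proof.
move=> fl v; pose fM := GRing.isLinear.Build _ _ _ _ f fl.
pose fL : {linear _ -> _} := HB.pack f fM.
rewrite -[f]/(fL : _ -> _) {1}(row_sum_delta v) linear_sum.
by apply: eq_bigr => i _; rewrite linearZ.
Qed.

Lemma pairing_row p (f : 'rV[R]_n -> 'rV[R]_n) :
  (forall a u v, f (a *: u + v) = a *: f u + f v) ->
  forall v, pairing (\row_i pairing p (f (delta_mx 0 i))) v = pairing p (f v).
Proof.
move=> fl v; rewrite (linear_sum_delta fl v) pairing_sumr pairingE.
by apply: eq_bigr => i _; rewrite mxE pairingZr mulrC.
Qed.

End Pairing.

Section DiffAtlas.
Context {R : realType} {n : nat} {X : Type}.

(** What the calculus of tangent vectors in charts uses of a manifold. It is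
    stated without a topology on [X], so that it applies to the cotangent
    bundle, which only comes with its canonical charts. *)
Record diff_atlas (A : atlas R n X) : Prop := DiffAtlas {
  da_center : forall a, cdom A a a;
  da_coordK : forall a x, cdom A a x -> cinv A a (cmap A a x) = x;
  da_near : forall a x, cdom A a x -> \forall z \near cmap A a x,
    cdom A a (cinv A a z) /\ cmap A a (cinv A a z) = z;
  da_overlap : forall a b x, cdom A a x -> cdom A b x ->
    \forall z \near cmap A a x, cdom A b (cinv A a z);
  da_diff : forall a b x, cdom A a x -> cdom A b x ->
    differentiable (cmap A b \o cinv A a) (cmap A a x) }.

Variable A : atlas R n X.
Hypothesis Aat : diff_atlas A.

Lemma changeE a b x v :
  change A a b x v = 'D_v (cmap A b \o cinv A a) (cmap A a x).
Proof. by []. Qed.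

Lemma has_D_transition a b x : cdom A a x -> cdom A b x ->
  has_D (fun z => cmap A b (cinv A a z)) (cmap A a x) (change A a b x).
Proof. by move=> ax bx; split=> //; exact: da_diff. Qed.

Lemma change_id a x v : cdom A a x -> change A a a x v = v.
Proof.
move=> ax; rewrite /change -(near_eq_derive (f := id)).
  by rewrite (has_D_id _).2.
by apply: near_imp (da_near Aat ax) _ => z [_ /= ->].
Qed.

Lemma change_linear a b x c u v : cdom A a x -> cdom A b x ->
  change A a b x (c *: u + v) = c *: change A a b x u + change A a b x v.
Proof.
by move=> ax bx; rewrite /change has_D_linear_part //; exact: da_diff.
Qed.

Lemma change0 a b x : change A a b x 0 = 0.
Proof. exact: derive0. Qed.

Lemma changeZ a b x c u : cdom A a x -> cdom A b x ->
  change A a b x (c *: u) = c *: change A a b x u.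
Proof.
move=> ax bx; have E := change_linear c u 0 ax bx.
by rewrite addr0 [X in _ = _ + X]change0 addr0 in E.
Qed.

Lemma changeD a b x u v : cdom A a x -> cdom A b x ->
  change A a b x (u + v) = change A a b x u + change A a b x v.
Proof.
move=> ax bx; have E := change_linear 1 u v ax bx.
by rewrite !scale1r in E.
Qed.

(** The chain rule, as two changes of charts compose near [x]. *)
Lemma change_trans a b c x v : cdom A a x -> cdom A b x -> cdom A c x ->
  change A b c x (change A a b x v) = change A a c x v.
Proof.
move=> ax bx cx.
have Dab := has_D_transition ax bx.
have Dbc := has_D_transition bx cx.
rewrite -{1}(da_coordK Aat ax) in Dbc.
rewrite -(has_D_comp Dab Dbc).2; apply: near_eq_derive.
apply: near_imp (da_overlap Aat ax bx) _ => z zb /=.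
by rewrite da_coordK.
Qed.

Lemma changeK a b x v : cdom A a x -> cdom A b x ->
  change A b a x (change A a b x v) = v.
Proof. by move=> ax bx; rewrite change_trans // change_id. Qed.

Lemma pairing_covector_in_chart a x p v : cdom A a x ->
  pairing (covector_in_chart A a x p) v = pairing p (change A a x x v).
Proof.
move=> ax; apply: pairing_row => c u w; apply: change_linear => //.
exact: da_center.
Qed.

Lemma curve_in_chart V (I : set R) c t b : is_integral_curve A V I c -> I t ->
  cdom A b (c t) ->
  (\forall s \near t, cdom A b (c s)) /\
  has_D (fun s => cmap A b (c s)) t
        (fun h => h *: change A (c t) b (c t) (V (c t))).
Proof.
move=> cI It bt; have [dt Dc] := cI t It.
have {}Dc := derive1_is_derive Dc.
have tt := da_center Aat (c t).
have near_b : \forall s \near t, cdom A b (c s).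
  apply: near_imp2 dt (near_has_D Dc (da_overlap Aat tt bt)) _ => s ds.
  by rewrite /= da_coordK.
split=> //.
have := has_D_comp Dc (has_D_transition tt bt).
move=> D; apply: has_D_eq (has_D_near _ D) _ => [|h]; last by rewrite changeZ.
by apply: near_imp dt _ => s ds /=; rewrite da_coordK.
Qed.

End DiffAtlas.

(** * Lie derivative along a flow *)

Section FlowLie.
Context {R : realType}.

Lemma has_D_linear_fun n (W : normedModType R) (f : 'rV[R]_n -> W) x :
  (forall a u v, f (a *: u + v) = a *: f u + f v) -> has_D f x f.
Proof.
move=> fl; pose fM := GRing.isLinear.Build _ _ _ _ f fl.
pose fL : {linear _ -> _} := HB.pack f fM.
exact: (has_D_lin fL x).
Qed.

Lemma has_D_derive1 (V : normedModType R) (f : R -> V) (t : R) (l : V) :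
  has_D f t (fun h => h *: l) -> derive1 f t = l.
Proof. by move=> [_ D]; rewrite derive1E D scale1r. Qed.

Lemma has_D_curve (V : normedModType R) (f : R -> V) (t : R) :
  differentiable f t -> has_D f t (fun h => h *: 'D_1 f t).
Proof.
move=> df; split=> // h; rewrite !deriveE // -linearZ /=.
by rewrite -[h *: 1]/(h * 1) mulr1.
Qed.

Lemma has_D_slice n (W : normedModType R) (F : R * 'rV[R]_n -> W) a z :
  differentiable F (a, z) ->
  has_D (fun y => F (a, y)) z (fun v => 'D_(0, v) F (a, z)).
Proof.
move=> dF.
exact: has_D_comp (has_D_pair (has_D_cst a z) (has_D_id z)) (has_D_self dF).
Qed.

Lemma has_D_time n (W : normedModType R) (F : R * 'rV[R]_n -> W) a z :
  differentiable F (a, z) ->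
  has_D (fun s => F (s, z)) a (fun h => 'D_(h, 0) F (a, z)).
Proof.
move=> dF.
exact: has_D_comp (has_D_pair (has_D_id a) (has_D_cst z a)) (has_D_self dF).
Qed.

(** Infinitesimal transport of [Y] along [z] by a local flow [Psi]: only the
    terms of first order in time survive, because [Psi (0, -)] is the identity,
    and exchanging the two derivatives turns them into a derivative of the
    generating field [Vt]. *)
Lemma transport_derivative n (Psi : R * 'rV[R]_n -> 'rV[R]_n)
    (Vt : 'rV[R]_n -> 'rV[R]_n) (z Y : R -> 'rV[R]_n) (z' : 'rV[R]_n) (s : R) :
  smooth_near Psi (0, z s) ->
  (\forall y \near z s, Psi (0, y) = y) ->
  (\forall y \near z s, 'D_(1, 0) Psi (0, y) = Vt y) ->
  has_D z s (fun h => h *: z') -> differentiable Y s ->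
  differentiable Vt (z s) /\
  has_D (fun e => 'D_(0, Y (s + e)) Psi (- e, z (s + e))) 0
        (fun h => h *: ('D_1 Y s - 'D_(Y s) Vt (z s))).
Proof.
move=> Psi_sm Psi0 Psi1 Dz dY.
have sm1 : \forall p \near (0 : R, z s), forall v, differentiable ('D_v Psi) p.
  by apply: near_imp Psi_sm _ => p H v; exact: (H [:: v]).
have sm0 : \forall p \near (0 : R, z s), differentiable Psi p.
  by apply: near_imp Psi_sm _ => p H; exact: (H [::]).
have d0 := near_self sm0; have d1 := near_self sm1.
have sl0 : {for z s, continuous (fun y : 'rV[R]_n => (0 : R, y))}.
  apply: differentiable_continuous.
  by have [] := has_D_pair (has_D_cst (0 : R) (z s)) (has_D_id (z s)).
have DVt : has_D Vt (z s) (fun v => 'D_(0, v) ('D_(1, 0) Psi) (0, z s)).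
  apply: has_D_near (has_D_slice (d1 _)).
  exact: near_imp Psi1 _.
have Did v : \forall y \near z s, 'D_(0, v) Psi (0, y) = v.
  apply: near_imp2 (near_near Psi0) (near_continuous sl0 sm0) _ => y Py dy.
  rewrite -(has_D_slice dy).2 -[RHS](has_D_id y).2.
  exact: near_eq_derive.
have D2 w v : 'D_(0, w) ('D_(0, v) Psi) (0, z s) = 0.
  rewrite -(has_D_slice (d1 _)).2 (near_eq_derive w (Did v)).
  by rewrite (has_D_cst v _).2.
split; first by case: DVt.
have Dsh : has_D (fun e : R => s + e) 0 (fun h => h).
  apply: has_D_eq (has_D_add (has_D_cst s 0) (has_D_id 0)) _ => h.
  by rewrite add0r.
have Dz0 : has_D (fun e => z (s + e)) 0 (fun h => h *: z').
  have Dzs : has_D z (s + 0) (fun h => h *: z') by rewrite addr0.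
  exact: has_D_comp Dsh Dzs.
have DY0 : has_D (fun e => Y (s + e)) 0 (fun h => h *: 'D_1 Y s).
  have DYs : has_D Y (s + 0) (fun h => h *: 'D_1 Y s).
    by rewrite addr0; apply: has_D_curve.
  exact: has_D_comp Dsh DYs.
have Dp : has_D (fun e : R => (- e, z (s + e))) 0 (fun h => (- h, h *: z')).
  exact: has_D_pair (has_D_opp (has_D_id 0)) Dz0.
have E0 : (- 0, z (s + 0)) = (0 : R, z s) by rewrite oppr0 addr0.
have expand (p : R * 'rV[R]_n) (v : 'rV[R]_n) : differentiable Psi p ->
    \sum_k v 0 k *: 'D_(0, delta_mx 0 k) Psi p = 'D_(0, v) Psi p.
  move=> dp; rewrite [RHS](linear_sum_delta (f := fun v : 'rV[R]_n => 'D_(0, v) Psi p)) //.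
  move=> a u w.
  have slin : ((0 : R), a *: u + w) = a *: ((0 : R), u) + ((0 : R), w).
    by apply: injective_projections => //=; rewrite scaler0 addr0.
  apply: etrans (f_equal (fun r => 'D_r Psi p) slin) _.
  exact: (has_D_linear_part dp).
apply: (@has_D_near _ _ _ (fun e => \sum_k Y (s + e) 0 k *:
    'D_(0, delta_mx 0 k) Psi (- e, z (s + e)))).
  rewrite -E0 in sm0.
  by apply: near_imp (near_has_D Dp sm0) _ => e de; apply: expand.
(* On the basis vectors the direction of the derivative of [Psi] is fixed, and
   only the coordinates of [Y] vary with [e]. *)
have Dk k : has_D (fun e => Y (s + e) 0 k *:
      'D_(0, delta_mx 0 k) Psi (- e, z (s + e))) 0
    (fun h => h *: ('D_1 Y s 0 k *: delta_mx 0 k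
                    - Y s 0 k *: 'D_(delta_mx 0 k) Vt (z s))).
  have d1k : differentiable ('D_(0, delta_mx 0 k) Psi) (- 0, z (s + 0)).
    by rewrite E0.
  have := has_D_scaler (has_D_coord 0 k DY0) (has_D_comp Dp (has_D_self d1k)).
  move=> D; apply: has_D_eq D _ => h; rewrite E0 !addr0.
  have Fk : 'D_(- h, h *: z') ('D_(0, delta_mx 0 k) Psi) (0, z s) =
      (- h) *: 'D_(delta_mx 0 k) Vt (z s).
    have -> : (- h, h *: z') = (- h) *: (1, 0) + ((0 : R), h *: z').
      apply: injective_projections => /=; last by rewrite scaler0 add0r.
      by rewrite addr0 [RHS]mulr1.
    apply: etrans (has_D_linear_part (d1 _) _ _ _) _.
    rewrite D2 addr0; congr (_ *: _); apply: etrans (esym (DVt.2 _)).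
    exact: derive_commute sm0 (d1 _) (d1 _).
  rewrite [X in _ + _ *: X]Fk (near_self (Did _)).
  rewrite mxE -scalerA scalerBr; congr (_ + _).
  by rewrite scaleNr scalerN !scalerA mulrC.
apply: has_D_eq (has_D_sum Dk) _ => h.
rewrite -scaler_sumr sumrB -row_sum_delta; congr (_ *: (_ - _)).
rewrite [RHS](linear_sum_delta (f := fun v : 'rV[R]_n => 'D_v Vt (z s))) // => a u v.
exact: has_D_linear_part (DVt.1) _ _ _.
Qed.

End FlowLie.

Section FlowChart.
Context {R : realType} {n : nat} {X : Type} (A : atlas R n X).
Hypothesis Aat : diff_atlas A.
Variables (V : X -> 'rV[R]_n) (W : set (R * X)) (flow : R -> X -> X).
Hypothesis flowP : is_flow A V W flow.

Definition chart_flow (b : X) (p : R * 'rV[R]_n) : 'rV[R]_n :=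
  cmap A b (flow p.1 (cinv A b p.2)).

Lemma chart_flow_smooth b : smooth_near (chart_flow b) (0, cmap A b b).
Proof.
by have := flow_smooth flowP (flow_dom0 flowP b); rewrite (flow0 flowP).
Qed.

Lemma chart_flow0 b : \forall y \near cmap A b b, chart_flow b (0, y) = y.
Proof.
apply: near_imp (da_near Aat (da_center Aat b)) _ => y [_ yE].
by rewrite /chart_flow /= (flow0 flowP).
Qed.

Lemma near_slice0 (P : R * 'rV[R]_n -> Prop) (z : 'rV[R]_n) :
  (\forall p \near (0, z), P p) -> \forall y \near z, P (0, y).
Proof.
move=> Pz; apply: (near_has_D (f := fun y : 'rV[R]_n => (0 : R, y))) Pz.
exact: has_D_pair (has_D_cst (0 : R) z) (has_D_id z).
Qed.

(** The generating field, near a point of a chart, is a partial derivative of the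
    flow: it inherits the smoothness of the flow in time and space. *)
Lemma chart_flow_time b : \forall y \near cmap A b b,
  'D_(1, 0) (chart_flow b) (0, y) = field_in_chart A b V y.
Proof.
have bb := da_center Aat b.
have sm := near_slice0 (chart_flow_smooth b).
apply: near_imp2 sm (da_near Aat bb) _ => y dy [by_ yE].
have dy0 : differentiable (chart_flow b) (0, y) := dy [::].
have W0 : [set t | W (t, cinv A b y)] 0 by exact: flow_dom0 flowP _.
have by0 : cdom A b (flow 0 (cinv A b y)) by rewrite (flow0 flowP).
have cI : is_integral_curve A V [set t | W (t, cinv A b y)]
    (flow^~ (cinv A b y)) by move=> t; apply: (flow_curve flowP).
have [_ Dc] := curve_in_chart Aat cI W0 by0.
rewrite -(has_D_time dy0).2 Dc.2 scale1r.
by rewrite /field_in_chart (flow0 flowP).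
Qed.

Variables (x0 : X) (I : set R).
Hypotheses (I_open : open I) (I_itv : is_interval I).
Hypothesis I_dom : forall t, I t -> W (t, x0).
Let c := fun t => flow t x0.

Lemma shifted_curve (s : R) : I s ->
  is_integral_curve A V [set r | I (s + r)] (fun r => c (s + r)).
Proof.
move=> Is r Ir; have [dc Dc] := flow_curve flowP (I_dom Ir).
have Dsh : has_D (fun r : R => s + r) r (fun h => h).
  apply: has_D_eq (has_D_add (has_D_cst s r) (has_D_id r)) _ => h.
  by rewrite add0r.
split; first exact: (near_has_D Dsh dc).
have [d1 D1] := has_D_comp Dsh (derive1_is_derive Dc).
apply: DeriveDef; first exact: diff_derivable.
by apply: etrans (D1 1) _; rewrite scale1r.
Qed.

(** The flow is maximal, hence it extends the curve [c] shifted in time; this is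
    the group property of the flow along [c]. *)
Lemma flow_back (s : R) : I s ->
  \forall e \near (0 : R), flow (- e) (c (s + e)) = c s.
Proof.
move=> Is.
have Dsh : has_D (fun r : R => s + r) 0 (fun h => h).
  apply: has_D_eq (has_D_add (has_D_cst s 0) (has_D_id 0)) _ => h.
  by rewrite add0r.
have nI : \forall y \near s + 0, I y.
  by rewrite addr0; apply: open_nbhs_nbhs.
apply: near_imp (near_has_D Dsh nI) _ => e Ise.
have Jc := shifted_curve Ise.
have Jo : open [set r | I (s + e + r)].
  apply: (@open_comp _ _ (fun r => s + e + r)) => // r _.
  by apply: differentiable_continuous; apply: differentiableD.
have Ji : is_interval [set r | I (s + e + r)].
  move=> a b /= Ia Ib r /andP[ar rb]; apply: I_itv Ia Ib _ _.
  by rewrite !lerD2l ar.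
have J0 : [set r | I (s + e + r)] 0 by rewrite /= addr0.
have Je : [set r | I (s + e + r)] (- e) by rewrite /= addrK.
have [_] := flow_maximal flowP Jo Ji J0 Jc Je.
by rewrite addr0 addrK.
Qed.

(** The derivative along the flow is a Lie bracket. It is computed in one fixed
    chart and at all times near [t0], so that the equations of a moving frame
    can be differentiated once more in time. *)
Lemma flow_derivative_in_chart (Z : R -> 'rV[R]_n) (t0 : R) : I t0 ->
  smooth_along A c Z t0 ->
  let b := c t0 in
  let z := fun s => cmap A b (c s) in
  let Y := fun s => change A (c s) b (c s) (Z s) in
  \forall s \near t0, [/\ I s, cdom A b (c s), differentiable Y s,
    differentiable (field_in_chart A b V) (z s) &
    change A (c s) b (c s) (flow_derivative A flow c Z s)
    = 'D_1 Y s - 'D_(Y s) (field_in_chart A b V) (z s)].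
Proof.
move=> It0 Zsm b z Y.
have bb : cdom A b b := da_center Aat b.
have cI : is_integral_curve A V I c.
  by move=> t It; apply: (flow_curve flowP); apply: I_dom.
have [near_b Dz0] := curve_in_chart Aat cI It0 bb.
have near_I : \forall s \near t0, I s by apply: open_nbhs_nbhs.
have near_Y : \forall s \near t0, differentiable Y s.
  by apply: near_imp Zsm _ => s H; exact: (H [::]).
have near1 := near_has_D Dz0 (near_near (chart_flow0 b)).
have near2 := near_has_D Dz0 (near_near (chart_flow_time b)).
have near_dom : \forall p \near (0 : R, cmap A b b),
    cdom A b (flow p.1 (cinv A b p.2)).
  have := flow_open flowP (flow_dom0 flowP b).
  by rewrite (flow0 flowP) => H; apply: near_imp H _ => p [].
have Dz0' : has_D (fun s => (0 : R, z s)) t0 _ :=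
  has_D_pair (has_D_cst (0 : R) t0) Dz0.
have near3 := near_has_D Dz0' (near_near (chart_flow_smooth b)).
have near4 := near_has_D Dz0' (near_near near_dom).
have near12 := near_and (near_and near1 near2) (near_and near3 near4).
apply: near_imp3 (near_and near_I near_b) near_Y near12 _.
move=> s [Is bs] dY [[F0 F1] [F2 F3]].
have ss := da_center Aat (c s).
have [near_bs Dz] := curve_in_chart Aat cI Is bs.
have [dV DG] := transport_derivative F2 F0 F1 Dz dY.
split=> //.
set D := _ - _ in DG *.
suff -> : flow_derivative A flow c Z s = change A b (c s) (c s) D.
  exact: changeK.
apply: has_D_derive1.
have Dsh : has_D (fun r : R => s + r) 0 (fun h => h).
  apply: has_D_eq (has_D_add (has_D_cst s 0) (has_D_id 0)) _ => h.
  by rewrite add0r.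
have at0 (P : R -> Prop) : (\forall r \near s, P r) ->
    \forall e \near (0 : R), P (s + e).
  by move=> Pr; apply: (near_has_D Dsh); rewrite addr0.
have DzN : has_D (fun e => z (s + e)) 0 (fun h => h *: change A (c s) b (c s) (V (c s))).
  have Dzs : has_D z (s + 0) (fun h => h *: change A (c s) b (c s) (V (c s))).
    by rewrite addr0.
  exact: has_D_comp Dsh Dzs.
have Dp := has_D_pair (has_D_opp (has_D_id (0 : R))) DzN.
have Ep : (- 0, z (s + 0)) = (0 : R, z s) by rewrite oppr0 addr0.
have F2' := near_near F2; have F3' := near_near F3.
rewrite -Ep in F2' F3'.
have Dch := has_D_linear_fun (f := change A b (c s) (c s))
  ('D_(0, Y (s + 0)) (chart_flow b) (- 0, z (s + 0)))
  (fun a u v => change_linear Aat a u v bs ss).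
have DD := has_D_comp DG Dch.
apply: has_D_eq (has_D_near _ DD) _; last by move=> h; rewrite changeZ.
have G1 := near_has_D Dp F2'; have G2 := near_has_D Dp F3'.
apply: near_imp3 (near_and (flow_back Is) (at0 _ near_bs)) G1 G2 _.
move=> e [fb bse] G3 G4.
set x' := c (s + e) in fb bse *.
have x'x' := da_center Aat x'.
have dPsi : differentiable (chart_flow b) (- e, z (s + e)).
  exact: (near_self G3 [::]).
have Dtr := has_D_transition Aat x'x' bse.
have Dsl := has_D_slice dPsi.
have bfs : cdom A b (flow (- e) x') by rewrite fb.
have Pe : chart_flow b (- e, z (s + e)) = cmap A b (c s).
  by rewrite /chart_flow /= /z da_coordK // fb.
have Dtr2 := has_D_transition Aat bs ss; rewrite -Pe in Dtr2.
have zE : cmap A b (cinv A x' (cmap A x' x')) = z (s + e).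
  by rewrite da_coordK.
have Dall := has_D_comp_at zE Dtr (has_D_comp Dsl Dtr2).
rewrite /differential fb -/x'.
have <- := Dall.2 (Z (s + e)); apply: near_eq_derive.
have sl : has_D (fun y => (- e, y)) (z (s + e)) (fun v => (0, v)).
  exact: has_D_pair (has_D_cst (- e) _) (has_D_id _).
have G6 := near_has_D sl G4; rewrite -zE in G6.
have G5 := near_has_D Dtr G6.
apply: near_imp2 G5 (da_overlap Aat x'x' bse) _ => y /=.
rewrite /chart_flow /= => dy by_.
rewrite da_coordK // in dy.
by rewrite !da_coordK.
Qed.

End FlowChart.

(** * The cotangent bundle *)

#[local] Opaque change pairing derive.

Section Manifold.
Context {R : realType} {n : nat} {M : topologicalType} (A : atlas R n M).
Hypothesis Aman : is_smooth_manifold A.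

Lemma near_cinv a x (U : M -> Prop) : cdom A a x ->
  (\forall y \near x, U y) -> \forall z \near cmap A a x, U (cinv A a z).
Proof.
move=> ax Ux; have := man_cinv_cont Aman (a := a).
rewrite continuous_open_subspace; last exact: man_image_open.
move=> /(_ (cmap A a x)); rewrite inE => cc.
have /cc : (cmap A a @` cdom A a) (cmap A a x) by exists x.
by move=> /near_continuous; apply; rewrite man_coordK.
Qed.

Lemma near_cdom a x : cdom A a x -> \forall y \near x, cdom A a y.
Proof. by move=> ax; apply: open_nbhs_nbhs; split => //; apply: man_open. Qed.

(** The charts of a manifold are homeomorphisms onto open sets, so every
    condition that holds near a point holds near its coordinates. *)
Lemma manifold_diff_atlas : diff_atlas A.
Proof.
split.
- exact: man_center.
- exact: man_coordK.
- move=> a x ax.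
  have im : \forall z \near cmap A a x, (cmap A a @` cdom A a) z.
    by apply: open_nbhs_nbhs; split; [apply: man_image_open|exists x].
  by apply: near_imp im _ => _ [y ay <-]; rewrite man_coordK.
- by move=> a b x ax bx; apply: near_cinv => //; apply: near_cdom.
- move=> a b x ax bx.
  exact: (near_self (man_smooth Aman ax bx) [::]).
Qed.
Let Aat := manifold_diff_atlas.

Lemma has_D_change a b x v : cdom A a x -> cdom A b x ->
  has_D (fun z => change A a b (cinv A a z) v) (cmap A a x)
        (fun u => 'D_u ('D_v (cmap A b \o cinv A a)) (cmap A a x)).
Proof.
move=> ax bx.
have d1 : differentiable ('D_v (cmap A b \o cinv A a)) (cmap A a x).
  exact: (near_self (man_smooth Aman ax bx) [:: v]).
apply: has_D_near (has_D_self d1).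
by apply: near_imp (da_near Aat ax) _ => z [_ zE]; rewrite changeE zE.
Qed.

Lemma change_commute a b x u v : cdom A a x -> cdom A b x ->
  'D_u ('D_v (cmap A b \o cinv A a)) (cmap A a x) =
  'D_v ('D_u (cmap A b \o cinv A a)) (cmap A a x).
Proof.
move=> ax bx; have sm := man_smooth Aman ax bx.
apply: derive_commute.
- by apply: near_imp sm _ => y H; exact: (H [::]).
- exact: (near_self sm [:: u]).
- exact: (near_self sm [:: v]).
Qed.

(** The transpose of the inverse change of charts, acting on covectors. *)
Definition cochange a b x (p : 'rV[R]_n) : 'rV[R]_n :=
  \row_i pairing p (change A b a x (delta_mx 0 i)).

Lemma cochangeE a b x p :
  cochange a b x p = \row_i pairing p (change A b a x (delta_mx 0 i)).
Proof. by []. Qed.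

Lemma pairing_cochange a b x p v : cdom A a x -> cdom A b x ->
  pairing (cochange a b x p) v = pairing p (change A b a x v).
Proof.
by move=> ax bx; apply: pairing_row => c u w; exact: change_linear.
Qed.

#[local] Opaque cochange.

Lemma cochange_trans a b c x p : cdom A a x -> cdom A b x -> cdom A c x ->
  cochange b c x (cochange a b x p) = cochange a c x p.
Proof.
move=> ax bx cx; apply: pairing_inj => v.
have E1 := pairing_cochange (cochange a b x p) v bx cx.
have E2 := pairing_cochange p (change A c b x v) ax bx.
have E3 := pairing_cochange p v ax cx.
apply: etrans E1 (etrans E2 (etrans _ (esym E3))).
exact: (f_equal (pairing p) (change_trans Aat v cx bx ax)).
Qed.

Lemma cochange_id a x p : cdom A a x -> cochange a a x p = p.
Proof.
by move=> ax; apply: pairing_inj => v; rewrite pairing_cochange // change_id.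
Qed.

Local Notation B := (cotangent_atlas A).

Lemma cotangent_cmapE l m :
  cmap B l m = row_mx (cmap A l.1 m.1) (cochange m.1 l.1 m.1 m.2).
Proof. by []. Qed.

Lemma cotangent_cinvE l z : cinv B l z = (cinv A l.1 (lsubmx z),
  cochange l.1 (cinv A l.1 (lsubmx z)) (cinv A l.1 (lsubmx z)) (rsubmx z)).
Proof. by []. Qed.

Lemma near_lsubmx (P : 'rV[R]_n -> Prop) (q p : 'rV[R]_n) :
  (\forall y \near q, P y) -> \forall z \near row_mx q p, P (lsubmx z).
Proof.
move=> Pq; apply: (near_has_D (f := fun z : 'rV[R]_(n + n) => lsubmx z)).
  exact: has_D_lin.
by rewrite row_mxKl.
Qed.

Lemma cotangent_transition a b x (p : 'rV[R]_n) l l' :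
  l.1 = a -> l'.1 = b ->
  cdom A a x -> cdom A b x ->
  \forall z \near row_mx (cmap A a x) p,
    cmap B l' (cinv B l z) =
    row_mx (cmap A b (cinv A a (lsubmx z)))
      (\row_i pairing (rsubmx z)
         (change A b a (cinv A b (cmap A b (cinv A a (lsubmx z))))
           (delta_mx 0 i))).
Proof.
move=> <- <- ax bx.
have N := near_lsubmx p (near_and (da_near Aat ax) (da_overlap Aat ax bx)).
apply: near_imp N _ => z [[az zE] bz].
have yy := da_center Aat (cinv A l.1 (lsubmx z)).
have E := cochange_trans (rsubmx z) az yy bz.
have E2 := da_coordK Aat bz.
by rewrite cotangent_cinvE cotangent_cmapE /= E E2 cochangeE.
Qed.

(** The momentum part of the change of canonical charts contains the first
    derivatives of the change of charts of the base, so its derivative contains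
    the second ones. *)
Lemma has_D_cotangent_transition a b x (p : 'rV[R]_n) :
  cdom A a x -> cdom A b x ->
  has_D (fun z : 'rV[R]_(n + n) =>
      row_mx (cmap A b (cinv A a (lsubmx z)))
      (\row_i pairing (rsubmx z)
         (change A b a (cinv A b (cmap A b (cinv A a (lsubmx z))))
           (delta_mx 0 i))))
    (row_mx (cmap A a x) p)
    (fun zeta => row_mx (change A a b x (lsubmx zeta))
      (\row_i (pairing (rsubmx zeta) (change A b a x (delta_mx 0 i)) +
        pairing p ('D_(change A a b x (lsubmx zeta))
            ('D_(delta_mx 0 i) (cmap A a \o cinv A b)) (cmap A b x))))).
Proof.
move=> ax bx.
set z0 := row_mx _ p.
have Dl : has_D (fun z : 'rV[R]_(n + n) => lsubmx z) z0 lsubmx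
  by exact: has_D_lin.
have Dr : has_D (fun z : 'rV[R]_(n + n) => rsubmx z) z0 rsubmx
  by exact: has_D_lin.
have l0 : lsubmx z0 = cmap A a x by rewrite row_mxKl.
have Dt := has_D_comp_at l0 Dl (has_D_transition Aat ax bx).
apply: has_D_row_mx; first exact: Dt.
apply: has_D_mx => k i; rewrite ord1.
have Et : cmap A b (cinv A a (lsubmx z0)) = cmap A b x.
  by rewrite l0 (da_coordK Aat).
have Dc := has_D_comp_at Et Dt (has_D_change (delta_mx 0 i) bx ax).
have := has_D_pairing Dr Dc.
rewrite l0 (da_coordK Aat ax) (da_coordK Aat bx) row_mxKr => D.
by apply: has_D_eq (has_D_ext _ D) _ => y; rewrite mxE.
Qed.

Lemma cotangent_diff_atlas : diff_atlas B.
Proof.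
have cc := da_center Aat.
split.
- by move=> l; apply: cc.
- move=> l [x p] lm; rewrite cotangent_cmapE cotangent_cinvE row_mxKl row_mxKr.
  rewrite (da_coordK Aat lm) (cochange_trans p (cc x) lm (cc x)).
  by rewrite (cochange_id p (cc x)).
- move=> l m lm; rewrite cotangent_cmapE.
  apply: near_imp (near_lsubmx _ (da_near Aat lm)) _ => z [lz zE].
  split=> //; rewrite cotangent_cinvE cotangent_cmapE /= zE.
  rewrite (cochange_trans (rsubmx z) lz (cc _) lz).
  by rewrite (cochange_id (rsubmx z) lz) hsubmxK.
- move=> l l' m lm l'm; rewrite cotangent_cmapE.
  exact: near_imp (near_lsubmx _ (da_overlap Aat lm l'm)) _.
- move=> l l' m lm l'm; rewrite cotangent_cmapE.
  have E := cotangent_transition (cochange m.1 l.1 m.1 m.2)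
    (erefl l.1) (erefl l'.1) lm l'm.
  have [D _] := has_D_cotangent_transition (cochange m.1 l.1 m.1 m.2) lm l'm.
  by apply: near_eq_differentiable D; apply: near_imp E _ => z /esym.
Qed.

Lemma cotangent_changeE l l' m zeta : cdom A l.1 m.1 -> cdom A l'.1 m.1 ->
  change B l l' m zeta =
  row_mx (change A l.1 l'.1 m.1 (lsubmx zeta))
      (\row_i (pairing (rsubmx zeta) (change A l'.1 l.1 m.1 (delta_mx 0 i)) +
        pairing (cochange m.1 l.1 m.1 m.2)
          ('D_(change A l.1 l'.1 m.1 (lsubmx zeta))
            ('D_(delta_mx 0 i) (cmap A l.1 \o cinv A l'.1))
            (cmap A l'.1 m.1)))).
Proof.
move=> lm l'm; rewrite changeE cotangent_cmapE.
have E := cotangent_transition (cochange m.1 l.1 m.1 m.2)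
    (erefl l.1) (erefl l'.1) lm l'm.
rewrite (near_eq_derive zeta E).
exact: (has_D_cotangent_transition _ lm l'm).2.
Qed.

Lemma lsubmx_cotangent_change l l' m zeta :
  cdom A l.1 m.1 -> cdom A l'.1 m.1 ->
  lsubmx (change B l l' m zeta) = change A l.1 l'.1 m.1 (lsubmx zeta).
Proof. by move=> lm l'm; rewrite cotangent_changeE // row_mxKl. Qed.

Lemma pairing_rsubmx_cotangent_change l l' m zeta v :
  cdom A l.1 m.1 -> cdom A l'.1 m.1 ->
  pairing (rsubmx (change B l l' m zeta)) v =
  pairing (rsubmx zeta) (change A l'.1 l.1 m.1 v) +
  pairing (cochange m.1 l.1 m.1 m.2)
    ('D_(change A l.1 l'.1 m.1 (lsubmx zeta))
      ('D_v (cmap A l.1 \o cinv A l'.1)) (cmap A l'.1 m.1)).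
Proof.
move=> lm l'm; rewrite cotangent_changeE // row_mxKr.
set w := change A l.1 _ _ _; set p := cochange _ _ _ _.
have D2 u : 'D_w ('D_u (cmap A l.1 \o cinv A l'.1)) (cmap A l'.1 m.1) =
    'D_u ('D_w (cmap A l.1 \o cinv A l'.1)) (cmap A l'.1 m.1).
  exact: change_commute.
have dw : differentiable ('D_w (cmap A l.1 \o cinv A l'.1)) (cmap A l'.1 m.1).
  exact: (near_self (man_smooth Aman l'm lm) [:: w]).
pose f u := 'D_u ('D_w (cmap A l.1 \o cinv A l'.1)) (cmap A l'.1 m.1).
have fl c u1 u2 : f (c *: u1 + u2) = c *: f u1 + f u2.
  exact: has_D_linear_part dw _ _ _.
have -> : \row_i (pairing (rsubmx zeta) (change A l'.1 l.1 m.1 (delta_mx 0 i)) +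
    pairing p ('D_w ('D_(delta_mx 0 i) (cmap A l.1 \o cinv A l'.1))
      (cmap A l'.1 m.1))) =
    cochange l.1 l'.1 m.1 (rsubmx zeta) +
    \row_i pairing p (f (delta_mx 0 i)).
  apply/rowP => i; rewrite mxE [in RHS]mxE cochangeE mxE.
  by rewrite [X in _ = _ + X]mxE (D2 (delta_mx 0 i)).
have C1 := pairing_cochange (rsubmx zeta) v lm l'm.
have C2 := pairing_row p fl v.
have C3 : pairing p (f v) = pairing p ('D_w ('D_v (cmap A l.1 \o cinv A l'.1))
    (cmap A l'.1 m.1)) := f_equal (pairing p) (esym (D2 v)).
exact: etrans (pairingDl _ _ _) (f_equal2 +%R C1 (etrans C2 C3)).
Qed.

(** Changes of canonical charts are symplectic: the second derivatives of the
    change of charts of the base cancel by symmetry. *)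
Lemma cotangent_change_symplectic l l' m zeta xi :
  cdom A l.1 m.1 -> cdom A l'.1 m.1 ->
  symplectic (change B l l' m zeta) (change B l l' m xi) = symplectic zeta xi.
Proof.
move=> lm l'm.
pose D2 u v := pairing (cochange m.1 l.1 m.1 m.2)
  ('D_u ('D_v (cmap A l.1 \o cinv A l'.1)) (cmap A l'.1 m.1)).
pose ch (w : 'rV[R]_(n + n)) := change A l.1 l'.1 m.1 (lsubmx w).
have E (w v : 'rV[R]_(n + n)) : pairing (rsubmx (change B l l' m w)) (lsubmx (change B l l' m v)) =
    pairing (rsubmx w) (lsubmx v) + D2 (ch w) (ch v).
  have EL := lsubmx_cotangent_change v lm l'm.
  have ER := pairing_rsubmx_cotangent_change w (ch v) lm l'm.
  have K := changeK Aat (lsubmx v) lm l'm.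
  apply: etrans (f_equal _ EL) _; apply: etrans ER _.
  exact: (f_equal (fun r => pairing (rsubmx w) r + D2 (ch w) (ch v)) K).
have C : D2 (ch zeta) (ch xi) = D2 (ch xi) (ch zeta).
  exact: (f_equal (pairing _) (change_commute (ch zeta) (ch xi) l'm lm)).
have cancel (b c e f : R) : e = f -> b + e - (c + f) = b - c.
  by move=> ->; rewrite opprD addrACA subrr addr0.
apply: etrans (f_equal2 (fun a b => a - b) (E zeta xi) (E xi zeta)) _.
exact: cancel C.
Qed.

End Manifold.

#[local] Opaque cochange.

(** * Orthonormal bases *)

Section OrthonormalFrame.
Context {R : realType} {n : nat}.
Variables (inner : 'rV[R]_n -> 'rV[R]_n -> R).
Hypothesis inner_sym : forall u v, inner u v = inner v u.
Hypothesis inner_lin : forall v a u u', inner v (a *: u + u') = a * inner v u + inner v u'.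
Hypothesis inner_pos : forall u, u != 0 -> 0 < inner u u.

Lemma inner_linl v a u u' : inner (a *: u + u') v = a * inner u v + inner u' v.
Proof. by rewrite inner_sym inner_lin !(inner_sym v). Qed.

Lemma inner_r0 v : inner v 0 = 0.
Proof.
have := inner_lin v 1 0 0; rewrite scaler0 addr0 mul1r => /esym/eqP.
by rewrite -subr_eq0 addrK => /eqP.
Qed.

Lemma inner_scaler v a u : inner v (a *: u) = a * inner v u.
Proof. by rewrite -[a *: u]addr0 inner_lin inner_r0 addr0. Qed.

Lemma inner_scalel v a u : inner (a *: u) v = a * inner u v.
Proof. by rewrite inner_sym inner_scaler inner_sym. Qed.

Lemma inner_sumr (I : Type) (r : seq I) v (f : I -> 'rV[R]_n) :
  inner v (\sum_(i <- r) f i) = \sum_(i <- r) inner v (f i).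
Proof.
elim: r => [|i r IH]; first by rewrite !big_nil inner_r0.
by rewrite !big_cons -[f i]scale1r inner_lin mul1r IH scale1r.
Qed.

Lemma inner_inj u v : (forall w, inner u w = inner v w) -> u = v.
Proof.
move=> uv; apply/eqP; rewrite -subr_eq0; apply/negPn/negP => /inner_pos.
have : inner (u - v) (u - v) = 0.
  set w := (X in inner _ X).
  by rewrite addrC -scaleN1r inner_linl uv mulN1r addNr.
by move=> ->; rewrite ltxx.
Qed.

Definition orthonormal_family (k : nat) (e : nat -> 'rV[R]_n) : Prop :=
  forall i j, (i < k)%N -> (j < k)%N -> inner (e i) (e j) = (i == j)%:R.

(** Gram-Schmidt step: [k < n] linear equations have a nonzero solution. *)
Lemma orthonormal_extend k e : (k < n)%N -> orthonormal_family k e ->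
  exists e', orthonormal_family k.+1 e' /\ forall i, (i < k)%N -> e' i = e i.
Proof.
move=> kn eo.
pose B := \matrix_(j < n, i < k) inner (e i) (delta_mx 0 j).
have ker0 : kermx B != 0.
  rewrite -mxrank_eq0 mxrank_ker subn_eq0 -ltnNge.
  exact: leq_ltn_trans (rank_leq_col B) kn.
have /rowV0Pn [v vB v0] := ker0.
have {}vB : v *m B = 0 by apply/sub_kermxP.
have ev i : (i < k)%N -> inner (e i) v = 0.
  move=> ik; have := congr1 (fun m : 'rV_k => m 0 (Ordinal ik)) vB.
  rewrite !mxE => <-; rewrite {1}(row_sum_delta v) inner_sumr.
  by apply: eq_bigr => j _; rewrite inner_scaler !mxE.
have vv := inner_pos v0.
pose r := (Num.sqrt (inner v v))^-1.
have r2 : r * (r * inner v v) = 1.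
  rewrite mulrA -expr2 exprVn sqr_sqrtr ?ltW // mulVf //.
  by rewrite gt_eqF.
exists (fun i => if i == k then r *: v else e i); split; last first.
  by move=> i ik; rewrite ltn_eqF.
move=> i j; rewrite !ltnS [(i <= k)%N]leq_eqVlt [(j <= k)%N]leq_eqVlt.
have [->|ik] := eqVneq i k; have [->|jk] := eqVneq j k => //=.
- by rewrite inner_scaler inner_scalel r2.
- by move=> _ jk'; rewrite inner_scalel inner_sym ev // mulr0.
- by move=> /= ik' _; rewrite inner_scaler ev ?mulr0 ?(negbTE ik).
- by move=> ik' jk'; apply: eo.
Qed.

(** An orthonormal family of [n] vectors is a basis, because the pairing with
    its members recovers the coefficients of any combination. *)
Lemma orthonormal_basis (x : 'rV[R]_n) : (0 < n)%N -> inner x x = 1 ->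
  exists e, [/\ e 0%N = x, orthonormal_family n e &
    forall v, v = \sum_(i < n) inner (e i) v *: e i].
Proof.
move=> n0 xx.
have ex k : (k < n)%N -> exists e, e 0%N = x /\ orthonormal_family k.+1 e.
  elim: k => [_|k IH kn].
    by exists (fun _ => x); split=> // i j; rewrite !ltnS !leqn0 => /eqP-> /eqP->.
  have [e [e0 eo]] := IH (ltnW kn).
  have [e' [e'o e'e]] := orthonormal_extend kn eo.
  by exists e'; rewrite e'e.
have [e [e0 eo]] : exists e, e 0%N = x /\ orthonormal_family n e.
  by move: (ex n.-1); rewrite prednK // => /(_ (leqnn _)).
exists e; split=> // v.
pose P := \matrix_(i < n, j < n) e i 0 j.
have rowP_ (c : 'rV[R]_n) : c *m P = \sum_i c 0 i *: e i.
  apply/rowP => j; rewrite mxE summxE; apply: eq_bigr => i _.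
  by rewrite !mxE.
have coef (c : 'rV[R]_n) (i : 'I_n) : inner (e i) (c *m P) = c 0 i.
  rewrite rowP_ inner_sumr (bigD1 i) //= inner_scaler eo // eqxx mulr1.
  rewrite big1 ?addr0 // => j ji; rewrite inner_scaler eo //.
  have -> : (nat_of_ord i == j) = false by rewrite eq_sym; apply: negbTE.
  by rewrite mulr0.
have Pu : P \in unitmx.
  rewrite -row_free_unit -kermx_eq0; apply/negPn/negP => /rowV0Pn[c cP c0].
  have {}cP : c *m P = 0 by apply/sub_kermxP.
  case/negP: c0; apply/eqP/rowP => i.
  by rewrite -coef cP inner_r0 mxE.
have -> : \sum_(i < n) inner (e i) v *: e i =
    \sum_(i < n) (v *m invmx P) 0 i *: e i.
  by apply: eq_bigr => i _; rewrite -coef mulmxKV.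
by rewrite -rowP_ mulmxKV.
Qed.

End OrthonormalFrame.

(** * Exterior derivative in charts *)

Section Forms.
Context {R : realType} {n : nat} {M : topologicalType} (A : atlas R n M).
Hypothesis Aman : is_smooth_manifold A.
Let Aat := manifold_diff_atlas Aman.
Variable w : M -> 'rV[R]_n.

Definition form_in_chart (a : M) (z : 'rV[R]_n) : 'rV[R]_n :=
  covector_in_chart A a (cinv A a z) (w (cinv A a z)).

Lemma pairing_form_in_chart a z v : cdom A a (cinv A a z) ->
  pairing (form_in_chart a z) v =
  pairing (w (cinv A a z)) (change A a (cinv A a z) (cinv A a z) v).
Proof. by move=> az; rewrite (pairing_covector_in_chart Aat). Qed.

(** The usual formula for the exterior derivative in the chart [a]. *)
Definition ext_deriv_in_chart (a : M) (q u v : 'rV[R]_n) : R :=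
  pairing ('D_u (form_in_chart a) q) v - pairing ('D_v (form_in_chart a) q) u.

Lemma field_in_chart_const a v : \forall z \near cmap A a a,
  field_in_chart A a (const_field A a v) z = v.
Proof.
have aa := da_center Aat a.
apply: near_imp (da_near Aat aa) _ => z [az _].
have zz := da_center Aat (cinv A a z).
exact: (changeK Aat v az zz).
Qed.

Lemma const_fieldE a v : const_field A a v a = v.
Proof. exact: (change_id Aat v (da_center Aat a)). Qed.

Lemma derive_near_const (q : 'rV[R]_n) u (c : 'rV[R]_n) (f : 'rV[R]_n -> 'rV[R]_n) :
  (\forall z \near q, f z = c) -> 'D_u f q = 0.
Proof.
by move=> fc; rewrite (near_eq_derive (g := fun _ => c)) // (has_D_cst c q).2.
Qed.

(** Fields with constant components in a chart commute, which is why [ext_deriv]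
    reduces to the usual formula in coordinates. *)
Lemma bracket_const a u v :
  bracket A (const_field A a u) (const_field A a v) a = 0.
Proof.
have E u1 v1 : 'D_u1 (field_in_chart A a (const_field A a v1)) (cmap A a a) = 0.
  exact: derive_near_const (field_in_chart_const a v1).
rewrite /bracket [X in X - _]E [X in _ - X]E; exact: subrr.
Qed.

Lemma dfun_form_const a u v : differentiable (form_in_chart a) (cmap A a a) ->
  dfun A (fun y => pairing (w y) (const_field A a v y)) a u =
  pairing ('D_u (form_in_chart a) (cmap A a a)) v.
Proof.
move=> dw; have aa := da_center Aat a.
have := has_D_pairing (has_D_self dw) (has_D_cst v (cmap A a a)).
move=> [_ D]; apply: etrans
  (_ : _ = pairing ('D_u (form_in_chart a) (cmap A a a)) v +
     pairing (form_in_chart a (cmap A a a)) 0) _; last first.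
  by rewrite [X in _ + X]pairing0r addr0.
apply: etrans _ (D u).
apply: near_eq_derive; apply: near_imp (da_near Aat aa) _ => z [az _].
by rewrite pairing_form_in_chart.
Qed.

Lemma ext_derivE a u v : differentiable (form_in_chart a) (cmap A a a) ->
  ext_deriv A w a u v = ext_deriv_in_chart a (cmap A a a) u v.
Proof.
move=> dw; have E1 := dfun_form_const u v dw; have E2 := dfun_form_const v u dw.
rewrite /ext_deriv /ext_deriv_fields bracket_const pairing0r subr0.
rewrite !const_fieldE.
exact: (f_equal2 (fun b c : R => b - c) E1 E2).
Qed.

(** The exterior derivative does not depend on the chart: the second
    derivatives of the change of charts cancel by symmetry. *)
Lemma ext_deriv_change a y u v : cdom A a y ->
  differentiable (form_in_chart a) (cmap A a y) ->
  differentiable (form_in_chart y) (cmap A y y) ->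
  ext_deriv_in_chart a (cmap A a y) u v =
  ext_deriv A w y (change A a y y u) (change A a y y v).
Proof.
move=> ay da dy; have yy := da_center Aat y.
rewrite (ext_derivE _ _ dy).
have E u1 v1 : pairing ('D_u1 (form_in_chart a) (cmap A a y)) v1 =
    pairing ('D_(change A a y y u1) (form_in_chart y) (cmap A y y))
            (change A a y y v1) +
    pairing (form_in_chart y (cmap A y y))
      ('D_u1 ('D_v1 (cmap A y \o cinv A a)) (cmap A a y)).
  have [_ D1] := has_D_pairing (has_D_self da) (has_D_cst v1 (cmap A a y)).
  have P0 : 'D_u1 (fun z => pairing (form_in_chart a z) v1) (cmap A a y) =
      pairing ('D_u1 (form_in_chart a) (cmap A a y)) v1.
    by apply: etrans (D1 u1) _; rewrite [X in _ + X]pairing0r addr0.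
  apply: etrans (esym P0) _.
  have Dt := has_D_transition Aat ay yy.
  have Et : cmap A y (cinv A a (cmap A a y)) = cmap A y y.
    by rewrite (da_coordK Aat ay).
  have Dw := has_D_comp_at Et Dt (has_D_self dy).
  have Dc := has_D_change Aman v1 ay yy.
  have [_ D2] := has_D_pairing Dw Dc.
  have D2u := D2 u1; rewrite Et (da_coordK Aat ay) in D2u.
  apply: etrans _ D2u.
  apply: near_eq_derive.
  have N := near_and (da_near Aat ay) (da_overlap Aat ay yy).
  apply: near_imp N _ => z [[az zE] yz].
  have mm := da_center Aat (cinv A a z).
  have K : cinv A y (cmap A y (cinv A a z)) = cinv A a z.
    exact: (da_coordK Aat yz).
  have yz' : cdom A y (cinv A y (cmap A y (cinv A a z))) by rewrite K.
  have E2 := pairing_form_in_chart (change A a y (cinv A a z) v1) yz'.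
  rewrite K in E2.
  apply: etrans (pairing_form_in_chart v1 az) _; apply: etrans _ (esym E2).
  exact: (f_equal (pairing _) (esym (change_trans Aat v1 az yz mm))).
have C := f_equal (pairing (form_in_chart y (cmap A y y)))
  (change_commute Aman u v ay yy).
have cancel (b c e f : R) : e = f -> b + e - (c + f) = b - c.
  by move=> ->; rewrite opprD addrACA subrr addr0.
apply: etrans (f_equal2 (fun b c : R => b - c) (E u v) (E v u)) _.
exact: cancel C.
Qed.

End Forms.

(** * The cometric *)

Section Geometry.
Context {R : realType} {d : nat} {M : topologicalType}.
Local Notation n := (d.*2.+1).
Variable A : atlas R n M.
Hypothesis Aman : is_smooth_manifold A.
Let Aat := manifold_diff_atlas Aman.
Variable omega : M -> 'rV[R]_n.
Variable g : M -> 'rV[R]_n -> 'rV[R]_n -> R.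
Hypothesis g_metric : is_horizontal_metric A omega g.
Variable X0 : M -> 'rV[R]_n.
Hypothesis X0_unit : forall x, pairing (omega x) (X0 x) = 1.

Local Notation gg := (extended_metric omega X0 g).
Local Notation B := (cotangent_atlas A).

Definition hor_part (x : M) (u : 'rV[R]_n) : 'rV[R]_n :=
  u - pairing (omega x) u *: X0 x.

Lemma hor_partP x u : horizontal omega x (hor_part x u).
Proof.
by rewrite /horizontal /= /hor_part pairingBr pairingZr X0_unit mulr1 subrr.
Qed.

Lemma hor_part_linear x a u v :
  hor_part x (a *: u + v) = a *: hor_part x u + hor_part x v.
Proof.
rewrite /hor_part pairingDr pairingZr scalerDl opprD addrACA -scalerA.
by rewrite scalerBr.
Qed.

Lemma extended_metricE x u v : gg x u v =
  g x (hor_part x u) (hor_part x v) + pairing (omega x) u * pairing (omega x) v.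
Proof. by []. Qed.

Lemma extended_metric_sym x u v : gg x u v = gg x v u.
Proof.
rewrite !extended_metricE mulrC; congr (_ + _).
by apply: (hm_sym g_metric); exact: hor_partP.
Qed.

Lemma extended_metric_linear x v a u u' : gg x v (a *: u + u') = a * gg x v u + gg x v u'.
Proof.
rewrite extended_metric_sym (extended_metric_sym x v u).
rewrite (extended_metric_sym x v u') !extended_metricE.
rewrite hor_part_linear (hm_lin g_metric) ?pairingDr ?pairingZr;
  try exact: hor_partP.
by ring.
Qed.

Lemma hor_part_id x u : horizontal omega x u -> hor_part x u = u.
Proof. by move=> uh; rewrite /hor_part (uh : _ = _) scale0r subr0. Qed.

Lemma extended_metric_horizontal x u v : horizontal omega x u -> horizontal omega x v ->
  gg x u v = g x u v.
Proof.
move=> uh vh; rewrite extended_metricE !hor_part_id //.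
by rewrite (uh : _ = _) mul0r addr0.
Qed.

Lemma metric0l x v : horizontal omega x v -> g x 0 v = 0.
Proof.
move=> vh; have h0 : horizontal omega x 0 by exact: pairing0r.
have := hm_lin g_metric 1 h0 h0 vh; rewrite scaler0 addr0 mul1r.
by move/esym/eqP; rewrite -subr_eq0 addrK => /eqP.
Qed.

Lemma extended_metric_reeb x v : gg x (X0 x) v = pairing (omega x) v.
Proof.
rewrite extended_metricE {1}/hor_part X0_unit scale1r subrr metric0l ?mul1r ?add0r//.
exact: hor_partP.
Qed.

Lemma extended_metric_gt0 x u : u != 0 -> 0 < gg x u u.
Proof.
move=> u0; rewrite extended_metricE.
have [h0|hn0] := eqVneq (hor_part x u) 0; last first.
  apply: ltr_wpDr; first by rewrite -expr2 sqr_ge0.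
  by apply: (hm_pos g_metric) => //; exact: hor_partP.
rewrite {1}h0 metric0l ?add0r; last exact: hor_partP.
rewrite -expr2 lt0r sqr_ge0 andbT sqrf_eq0.
apply: contraNneq u0 => wu; move: h0; rewrite /hor_part wu scale0r subr0.
by move=> ->.
Qed.

(** Gram-Schmidt for the extended metric, started at the Reeb field: the other
    vectors are then horizontal, and orthonormal for [g]. *)
Lemma orthonormal_frame_exists x : exists e : 'I_d.*2 -> 'rV[R]_n,
  is_orthonormal_frame omega g x e /\
  forall v, v = pairing (omega x) v *: X0 x + \sum_i gg x (e i) v *: e i.
Proof.
have XX : gg x (X0 x) (X0 x) = 1 by rewrite extended_metric_reeb X0_unit.
have [e [e0 eo ev]] := orthonormal_basis (extended_metric_sym x) (extended_metric_linear x)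
  (@extended_metric_gt0 x) (ltn0Sn _) XX.
have eh (i : 'I_d.*2) : horizontal omega x (e i.+1).
  by rewrite /horizontal /= -extended_metric_reeb -e0 eo // ltnS.
exists (fun i => e i.+1); split; last first.
  move=> v; rewrite {1}[v]ev big_ord_recl e0 extended_metric_reeb; congr (_ + _).
split=> // i j; rewrite -extended_metric_horizontal // eo // ?ltnS //.
Qed.

Variable H : M * 'rV[R]_n -> R.
Hypothesis H_def : is_hamiltonian omega g H.
Variable Hvec : M * 'rV[R]_n -> 'rV[R]_(n + n).
Hypothesis Hvec_def : is_hamiltonian_field A H Hvec.

(** The horizontal vector dual to the covector [p]: it is the velocity of the
    extremal through [(x, p)]. *)
Definition sharp (x : M) (p : 'rV[R]_n) : 'rV[R]_n := lsubmx (Hvec (x, p)).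

(** On one fibre the Hamiltonian is a sum of squares of linear forms. Its
    derivative along a vertical line is that of a polynomial, and it determines
    the position component of the Hamiltonian field. *)
Lemma sharp_frame x p (e : 'I_d.*2 -> 'rV[R]_n) :
  is_orthonormal_frame omega g x e ->
  sharp x p = \sum_i pairing p (e i) *: e i.
Proof.
move=> eP; apply: pairing_inj => b; rewrite ![pairing _ b]pairingC.
have xx := da_center Aat x.
have E : pairing b (sharp x p) = dfun B H (x, p) (row_mx 0 b).
  by rewrite Hvec_def /symplectic row_mxKl row_mxKr pairing0r subr0.
rewrite E /dfun derive_line.
pose F (h : R) := 2^-1 * \sum_(i < d.*2)
   (pairing p (e i) + h * pairing b (e i)) ^+ 2.
have DF : has_D F 0 (fun h => h * \sum_i pairing p (e i) * pairing b (e i)).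
  have Di i : has_D (fun h : R => pairing p (e i) + h * pairing b (e i)) 0
      (fun h => h * pairing b (e i)).
    apply: has_D_eq (has_D_add (has_D_cst _ _)
      (has_D_mul (has_D_id (0 : R)) (has_D_cst _ _))) _ => h.
    by rewrite mulr0 addr0 add0r.
  have D := has_D_scale 2^-1 (has_D_sum (fun i => has_D_mul (Di i) (Di i))).
  apply: has_D_eq (has_D_ext _ D) _ => h.
    by rewrite /F; congr (_ * _); apply: eq_bigr => i _; rewrite expr2.
  rewrite mulr_sumr -[_ *: _]/(_ * _) mulr_sumr; apply: eq_bigr => i _.
  by rewrite mul0r addr0; field.
have -> : (fun h : R => (H \o cinv B (x, p))
    (h *: row_mx 0 b + cmap B (x, p) (x, p))) = F.
  apply/funext => h.
  have cid q : cochange A x x x q = q by exact: cochange_id.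
  have Ez : h *: row_mx 0 b + cmap B (x, p) (x, p) =
      row_mx (cmap A x x) (h *: b + p).
    by rewrite cotangent_cmapE cid scale_row_mx scaler0 add_row_mx add0r.
  have Ec : cinv B (x, p) (row_mx (cmap A x x) (h *: b + p)) =
      (x, h *: b + p).
    by rewrite cotangent_cinvE row_mxKl row_mxKr (da_coordK Aat xx) cid.
  rewrite -[LHS]/(H (cinv B (x, p) _)) Ez Ec.
  rewrite /F (H_def _ eP); congr (_ * _); apply: eq_bigr => i _.
  by rewrite pairingDl pairingZl addrC.
rewrite DF.2 mul1r pairing_sumr; apply: eq_bigr => i _.
by rewrite pairingZr.
Qed.

Lemma sharp_linear x a p q : sharp x (a *: p + q) = a *: sharp x p + sharp x q.
Proof.
have [e [eP _]] := orthonormal_frame_exists x.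
rewrite !(sharp_frame _ eP) scaler_sumr -big_split; apply: eq_bigr => i _ /=.
by rewrite pairingDl pairingZl scalerDl scalerA.
Qed.

Lemma sharp_hor x p : pairing (omega x) (sharp x p) = 0.
Proof.
have [e [eP _]] := orthonormal_frame_exists x.
rewrite (sharp_frame _ eP) pairing_sumr big1 // => i _.
by rewrite pairingZr (eP.1 i : _ = _) mulr0.
Qed.

Lemma extended_metric_sharp x p v :
  gg x (sharp x p) v = pairing p v - pairing (omega x) v * pairing p (X0 x).
Proof.
have [e [eP ev]] := orthonormal_frame_exists x.
rewrite extended_metric_sym (sharp_frame _ eP) (inner_sumr (extended_metric_linear x)).
have {2}-> := ev v; rewrite pairingDr pairingZr addrAC subrr add0r pairing_sumr.
apply: eq_bigr => i _; rewrite (inner_scaler (extended_metric_linear x)) pairingZr mulrC.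
by rewrite extended_metric_sym.
Qed.

Lemma hamiltonian_sharp x p : H (x, p) = 2^-1 * pairing p (sharp x p).
Proof.
have [e [eP _]] := orthonormal_frame_exists x.
rewrite (H_def _ eP) (sharp_frame _ eP) pairing_sumr.
by congr (_ * _); apply: eq_bigr => i _; rewrite pairingZr expr2.
Qed.

Lemma extended_metric_inj x u v : (forall w, gg x u w = gg x v w) -> u = v.
Proof.
exact: inner_inj (extended_metric_sym x) (extended_metric_linear x)
  (@extended_metric_gt0 x) u v.
Qed.

Lemma sharp_symmetric x p q : pairing p (sharp x q) = pairing q (sharp x p).
Proof.
have E p1 q1 : gg x (sharp x p1) (sharp x q1) = pairing p1 (sharp x q1).
  by rewrite extended_metric_sharp sharp_hor mul0r subr0.
by rewrite -!E extended_metric_sym.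
Qed.

(** If [sharp x p] vanishes, [extended_metric_sharp] says that [p] vanishes on
    the horizontal parts of all vectors. *)
Lemma sharp_eq0 x p : sharp x p = 0 -> p = pairing p (X0 x) *: omega x.
Proof.
move=> p0; apply: pairing_inj => v; rewrite pairingZl mulrC.
apply/eqP; rewrite -subr_eq0 -extended_metric_sharp p0 extended_metric_sym.
by rewrite (inner_r0 (extended_metric_linear x)).
Qed.

End Geometry.

(** * The cometric in a chart *)

Section ChartGeometry.
Context {R : realType} {d : nat} {M : topologicalType}.
Local Notation n := (d.*2.+1).
Variable A : atlas R n M.
Hypothesis Aman : is_smooth_manifold A.
Let Aat := manifold_diff_atlas Aman.
Variable omega : M -> 'rV[R]_n.
Hypothesis omega_smooth : forall x, smooth_form_at A omega x.
Variable g : M -> 'rV[R]_n -> 'rV[R]_n -> R.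
Hypothesis g_metric : is_horizontal_metric A omega g.
Variable X0 : M -> 'rV[R]_n.
Hypothesis X0_smooth : forall x, smooth_field_at A X0 x.
Hypothesis X0_unit : forall x, pairing (omega x) (X0 x) = 1.
Local Notation B := (cotangent_atlas A).
Variable H : M * 'rV[R]_n -> R.
Hypothesis H_def : is_hamiltonian omega g H.
Variable Hvec : M * 'rV[R]_n -> 'rV[R]_(n + n).
Hypothesis Hvec_def : is_hamiltonian_field A H Hvec.
Variables (W : set (R * (M * 'rV[R]_n)))
  (flow : R -> M * 'rV[R]_n -> M * 'rV[R]_n).
Hypothesis flowP : is_flow B Hvec W flow.
Let Bat := cotangent_diff_atlas Aman.
Local Notation sharp := (sharp Hvec).

Definition sharp_chart (a : M) (q alpha : 'rV[R]_n) : 'rV[R]_n :=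
  change A (cinv A a q) a (cinv A a q)
    (sharp (cinv A a q) (cochange A a (cinv A a q) (cinv A a q) alpha)).

Lemma cochange_linear a b x c p q :
  cochange A a b x (c *: p + q) = c *: cochange A a b x p + cochange A a b x q.
Proof.
apply/rowP => i; rewrite !cochangeE mxE [in RHS]mxE [X in _ = X + _]mxE.
by rewrite [X in _ * X]mxE [X in _ = _ + X]mxE pairingDl pairingZl.
Qed.

Lemma sharp_chart_linear a q c p1 p2 : cdom A a (cinv A a q) ->
  sharp_chart a q (c *: p1 + p2) =
  c *: sharp_chart a q p1 + sharp_chart a q p2.
Proof.
move=> aq; have yy := da_center Aat (cinv A a q).
rewrite /sharp_chart cochange_linear.
rewrite (sharp_linear Aman g_metric X0_unit H_def Hvec_def).
exact: (change_linear Aat).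
Qed.

(** The matrix of the cometric in the chart [a]. *)
Definition sharp_mx (a : M) (q : 'rV[R]_n) : 'M[R]_n :=
  \matrix_(i, j) sharp_chart a q (delta_mx 0 i) 0 j.

Lemma sharp_mxE a q p : cdom A a (cinv A a q) ->
  p *m sharp_mx a q = sharp_chart a q p.
Proof.
move=> aq; have L c u v := sharp_chart_linear c u v aq.
rewrite [RHS](linear_sum_delta L); apply/rowP => j; rewrite mxE summxE.
by apply: eq_bigr => i _; rewrite !mxE.
Qed.

Lemma lsubmx_field_in_chart l z : cdom A l.1 (cinv A l.1 (lsubmx z)) ->
  lsubmx (field_in_chart B l Hvec z) = sharp_chart l.1 (lsubmx z) (rsubmx z).
Proof.
move=> lz; rewrite /field_in_chart.
exact: (lsubmx_cotangent_change Aman (l := cinv B l z) (m := cinv B l z) (l' := l)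
  _ (da_center Aat (cinv B l z).1) lz).
Qed.

(** The Hamiltonian field is the time derivative of its smooth flow. *)
Lemma field_in_chart_smooth a p :
  smooth_near (field_in_chart B (a, p) Hvec) (row_mx (cmap A a a) p).
Proof.
have zE : cmap B (a, p) (a, p) = row_mx (cmap A a a) p.
  rewrite cotangent_cmapE /=.
  by have -> : cochange A a a a p = p by apply: (cochange_id Aman); apply: (da_center Aat).
rewrite -zE.
apply: (@smooth_near_eq _ _ _
  (fun y => 'D_(1, 0) (chart_flow B flow (a, p)) (0, y))).
  exact: (chart_flow_time Bat flowP).
have aff (y : 'rV[R]_(n + n)) :
    has_D (fun y : 'rV[R]_(n + n) => (0 : R, y)) y (fun v => (0, v)).
  exact: has_D_pair (has_D_cst (0 : R) y) (has_D_id y).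
apply: (@smooth_near_affine _ _ _ _ ('D_(1, 0) (chart_flow B flow (a, p)))
  _ _ _ aff).
apply: smooth_near_derive.
exact: (chart_flow_smooth flowP).
Qed.

(** The cometric is the position component of the Hamiltonian field at a
    constant covector, and inherits its smoothness; the metric is never
    differentiated in coordinates. *)
Lemma sharp_chart_smooth a p :
  smooth_near (fun q => sharp_chart a q p) (cmap A a a).
Proof.
have aa := da_center Aat a.
apply: (@smooth_near_eq _ _ _
  (fun q => lsubmx (field_in_chart B (a, p) Hvec (row_mx q p)))).
  apply: near_imp (da_near Aat aa) _ => q [aq _].
  rewrite lsubmx_field_in_chart; last by rewrite row_mxKl.
  by rewrite row_mxKl row_mxKr.
apply: smooth_near_linear.
have aff (y : 'rV[R]_n) :
    has_D (fun y : 'rV[R]_n => row_mx y p) y (fun v => row_mx v 0).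
  exact: has_D_row_mx (has_D_id y) (has_D_cst p y).
apply: (@smooth_near_affine _ _ _ _ (field_in_chart B (a, p) Hvec) _ _ _ aff).
exact: field_in_chart_smooth.
Qed.

Lemma sharp_mx_differentiable a :
  \forall q \near cmap A a a, differentiable (sharp_mx a) q.
Proof.
have N : \forall q \near cmap A a a, forall i : 'I_n,
    differentiable (fun q => sharp_chart a q (delta_mx 0 i)) q.
  apply: near_forall => i.
  exact: smooth_near_differentiable (sharp_chart_smooth a _).
apply: near_imp N _ => q dq.
have D i j := has_D_coord 0 j (has_D_self (dq i)).
have [] // := @has_D_mx _ _ _ _ (sharp_mx a) q
  (fun v => \matrix_(i, j) ('D_v (fun q => sharp_chart a q (delta_mx 0 i)) q) 0 j) _.
move=> i j; apply: has_D_eq (has_D_ext _ (D i j)) _ => v; by rewrite mxE.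
Qed.

Lemma form_in_chart_differentiable a :
  \forall q \near cmap A a a, differentiable (form_in_chart A omega a) q.
Proof. exact: smooth_near_differentiable (omega_smooth a). Qed.

Lemma reeb_in_chart_differentiable a :
  \forall q \near cmap A a a, differentiable (field_in_chart A a X0) q.
Proof. exact: smooth_near_differentiable (X0_smooth a). Qed.

Lemma pairing_field_in_chart a q p V : cdom A a (cinv A a q) ->
  pairing p (field_in_chart A a V q) =
  pairing (cochange A a (cinv A a q) (cinv A a q) p) (V (cinv A a q)).
Proof.
move=> aq; have yy := da_center Aat (cinv A a q).
by rewrite (pairing_cochange Aman p (V (cinv A a q)) aq yy).
Qed.

Lemma form_field_in_chart a q V : cdom A a (cinv A a q) ->
  pairing (form_in_chart A omega a q) (field_in_chart A a V q) =
  pairing (omega (cinv A a q)) (V (cinv A a q)).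
Proof.
move=> aq; have yy := da_center Aat (cinv A a q).
have E := pairing_form_in_chart Aman omega (field_in_chart A a V q) aq.
apply: etrans E _; congr (pairing _ _).
exact: (changeK Aat (V (cinv A a q)) yy aq).
Qed.

Lemma sharp_chart_hor a q p : cdom A a (cinv A a q) ->
  pairing (form_in_chart A omega a q) (sharp_chart a q p) = 0.
Proof.
move=> aq; rewrite -(sharp_hor Aman g_metric X0_unit H_def Hvec_def (cinv A a q)
  (cochange A a (cinv A a q) (cinv A a q) p)).
exact: (@form_field_in_chart a q (fun y => sharp y (cochange A a y y p)) aq).
Qed.

Lemma sharp_chart_symmetric a q p1 p2 : cdom A a (cinv A a q) ->
  pairing p1 (sharp_chart a q p2) = pairing p2 (sharp_chart a q p1).
Proof.
move=> aq.
have E p p' := @pairing_field_in_chart a q p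
  (fun y => sharp y (cochange A a y y p')) aq.
apply: etrans (E p1 p2) (etrans _ (esym (E p2 p1))).
exact: (sharp_symmetric Aman g_metric X0_unit H_def Hvec_def).
Qed.

Lemma sharp_chart_eq0 a q p : cdom A a (cinv A a q) ->
  sharp_chart a q p = 0 ->
  p = pairing p (field_in_chart A a X0 q) *: form_in_chart A omega a q.
Proof.
move=> aq p0; have yy := da_center Aat (cinv A a q).
set y := cinv A a q in aq p0 yy *.
have s0 : sharp y (cochange A a y y p) = 0.
  have := f_equal (change A a y y) p0.
  by rewrite (changeK Aat _ yy aq) change0.
have E := sharp_eq0 Aman g_metric X0_unit H_def Hvec_def s0.
apply: pairing_inj => v; rewrite pairingZl.
rewrite (pairing_form_in_chart Aman omega v aq).
rewrite pairing_field_in_chart // -/y.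
have K := changeK Aat v aq yy.
have E2 := pairing_cochange Aman p (change A a y y v) aq yy.
rewrite K in E2; rewrite -E2.
by rewrite {1}E pairingZl.
Qed.

End ChartGeometry.

(** * Hamilton's equations and their linearization *)

Section HamiltonField.
Context {R : realType} {d : nat} {M : topologicalType}.
Local Notation n := (d.*2.+1).
Variable A : atlas R n M.
Hypothesis Aman : is_smooth_manifold A.
Let Aat := manifold_diff_atlas Aman.
Variable omega : M -> 'rV[R]_n.
Hypothesis omega_smooth : forall x, smooth_form_at A omega x.
Variable g : M -> 'rV[R]_n -> 'rV[R]_n -> R.
Hypothesis g_metric : is_horizontal_metric A omega g.
Variable X0 : M -> 'rV[R]_n.
Hypothesis X0_smooth : forall x, smooth_field_at A X0 x.
Hypothesis X0_unit : forall x, pairing (omega x) (X0 x) = 1.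
Local Notation B := (cotangent_atlas A).
Variable H : M * 'rV[R]_n -> R.
Hypothesis H_def : is_hamiltonian omega g H.
Variable Hvec : M * 'rV[R]_n -> 'rV[R]_(n + n).
Hypothesis Hvec_def : is_hamiltonian_field A H Hvec.
Variables (W : set (R * (M * 'rV[R]_n)))
  (flow : R -> M * 'rV[R]_n -> M * 'rV[R]_n).
Hypothesis flowP : is_flow B Hvec W flow.
Let Bat := cotangent_diff_atlas Aman.
Local Notation sharp := (sharp Hvec).

Local Notation sharp_chart := (sharp_chart A Hvec).
Local Notation S := (sharp_mx A Hvec).

Lemma hamiltonian_in_chart l z : cdom A l.1 (cinv A l.1 (lsubmx z)) ->
  H (cinv B l z) =
  2^-1 * pairing (rsubmx z) (sharp_chart l.1 (lsubmx z) (rsubmx z)).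
Proof.
move=> lz; rewrite cotangent_cinvE.
rewrite (hamiltonian_sharp Aman g_metric X0_unit H_def Hvec_def).
congr (_ * _); apply: esym.
exact: (@pairing_field_in_chart _ _ _ A Aman l.1 (lsubmx z) (rsubmx z)
  (fun y => sharp y (cochange A l.1 y y (rsubmx z))) lz).
Qed.

Lemma has_D_quadratic a q p : differentiable (S a) q ->
  has_D (fun z : 'rV[R]_(n + n) =>
     2^-1 * pairing (rsubmx z) (rsubmx z *m S a (lsubmx z))) (row_mx q p)
   (fun zeta => 2^-1 * (pairing (rsubmx zeta) (p *m S a q) +
      pairing p (rsubmx zeta *m S a q + p *m 'D_(lsubmx zeta) (S a) q))).
Proof.
move=> dS.
have Dl : has_D (fun z : 'rV[R]_(n + n) => lsubmx z) (row_mx q p) lsubmx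
  by exact: has_D_lin.
have Dr : has_D (fun z : 'rV[R]_(n + n) => rsubmx z) (row_mx q p) rsubmx
  by exact: has_D_lin.
have DS := has_D_comp_at (row_mxKl q p) Dl (has_D_self dS).
have := has_D_scale 2^-1 (has_D_pairing Dr (has_D_mulmx Dr DS)).
by rewrite row_mxKl row_mxKr.
Qed.

(** The Hamiltonian is defined fibre by fibre from orthonormal frames; it is
    differentiable because it is the quadratic form of the smooth cometric. *)
Lemma hamiltonian_differentiable l :
  differentiable (H \o cinv B l) (cmap B l l).
Proof.
have aa := da_center Aat l.1.
have dS := near_self (sharp_mx_differentiable Aman flowP l.1).
have [D _] := has_D_quadratic l.2 dS.
have -> : cmap B l l = row_mx (cmap A l.1 l.1) l.2.
  rewrite cotangent_cmapE.
  by have -> : cochange A l.1 l.1 l.1 l.2 = l.2 by apply: (cochange_id Aman).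
apply: near_eq_differentiable D.
apply: near_imp (near_lsubmx l.2 (da_near Aat aa)) _ => z [lz _].
rewrite [RHS]hamiltonian_in_chart //; congr (_ * pairing _ _).
exact: (sharp_mxE Aman g_metric X0_unit H_def Hvec_def).
Qed.

(** The Hamiltonian field is characterized at each point in the canonical chart
    at this point; as changes of canonical charts are symplectic, Hamilton's
    equations hold in any fixed chart. *)
Lemma hamilton_equation_in_chart l z zeta :
  cdom A l.1 (cinv A l.1 (lsubmx z)) ->
  cmap A l.1 (cinv A l.1 (lsubmx z)) = lsubmx z ->
  'D_zeta (H \o cinv B l) z = symplectic zeta (field_in_chart B l Hvec z).
Proof.
move=> lz lzE; set m := cinv B l z.
have lm : cdom B l m by [].
have mm := da_center Bat m.
have zE : cmap B l m = z.
  rewrite /m cotangent_cinvE cotangent_cmapE /= lzE.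
  rewrite (cochange_trans Aman (rsubmx z) lz (da_center Aat _) lz).
  by rewrite (cochange_id Aman (rsubmx z) lz) hsubmxK.
have Dt := has_D_transition Bat lm mm.
have Et : cmap B m (cinv B l (cmap B l m)) = cmap B m m.
  by rewrite (da_coordK Bat lm).
have [_ D] := @has_D_comp_at _ _ _ _ (fun z => cmap B m (cinv B l z))
  (H \o cinv B m) _ _ _ _ Et Dt (has_D_self (hamiltonian_differentiable m)).
have N : \forall z' \near cmap B l m,
    (H \o cinv B m) (cmap B m (cinv B l z')) = (H \o cinv B l) z'.
  apply: near_imp (da_overlap Bat lm mm) _ => z' mz' /=.
  exact: (f_equal H (da_coordK Bat mz')).
have E1 : 'D_zeta (H \o cinv B l) (cmap B l m) =
    symplectic (change B l m m zeta) (Hvec m).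
  apply: etrans (esym (near_eq_derive zeta N)) _.
  apply: etrans (D zeta) _.
  exact: (Hvec_def m (change B l m m zeta)).
rewrite -zE; apply: etrans E1 _.
have lz2 : cinv B l (cmap B l m) = m by rewrite zE.
rewrite /field_in_chart lz2.
rewrite -(cotangent_change_symplectic Aman zeta _ lm (da_center Aat m.1)).
by rewrite (changeK Bat _ mm lm).
Qed.

Lemma rsubmx_field_in_chart l q p v :
  (\forall q' \near q, cdom A l.1 (cinv A l.1 q') /\
     cmap A l.1 (cinv A l.1 q') = q') ->
  differentiable (S l.1) q ->
  pairing (rsubmx (field_in_chart B l Hvec (row_mx q p))) v =
  - (2^-1 * pairing p (p *m 'D_v (S l.1) q)).
Proof.
move=> nq dS; have [lq lqE] := near_self nq.
have E := hamilton_equation_in_chart (l := l) (z := row_mx q p) (row_mx v 0).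
rewrite row_mxKl in E; have {E} E := E lq lqE.
have [_ D] := has_D_quadratic p dS.
have N : \forall z \near row_mx q p,
   2^-1 * pairing (rsubmx z) (rsubmx z *m S l.1 (lsubmx z)) =
   (H \o cinv B l) z.
  apply: near_imp (near_lsubmx p nq) _ => z [lz _].
  rewrite [RHS]hamiltonian_in_chart //; congr (_ * pairing _ _).
  exact: (sharp_mxE Aman g_metric X0_unit H_def Hvec_def).
have E2 := etrans (near_eq_derive (row_mx v 0) N) E.
have E3 := etrans (esym (D (row_mx v 0))) E2.
rewrite /symplectic row_mxKl row_mxKr !pairing0l mul0mx !add0r in E3.
by rewrite E3 opprK.
Qed.

Lemma sharp_mx_symmetric a q p1 p2 : cdom A a (cinv A a q) ->
  pairing p1 (p2 *m S a q) = pairing p2 (p1 *m S a q).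
Proof.
move=> aq; have E p := sharp_mxE Aman g_metric X0_unit H_def Hvec_def p aq.
have C := sharp_chart_symmetric Aman g_metric X0_unit H_def Hvec_def p1 p2 aq.
exact: etrans (f_equal _ (E p2)) (etrans C (f_equal _ (esym (E p1)))).
Qed.

Lemma derive_sharp_mx_symmetric a q p1 p2 v :
  (\forall q' \near q, cdom A a (cinv A a q')) -> differentiable (S a) q ->
  pairing p1 (p2 *m 'D_v (S a) q) = pairing p2 (p1 *m 'D_v (S a) q).
Proof.
move=> nq dS.
have D b c : has_D (fun q => pairing b (c *m S a q)) q
    (fun v => pairing b (c *m 'D_v (S a) q)).
  have := has_D_pairing (has_D_cst b q)
    (has_D_mulmx (has_D_cst c q) (has_D_self dS)).
  by move=> D; apply: has_D_eq D _ => w; rewrite mul0mx add0r pairing0l add0r.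
apply: etrans (esym ((D p1 p2).2 v)) _; apply: etrans ((D p2 p1).2 v).
apply: near_eq_derive; apply: near_imp nq _ => q' aq'.
exact: sharp_mx_symmetric.
Qed.

Lemma lsubmx_derive_field l q p a b :
  (\forall q' \near q, cdom A l.1 (cinv A l.1 q')) ->
  differentiable (S l.1) q ->
  differentiable (field_in_chart B l Hvec) (row_mx q p) ->
  lsubmx ('D_(row_mx a b) (field_in_chart B l Hvec) (row_mx q p)) =
  b *m S l.1 q + p *m 'D_a (S l.1) q.
Proof.
move=> nq dS dV.
have [_ D1] := has_D_linear lsubmx (has_D_self dV).
rewrite -D1.
have Dl : has_D (fun z : 'rV[R]_(n + n) => lsubmx z) (row_mx q p) lsubmx
  by exact: has_D_lin.
have Dr : has_D (fun z : 'rV[R]_(n + n) => rsubmx z) (row_mx q p) rsubmx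
  by exact: has_D_lin.
have DS := has_D_comp_at (row_mxKl q p) Dl (has_D_self dS).
have [_ D2] := has_D_mulmx Dr DS.
have := D2 (row_mx a b); rewrite !row_mxKl !row_mxKr => E.
apply: etrans _ E; apply: near_eq_derive.
apply: near_imp (near_lsubmx p nq) _ => z lz.
have E1 := lsubmx_field_in_chart Aman Hvec lz.
have E2 := sharp_mxE Aman g_metric X0_unit H_def Hvec_def (rsubmx z) lz.
exact: etrans E1 (esym E2).
Qed.

(** Only the derivative along vertical vectors [row_mx 0 b] is computed: it
    involves first derivatives of the cometric only. *)
Lemma rsubmx_derive_field l q p b v :
  (\forall q' \near q, cdom A l.1 (cinv A l.1 q') /\
     cmap A l.1 (cinv A l.1 q') = q') ->
  differentiable (S l.1) q ->
  differentiable (field_in_chart B l Hvec) (row_mx q p) ->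
  pairing (rsubmx ('D_(row_mx 0 b) (field_in_chart B l Hvec) (row_mx q p))) v =
  - pairing b (p *m 'D_v (S l.1) q).
Proof.
move=> nq dS dV.
have sl : has_D (fun h : R => h *: b + p) 0 (fun h => h *: b).
  have D := has_D_add (has_D_scalel b (has_D_id (0 : R))) (has_D_cst p _).
  by apply: has_D_eq D _ => h; rewrite addr0.
have sl2 := has_D_row_mx (has_D_cst q (0 : R)) sl.
have z0 : row_mx q ((0 : R) *: b + p) = row_mx q p by rewrite scale0r add0r.
have D1 := @has_D_comp_at _ _ _ _ (fun y : R => row_mx q (y *: b + p)) _ _ _ _ _
  z0 sl2 (has_D_self dV).
have D2 := has_D_pairing (has_D_linear rsubmx D1) (has_D_cst v (0 : R)).
have D3 := has_D_opp (has_D_scale 2^-1 (has_D_pairing sl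
  (has_D_mulmx sl (has_D_cst ('D_v (S l.1) q) (0 : R))))).
have E2 : 'D_1 (fun h : R =>
    pairing (rsubmx (field_in_chart B l Hvec (row_mx q (h *: b + p)))) v) 0 =
    pairing (rsubmx ('D_(row_mx 0 b) (field_in_chart B l Hvec) (row_mx q p))) v.
  by apply: etrans (D2.2 1) _; rewrite scale1r [X in _ + X]pairing0r addr0.
apply: etrans (esym E2) _.
have N : (fun h : R =>
    pairing (rsubmx (field_in_chart B l Hvec (row_mx q (h *: b + p)))) v) =
   (fun h : R => - (2^-1 *: pairing (h *: b + p)
         ((h *: b + p) *m 'D_v (S l.1) q))).
  by apply/funext => h; exact: rsubmx_field_in_chart.
rewrite N; apply: etrans (D3.2 1) _.
rewrite scale1r scale0r add0r mulmx0 addr0.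
have nq' : \forall q' \near q, cdom A l.1 (cinv A l.1 q').
  by apply: near_imp nq _ => q' [].
have -> := derive_sharp_mx_symmetric p b v nq' dS.
by rewrite -[_ *: _]/(_ * _); congr (- _); field.
Qed.

End HamiltonField.

(** * The contact endomorphism in a chart *)

Section Endomorphism.
Context {R : realType} {d : nat} {M : topologicalType}.
Local Notation n := (d.*2.+1).
Variable A : atlas R n M.
Hypothesis Aman : is_smooth_manifold A.
Let Aat := manifold_diff_atlas Aman.
Variable omega : M -> 'rV[R]_n.
Hypothesis omega_smooth : forall x, smooth_form_at A omega x.
Variable g : M -> 'rV[R]_n -> 'rV[R]_n -> R.
Hypothesis g_metric : is_horizontal_metric A omega g.
Variable X0 : M -> 'rV[R]_n.
Hypothesis X0_smooth : forall x, smooth_field_at A X0 x.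
Hypothesis X0_unit : forall x, pairing (omega x) (X0 x) = 1.
Local Notation B := (cotangent_atlas A).
Variable H : M * 'rV[R]_n -> R.
Hypothesis H_def : is_hamiltonian omega g H.
Variable Hvec : M * 'rV[R]_n -> 'rV[R]_(n + n).
Hypothesis Hvec_def : is_hamiltonian_field A H Hvec.
Variables (W : set (R * (M * 'rV[R]_n)))
  (flow : R -> M * 'rV[R]_n -> M * 'rV[R]_n).
Hypothesis flowP : is_flow B Hvec W flow.
Let Bat := cotangent_diff_atlas Aman.
Local Notation sharp := (sharp Hvec).

Local Notation S := (sharp_mx A Hvec).
Hypothesis X0_ker : forall x v, ext_deriv A omega x (X0 x) v = 0.
Variable J : M -> 'rV[R]_n -> 'rV[R]_n.
Hypothesis J_def : is_contact_endomorphism A omega X0 g J.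
Local Notation gg := (extended_metric omega X0 g).

Lemma pairing_row_fun (f : 'rV[R]_n -> R) :
  (forall a u v, f (a *: u + v) = a * f u + f v) ->
  forall v, pairing (\row_i f (delta_mx 0 i)) v = f v.
Proof.
move=> fl v; rewrite pairingE.
rewrite (@linear_sum_delta _ _ R^o f fl v); apply: eq_bigr => i _.
by rewrite mxE mulrC.
Qed.

Lemma ext_deriv_in_chart_linear a q v c u1 u2 :
  differentiable (form_in_chart A omega a) q ->
  ext_deriv_in_chart A omega a q v (c *: u1 + u2) =
  c * ext_deriv_in_chart A omega a q v u1 + ext_deriv_in_chart A omega a q v u2.
Proof.
move=> dw; rewrite /ext_deriv_in_chart.
have E := has_D_linear_part dw c u1 u2.
have E2 : pairing ('D_(c *: u1 + u2) (form_in_chart A omega a) q) v =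
  c * pairing ('D_u1 (form_in_chart A omega a) q) v +
  pairing ('D_u2 (form_in_chart A omega a) q) v.
  by apply: etrans (f_equal (fun r => pairing r v) E) _;
     rewrite pairingDl pairingZl.
rewrite [X in X - _]pairingDr [X in X + _ - _]pairingZr [X in _ - X]E2.
have key (k a1 b1 e1 f1 : R) :
  k * a1 + b1 - (k * e1 + f1) = k * (a1 - e1) + (b1 - f1) by ring.
exact: key.
Qed.

Lemma ext_deriv_in_chart_anti a q v u :
  ext_deriv_in_chart A omega a q v u = - ext_deriv_in_chart A omega a q u v.
Proof. by rewrite /ext_deriv_in_chart opprB. Qed.

Lemma form_in_chart_differentiable_center a : differentiable (form_in_chart A omega a) (cmap A a a).
Proof. exact: near_self (form_in_chart_differentiable omega_smooth a). Qed.

Lemma ext_deriv_anti x v u : ext_deriv A omega x v u = - ext_deriv A omega x u v.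
Proof.
apply: etrans (ext_derivE Aman v u (form_in_chart_differentiable_center x)) _.
apply: etrans (ext_deriv_in_chart_anti _ _ _ _) _.
exact: (f_equal -%R (esym (ext_derivE Aman u v (form_in_chart_differentiable_center x)))).
Qed.

Lemma ext_deriv_linear x v c u1 u2 :
  ext_deriv A omega x v (c *: u1 + u2) =
  c * ext_deriv A omega x v u1 + ext_deriv A omega x v u2.
Proof.
have E u := ext_derivE Aman v u (form_in_chart_differentiable_center x).
apply: etrans (E _) _.
apply: etrans (ext_deriv_in_chart_linear _ _ _ _ (form_in_chart_differentiable_center x)) _.
exact: (f_equal2 (fun r s => c * r + s) (esym (E u1)) (esym (E u2))).
Qed.

Definition ext_row (x : M) (v : 'rV[R]_n) : 'rV[R]_n :=
  \row_i ext_deriv A omega x v (delta_mx 0 i).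

Lemma pairing_ext_row x v u : pairing (ext_row x v) u = ext_deriv A omega x v u.
Proof. exact: pairing_row_fun (ext_deriv_linear x v) u. Qed.

(** [J] is the cometric applied to the exterior derivative of the contact form;
    the Reeb field is in the kernel of the latter, so both sides are
    horizontal. *)
Lemma contact_endomorphismE x v : J x v = - sharp x (ext_row x v).
Proof.
apply: (extended_metric_inj g_metric X0_unit (x := x)) => u.
have L := extended_metric_linear g_metric X0_unit.
have SY := extended_metric_sym g_metric X0_unit.
have E : gg x (- sharp x (ext_row x v)) u = - gg x (sharp x (ext_row x v)) u.
  have := inner_scalel (SY x) (L x) u (-1) (sharp x (ext_row x v)).
  by rewrite scaleN1r mulN1r.
apply: etrans (SY x _ _) _; apply: etrans (J_def x u v) _.
apply: etrans _ (esym E).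
have G := extended_metric_sharp Aman g_metric X0_unit H_def Hvec_def x (ext_row x v) u.
apply: etrans _ (f_equal -%R (esym G)).
rewrite !pairing_ext_row (ext_deriv_anti x v (X0 x)) X0_ker oppr0 mulr0 subr0.
exact: ext_deriv_anti.
Qed.

Definition ext_mx (a : M) (q : 'rV[R]_n) : 'M[R]_n :=
  \matrix_(i, j) ext_deriv_in_chart A omega a q (delta_mx 0 i) (delta_mx 0 j).

Lemma pairing_ext_mx a q v u : differentiable (form_in_chart A omega a) q ->
  pairing (v *m ext_mx a q) u = ext_deriv_in_chart A omega a q v u.
Proof.
move=> dw; have L := ext_deriv_in_chart_linear _ _ _ _ dw.
have L1 w c u1 u2 : ext_deriv_in_chart A omega a q (c *: u1 + u2) w =
   c * ext_deriv_in_chart A omega a q u1 w + ext_deriv_in_chart A omega a q u2 w.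
  have E u := ext_deriv_in_chart_anti a q u w.
  apply: etrans (E _) _; apply: etrans (f_equal -%R (L w c u1 u2)) _.
  rewrite opprD -mulrN.
  exact: (f_equal2 (fun r s => c * r + s) (esym (E u1)) (esym (E u2))).
have -> : v *m ext_mx a q =
    \row_j ext_deriv_in_chart A omega a q v (delta_mx 0 j).
  apply/rowP => j; rewrite mxE [RHS]mxE.
  rewrite [RHS](@linear_sum_delta _ _ R^o
    (fun v => ext_deriv_in_chart A omega a q v (delta_mx 0 j)) (L1 _)).
  by apply: eq_bigr => i _; rewrite mxE.
exact: pairing_row_fun (L v) u.
Qed.

Lemma ext_mx_differentiable a :
  \forall q \near cmap A a a, differentiable (ext_mx a) q.
Proof.
have N i : \forall q \near cmap A a a,
    differentiable ('D_(delta_mx 0 i) (form_in_chart A omega a)) q.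
  exact: smooth_near_differentiable (smooth_near_derive _ (omega_smooth a)).
apply: near_imp (near_forall N) _ => q dq.
have D (i j : 'I_n) := has_D_sub
  (has_D_pairing (has_D_self (dq i)) (has_D_cst (delta_mx 0 j) q))
  (has_D_pairing (has_D_self (dq j)) (has_D_cst (delta_mx 0 i) q)).
have Df (i j : 'I_n) : differentiable (fun q => ext_mx a q i j) q.
  suff E : (fun q => ext_mx a q i j) = (fun q =>
    pairing ('D_(delta_mx 0 i) (form_in_chart A omega a) q) (delta_mx 0 j) -
    pairing ('D_(delta_mx 0 j) (form_in_chart A omega a) q) (delta_mx 0 i)).
    by rewrite E; exact: (D i j).1.
  by apply/funext => y; rewrite mxE.
have [] // := @has_D_mx _ _ _ _ (ext_mx a) q
  (fun v => \matrix_(i, j) 'D_v (fun q => ext_mx a q i j) q) _.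
by move=> i j; apply: has_D_eq (has_D_self (Df i j)) _ => v; rewrite [RHS]mxE.
Qed.

(** In a chart [J] is minus a product of two differentiable matrices. *)
Lemma endomorphism_in_chart a : \forall q \near cmap A a a, forall v,
  field_in_chart A a (fun y => J y (const_field A a v y)) q =
  - (v *m ext_mx a q *m S a q).
Proof.
have aa := da_center Aat a.
apply: near_imp2 (da_near Aat aa) (form_in_chart_differentiable omega_smooth a) _.
move=> q [aq aqE] dw v.
set y := cinv A a q in aq aqE *.
have yy := da_center Aat y.
have dwa : differentiable (form_in_chart A omega a) (cmap A a y) by rewrite aqE.
have E : ext_row y (change A a y y v) = cochange A a y y (v *m ext_mx a q).
  apply: pairing_inj => u.
  apply: etrans (pairing_ext_row _ _ _) _.
  apply: etrans _ (esym (pairing_cochange Aman _ u aq yy)).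
  apply: etrans _ (esym (pairing_ext_mx v (change A y a y u) dw)).
  rewrite -[X in ext_deriv_in_chart _ _ _ X]aqE.
  apply: etrans _ (esym (ext_deriv_change Aman v _ aq dwa (form_in_chart_differentiable_center y))).
  exact: (f_equal (ext_deriv A omega y _) (esym (changeK Aat u yy aq))).
have E2 : field_in_chart A a (fun y => J y (const_field A a v y)) q =
    change A y a y (J y (change A a y y v)) by [].
apply: etrans E2 _.
rewrite contact_endomorphismE E -scaleN1r changeZ // scaleN1r; congr (- _).
exact: esym (sharp_mxE Aman g_metric X0_unit H_def Hvec_def _ aq).
Qed.

Lemma endomorphism_field_smooth a v :
  smooth_field_at A (fun y => J y (const_field A a v y)) a.
Proof.
have aa := da_center Aat a.
have sc (u w : 'rV[R]_n) :
    smooth_near (fun q => pairing ('D_u (form_in_chart A omega a) q) w) (cmap A a a).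
  have plin : linear (fun p : 'rV[R]_n => pairing p w : R^o).
    by move=> c p1 p2; rewrite pairingDl pairingZl.
  pose fM := GRing.isLinear.Build _ _ _ _ (fun p : 'rV[R]_n => pairing p w : R^o) plin.
  pose fL : {linear 'rV[R]_n -> R^o} := HB.pack (fun p : 'rV[R]_n => pairing p w : R^o) fM.
  have sD := smooth_near_derive u (omega_smooth a).
  exact: (@smooth_near_linear _ _ _ _ _ fL ('D_u (form_in_chart A omega a)) _ sD).
apply: (@smooth_near_eq _ _ _ (fun q => \sum_(i < n)
  (pairing ('D_(delta_mx 0 i) (form_in_chart A omega a) q) v *:
     sharp_chart A Hvec a q (delta_mx 0 i) +
  pairing ('D_v (form_in_chart A omega a) q) (delta_mx 0 i) *:
   ((-1) *: sharp_chart A Hvec a q (delta_mx 0 i))))).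
  have N := near_and (form_in_chart_differentiable omega_smooth a)
    (near_and (da_near Aat aa) (endomorphism_in_chart a)).
  apply: near_imp N _ => q [dw [[aq _] Jq]].
  rewrite Jq -mulmxA.
  have L c u1 u2 := sharp_chart_linear Aman g_metric X0_unit H_def Hvec_def
    c u1 u2 aq.
  rewrite mulmxA (sharp_mxE Aman g_metric X0_unit H_def Hvec_def _ aq).
  rewrite (linear_sum_delta L) -sumrN; apply: eq_bigr => i _.
  rewrite scaleN1r scalerN -scalerBl -scaleNr; congr (_ *: _).
  have := pairing_ext_mx v (delta_mx 0 i) dw.
  by rewrite pairing_delta => ->; rewrite /ext_deriv_in_chart opprB.
apply: smooth_near_sum => i.
have sS := sharp_chart_smooth Aman flowP a (delta_mx 0 i).
have sS' : smooth_near (fun q => (-1 : R) *: sharp_chart A Hvec a q (delta_mx 0 i))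
    (cmap A a a).
  by apply: smooth_near_scaler => //; exact: smooth_near_cst.
by apply: smooth_near_add; apply: smooth_near_scaler.
Qed.

End Endomorphism.

(** * The Tanno connection in a chart *)

Section Connection.
Context {R : realType} {d : nat} {M : topologicalType}.
Local Notation n := (d.*2.+1).
Variable A : atlas R n M.
Hypothesis Aman : is_smooth_manifold A.
Let Aat := manifold_diff_atlas Aman.
Variable omega : M -> 'rV[R]_n.
Hypothesis omega_smooth : forall x, smooth_form_at A omega x.
Variable g : M -> 'rV[R]_n -> 'rV[R]_n -> R.
Hypothesis g_metric : is_horizontal_metric A omega g.
Variable X0 : M -> 'rV[R]_n.
Hypothesis X0_smooth : forall x, smooth_field_at A X0 x.
Hypothesis X0_unit : forall x, pairing (omega x) (X0 x) = 1.
Local Notation B := (cotangent_atlas A).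
Variable H : M * 'rV[R]_n -> R.
Hypothesis H_def : is_hamiltonian omega g H.
Variable Hvec : M * 'rV[R]_n -> 'rV[R]_(n + n).
Hypothesis Hvec_def : is_hamiltonian_field A H Hvec.
Variables (W : set (R * (M * 'rV[R]_n)))
  (flow : R -> M * 'rV[R]_n -> M * 'rV[R]_n).
Hypothesis flowP : is_flow B Hvec W flow.
Let Bat := cotangent_diff_atlas Aman.
Local Notation sharp := (sharp Hvec).

Local Notation S := (sharp_mx A Hvec).
Variable J : M -> 'rV[R]_n -> 'rV[R]_n.
Variable nabla : M -> 'rV[R]_n -> (M -> 'rV[R]_n) -> 'rV[R]_n.
Hypothesis nabla_tanno : is_tanno_connection A omega X0 g J nabla.
Let nabla_lin := tanno_linear nabla_tanno.
Local Notation gg := (extended_metric omega X0 g).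

Lemma smooth_field_eq x V V' : (\forall y \near x, V y = V' y) ->
  smooth_field_at A V x -> smooth_field_at A V' x.
Proof.
move=> VV; apply: smooth_near_eq.
apply: near_imp (near_cinv Aman (da_center Aat x) VV) _ => q E.
by rewrite /field_in_chart E.
Qed.

Lemma smooth_const_field x v : smooth_field_at A (const_field A x v) x.
Proof.
apply: (@smooth_near_eq _ _ _ (fun _ => v)); last exact: smooth_near_cst.
by apply: near_imp (field_in_chart_const Aman x v) _.
Qed.

(** A linear connection is local. The Leibniz rule only asks its function to
    be smooth near the point, so the indicator of the set where the two fields
    agree does the work of a bump function. *)
Lemma nabla_local x u V V' : smooth_field_at A V x ->
  (\forall y \near x, V y = V' y) -> nabla x u V = nabla x u V'.
Proof.
move=> sV VV; have sV' := smooth_field_eq VV sV.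
have xx := da_center Aat x.
pose f y : R := if `[< V y = V' y >] then 1 else 0.
have f1 : \forall y \near x, f y = 1.
  by apply: near_imp VV _ => y E; rewrite /f; case: asboolP.
have f1c := near_cinv Aman xx f1.
have sf : smooth_fun_at A f x.
  apply: (@smooth_near_eq _ _ _ (fun _ => 1 : R)); last exact: smooth_near_cst.
  by apply: near_imp f1c _ => q /= ->.
have df : dfun A f x u = 0.
  apply: etrans (near_eq_derive (f := f \o cinv A x) (g := fun _ => 1 : R) u f1c) _.
  exact: (has_D_cst (1 : R) _).2.
have fV V1 : smooth_field_at A V1 x ->
    nabla x u (fun y => f y *: V1 y) = nabla x u V1.
  move=> sV1; rewrite (lc_leibniz nabla_lin u sf sV1) df scale0r add0r.
  by rewrite (near_self f1) scale1r.
rewrite -(fV _ sV) -(fV _ sV'); congr (nabla x u _).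
apply/funext => y; rewrite /f; case: asboolP => [->//|_].
by rewrite !scale0r.
Qed.

Lemma smooth_zero_field x : smooth_field_at A (fun _ => 0) x.
Proof.
apply: (@smooth_near_eq _ _ _ (fun _ => 0)); last exact: smooth_near_cst.
by apply: near_imp (da_near Aat (da_center Aat x)) _ => q _;
  rewrite /field_in_chart change0.
Qed.

Lemma nabla_zero x u : nabla x u (fun _ => 0) = 0.
Proof.
have sf : smooth_fun_at A (fun _ : M => 0 : R) x.
  exact: smooth_near_cst.
have := lc_leibniz nabla_lin u sf (smooth_zero_field x).
have -> : (fun _ : M => (0 : R) *: (0 : 'rV[R]_n)) = (fun _ => 0).
  by apply/funext => y; rewrite scaler0.
by move=> ->; rewrite scaler0 scale0r addr0.
Qed.

Lemma smooth_field_scale x (f : M -> R) V : smooth_fun_at A f x ->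
  smooth_field_at A V x -> smooth_field_at A (fun y => f y *: V y) x.
Proof.
move=> sf sV; have xx := da_center Aat x.
apply: (@smooth_near_eq _ _ _
  (fun q => (f \o cinv A x) q *: field_in_chart A x V q)); last first.
  exact: smooth_near_scaler.
apply: near_imp (da_near Aat xx) _ => q [xq _].
by rewrite /field_in_chart (changeZ Aat) //; exact: (da_center Aat).
Qed.

Lemma smooth_field_add x V V' : smooth_field_at A V x ->
  smooth_field_at A V' x -> smooth_field_at A (fun y => V y + V' y) x.
Proof.
move=> sV sV'; have xx := da_center Aat x.
apply: (@smooth_near_eq _ _ _
  (fun q => field_in_chart A x V q + field_in_chart A x V' q)); last first.
  exact: (smooth_near_add sV sV').
apply: near_imp (da_near Aat xx) _ => q [xq _].
by rewrite /field_in_chart (changeD Aat) //; exact: (da_center Aat).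
Qed.

Lemma nabla_sum x u (r : seq 'I_n) (f : 'I_n -> M -> R)
    (V : 'I_n -> M -> 'rV[R]_n) :
  (forall k, smooth_fun_at A (f k) x) -> (forall k, smooth_field_at A (V k) x) ->
  smooth_field_at A (fun y => \sum_(k <- r) f k y *: V k y) x /\
  nabla x u (fun y => \sum_(k <- r) f k y *: V k y) =
  \sum_(k <- r) (dfun A (f k) x u *: V k x + f k x *: nabla x u (V k)).
Proof.
move=> sf sV; elim: r => [|k r [sr IH]].
  rewrite big_nil (_ : (fun _ => _) = fun _ => 0); last first.
    by apply/funext => y; rewrite big_nil.
  by split; [exact: smooth_zero_field|exact: nabla_zero].
rewrite big_cons (_ : (fun _ => _) = fun y => f k y *: V k y +
    \sum_(k <- r) f k y *: V k y); last first.
  by apply/funext => y; rewrite big_cons.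
have sk := smooth_field_scale (sf k) (sV k).
split; first exact: smooth_field_add.
have E := lc_leibniz nabla_lin u (sf k) (sV k).
by rewrite (lc_add nabla_lin u sk sr) IH E.
Qed.

(** Christoffel symbols of the chart at [x], at the point [x] itself. Expanding
    [v] on the basis makes them linear in [v] by construction. *)
Definition christoffel (x : M) (u v : 'rV[R]_n) : 'rV[R]_n :=
  \sum_k v 0 k *: nabla x u (const_field A x (delta_mx 0 k)).

Lemma christoffel_linear x u c v1 v2 :
  christoffel x u (c *: v1 + v2) = c *: christoffel x u v1 + christoffel x u v2.
Proof.
rewrite /christoffel scaler_sumr -big_split; apply: eq_bigr => k _.
by rewrite !mxE scalerDl scalerA.
Qed.

Lemma field_in_chart_center x V : field_in_chart A x V (cmap A x x) = V x.
Proof.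
have xx := da_center Aat x.
by rewrite /field_in_chart (da_coordK Aat xx) (change_id Aat).
Qed.

(** The field is expanded on the coordinate fields near [x]; locality and the
    Leibniz rule do the rest. *)
Lemma nabla_in_chart x u V : smooth_field_at A V x ->
  nabla x u V =
  'D_u (field_in_chart A x V) (cmap A x x) + christoffel x u (V x).
Proof.
move=> sV; have xx := da_center Aat x.
pose f (k : 'I_n) y := field_in_chart A x V (cmap A x y) 0 k.
have fE k : \forall q \near cmap A x x,
    (f k \o cinv A x) q = field_in_chart A x V q 0 k.
  by apply: near_imp (da_near Aat xx) _ => q [_ qE]; rewrite /f /= qE.
have sf k : smooth_fun_at A (f k) x.
  apply: (@smooth_near_eq _ _ _ (fun q => field_in_chart A x V q 0 k)).
    by apply: near_imp (fE k) _ => q /esym.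
  exact: smooth_near_coord.
have dV := near_self (smooth_near_differentiable sV).
have df k : dfun A (f k) x u = 'D_u (field_in_chart A x V) (cmap A x x) 0 k.
  apply: etrans (near_eq_derive u (fE k)) _.
  exact: (has_D_coord 0 k (has_D_self dV)).2.
pose e k := const_field A x (delta_mx 0 k).
have [sE E] := @nabla_sum x u (index_enum 'I_n) f e sf
  (fun k => smooth_const_field x (delta_mx 0 k)).
have VE : \forall y \near x, V y = \sum_k f k y *: e k y.
  apply: near_imp (near_cdom Aman xx) _ => y xy.
  have yy := da_center Aat y.
  have L c u1 u2 := change_linear Aat c u1 u2 xy yy.
  have := linear_sum_delta L (field_in_chart A x V (cmap A x y)).
  move=> <-; rewrite /field_in_chart (da_coordK Aat xy).
  by rewrite (changeK Aat _ yy xy).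
rewrite (nabla_local u sV VE) E big_split /=; congr (_ + _).
  apply: etrans (esym (row_sum_delta _)).
  by apply: eq_bigr => k _; rewrite df /e (const_fieldE Aman).
apply: eq_bigr => k _; rewrite /f field_in_chart_center //.
Qed.

(** The field dual to the covector [p], constant in the chart at [x]. Such
    fields are horizontal at every point, and at [x] they take all horizontal
    values. *)
Definition sharp_field (x : M) (p : 'rV[R]_n) (y : M) : 'rV[R]_n :=
  sharp y (cochange A x y y p).

Lemma sharp_field_smooth x p : smooth_field_at A (sharp_field x p) x.
Proof. exact: (sharp_chart_smooth Aman flowP x p). Qed.

Lemma sharp_mx_center x p : p *m S x (cmap A x x) = sharp x p.
Proof.
have xx := da_center Aat x.
have aq : cdom A x (cinv A x (cmap A x x)) by rewrite (da_coordK Aat xx).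
rewrite (sharp_mxE Aman g_metric X0_unit H_def Hvec_def _ aq) /sharp_chart.
by rewrite (da_coordK Aat xx) (change_id Aat) // (cochange_id Aman).
Qed.

Lemma sharp_field_center x p : sharp_field x p x = p *m S x (cmap A x x).
Proof.
rewrite sharp_mx_center /sharp_field (cochange_id Aman) //.
exact: (da_center Aat).
Qed.

Lemma sharp_field_in_chart x p : \forall q \near cmap A x x,
  field_in_chart A x (sharp_field x p) q = p *m S x q.
Proof.
apply: near_imp (da_near Aat (da_center Aat x)) _ => q [xq _].
by rewrite (sharp_mxE Aman g_metric X0_unit H_def Hvec_def _ xq).
Qed.

Lemma derive_sharp_field x p u :
  'D_u (field_in_chart A x (sharp_field x p)) (cmap A x x) =
  p *m 'D_u (S x) (cmap A x x).
Proof.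
have dS := near_self (sharp_mx_differentiable Aman flowP x).
have [_ D] := has_D_mulmx (has_D_cst p (cmap A x x)) (has_D_self dS).
apply: etrans (near_eq_derive u (sharp_field_in_chart x p)) _.
by apply: etrans (D u) _; rewrite mul0mx add0r.
Qed.

Lemma nabla_sharp_field x u p :
  nabla x u (sharp_field x p) =
  p *m 'D_u (S x) (cmap A x x) + christoffel x u (p *m S x (cmap A x x)).
Proof.
rewrite (nabla_in_chart u (sharp_field_smooth x p)) sharp_field_center.
by rewrite derive_sharp_field.
Qed.

Lemma omega_nabla_sharp_field x u p :
  pairing (omega x) (nabla x u (sharp_field x p)) = 0.
Proof.
have := tanno_form nabla_tanno u (sharp_field_smooth x p).
have E : (fun y => pairing (omega y) (sharp_field x p y)) = (fun _ => 0).
  apply/funext => y.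
  exact: (sharp_hor Aman g_metric X0_unit H_def Hvec_def).
rewrite E /dfun.
have -> : 'D_u ((fun _ : M => 0 : R) \o cinv A x) (cmap A x x) = 0.
  exact: (has_D_cst (0 : R) (cmap A x x)).2.
by rewrite sub0r => /eqP; rewrite oppr_eq0 => /eqP.
Qed.

Let sharp_hor' := sharp_hor Aman g_metric X0_unit H_def Hvec_def.
Let gg_sharp' := extended_metric_sharp Aman g_metric X0_unit H_def Hvec_def.

(** The connection preserves the metric and the contact form, hence the
    cometric. The metric identity is applied to two fields [sharp_field], on
    which the metric is the pairing of a constant covector with [sharp_mx]. *)
Lemma derive_sharp_mx x u p1 p2 :
  let q0 := cmap A x x in
  pairing p1 (p2 *m 'D_u (S x) q0) =
  - pairing p1 (christoffel x u (p2 *m S x q0))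
  - pairing p2 (christoffel x u (p1 *m S x q0)).
Proof.
move=> q0; have xx := da_center Aat x.
have dS := near_self (sharp_mx_differentiable Aman flowP x).
have nd : \forall q \near q0, cdom A x (cinv A x q).
  by apply: near_imp (da_near Aat xx) _ => q [].
have cid p : cochange A x x x p = p by apply: (cochange_id Aman).
have := tanno_metric nabla_tanno u (sharp_field_smooth x p2)
  (sharp_field_smooth x p1).
have G2 : gg x (nabla x u (sharp_field x p2)) (sharp_field x p1 x) =
    pairing p1 (nabla x u (sharp_field x p2)).
  rewrite (extended_metric_sym g_metric X0_unit) gg_sharp' cid.
  by rewrite omega_nabla_sharp_field mul0r subr0.
have G1 : gg x (sharp_field x p2 x) (nabla x u (sharp_field x p1)) =
    pairing p2 (nabla x u (sharp_field x p1)).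
  by rewrite gg_sharp' cid omega_nabla_sharp_field mul0r subr0.
have DE : dfun A (fun y => gg y (sharp_field x p2 y) (sharp_field x p1 y)) x u =
    pairing p2 (p1 *m 'D_u (S x) q0).
  have [_ D] := has_D_pairing (has_D_cst p2 q0)
    (has_D_mulmx (has_D_cst p1 q0) (has_D_self dS)).
  apply: etrans (_ : _ = pairing 0 (p1 *m S x q0) +
     pairing p2 (0 *m S x q0 + p1 *m 'D_u (S x) q0)) _; last first.
    by rewrite pairing0l mul0mx !add0r.
  apply: etrans _ (D u); apply: near_eq_derive.
  apply: near_imp nd _ => q xq.
  have yy := da_center Aat (cinv A x q).
  apply: etrans (gg_sharp' _ _ _) _; rewrite sharp_hor' mul0r subr0.
  rewrite (sharp_mxE Aman g_metric X0_unit H_def Hvec_def _ xq).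
  apply: etrans (pairing_cochange Aman p2 _ xq yy) _.
  by [].
rewrite DE G1 G2 !nabla_sharp_field !pairingDr -/q0.
have := derive_sharp_mx_symmetric Aman g_metric X0_unit H_def Hvec_def
  p1 p2 u nd dS.
move=> ->; set a := pairing p2 (p1 *m _).
set b := pairing p1 (christoffel _ _ _); set c := pairing p2 (christoffel _ _ _).
by move=> E; lra.
Qed.

(** The torsion is prescribed on fields that are horizontal near [x], such as
    [sharp_field]; the bracket cancels the derivatives of [sharp_mx]. *)
Lemma christoffel_torsion x p1 p2 :
  let q0 := cmap A x x in
  christoffel x (p1 *m S x q0) (p2 *m S x q0) -
  christoffel x (p2 *m S x q0) (p1 *m S x q0) =
  ext_deriv A omega x (p1 *m S x q0) (p2 *m S x q0) *: X0 x.
Proof.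
move=> q0; have xx := da_center Aat x.
have := tanno_torsion_hor nabla_tanno (sharp_field_smooth x p1)
  (sharp_field_smooth x p2).
rewrite !sharp_field_center => <-; last first.
  by apply: nearW => y; split; exact: sharp_hor'.
rewrite /torsion !nabla_sharp_field !sharp_field_center /bracket.
rewrite [X in _ = _ - (X - _)]derive_sharp_field.
rewrite [X in _ = _ - (_ - X)]derive_sharp_field.
rewrite !sharp_field_center -/q0.
have key (a b c e : 'rV[R]_n) : c - e = a + c - (b + e) - (a - b).
  by apply/rowP => i; rewrite !mxE; ring.
exact: key.
Qed.

Hypothesis J_smooth : forall x v,
  smooth_field_at A (fun y => J y (const_field A x v y)) x.

(** The components of the field [J u] vary, whence the derivative; those of the
    constant field [u] do not in its own chart. *)
Lemma tanno_tensorE x u v :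
  tanno_tensor A J nabla x u v =
  'D_v (field_in_chart A x (fun y => J y (const_field A x u y))) (cmap A x x)
  + christoffel x v (J x u) - J x (christoffel x v u).
Proof.
rewrite /tanno_tensor (nabla_in_chart v (J_smooth x u)) (const_fieldE Aman).
congr (_ - J x _).
rewrite (nabla_in_chart v (smooth_const_field x u)) (const_fieldE Aman).
have -> : 'D_v (field_in_chart A x (const_field A x u)) (cmap A x x) = 0.
  exact: derive_near_const (field_in_chart_const Aman x u).
by rewrite add0r.
Qed.

End Connection.

(** * The canonical frame in a fixed chart *)

Section FrameEquationsSection.
Context {R : realType} {d : nat} {M : topologicalType}.
Local Notation n := (d.*2.+1).
Variable A : atlas R n M.
Hypothesis Aman : is_smooth_manifold A.
Let Aat := manifold_diff_atlas Aman.
Variable omega : M -> 'rV[R]_n.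
Hypothesis omega_smooth : forall x, smooth_form_at A omega x.
Variable g : M -> 'rV[R]_n -> 'rV[R]_n -> R.
Hypothesis g_metric : is_horizontal_metric A omega g.
Variable X0 : M -> 'rV[R]_n.
Hypothesis X0_smooth : forall x, smooth_field_at A X0 x.
Hypothesis X0_unit : forall x, pairing (omega x) (X0 x) = 1.
Local Notation B := (cotangent_atlas A).
Variable H : M * 'rV[R]_n -> R.
Hypothesis H_def : is_hamiltonian omega g H.
Variable Hvec : M * 'rV[R]_n -> 'rV[R]_(n + n).
Hypothesis Hvec_def : is_hamiltonian_field A H Hvec.
Variables (W : set (R * (M * 'rV[R]_n)))
  (flow : R -> M * 'rV[R]_n -> M * 'rV[R]_n).
Hypothesis flowP : is_flow B Hvec W flow.
Let Bat := cotangent_diff_atlas Aman.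
Local Notation sharp := (sharp Hvec).

Local Notation S := (sharp_mx A Hvec).
Hypothesis d_gt0 : (0 < d)%N.
Variable lambda : M * 'rV[R]_n.
Variable I : set R.
Hypotheses (I_open : open I) (I_itv : is_interval I).
Hypothesis I_dom : forall t, I t -> W (t, lambda).
Variables (E F : R -> 'I_n -> 'rV[R]_(n + n)) (Rm : R -> 'M[R]_n).
Local Notation c := (fun t => flow t lambda).
Hypothesis EF : is_canonical_frame A flow c I E F Rm.
Local Notation i0 := (ord0 : 'I_n).
Local Notation i1 := (inord 1 : 'I_n).

Lemma val_inord1_frame : i1 = 1%N :> nat.
Proof. by rewrite inordK // ltnS double_gt0. Qed.

Lemma differential_fst l Z : differential B A fst l Z = lsubmx Z.
Proof.
have ll := da_center Aat l.1.
have D := has_D_lin (lsubmx : {linear 'M[R]_(1, n + n) -> 'M[R]_(1, n)})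
  (cmap B l l).
apply: etrans _ (D.2 Z); apply: near_eq_derive.
rewrite cotangent_cmapE.
apply: near_imp (near_lsubmx _ (da_near Aat ll)) _ => z [_ zE].
exact: zE.
Qed.

Lemma frame_E_vertical s mu : I s -> lsubmx (E s mu) = 0.
Proof.
move=> Is; rewrite -(differential_fst (c s)).
apply/(cf_vertical EF Is); apply: memv_span.
exact: codom_f.
Qed.

Lemma frame_eq_E0 s : I s ->
  flow_derivative B flow c (E^~ i0) s = E s i1.
Proof.
move=> Is; rewrite (cf_dotE EF Is).
rewrite (bigD1 i1) //= big1 => [|j j1]; last first.
  rewrite mxE eqxx /=; case: eqP => [j1'|_]; last by rewrite scale0r.
  by case/negP: j1; apply/eqP/val_inj; rewrite /= val_inord1_frame.
rewrite big1 => [|j _]; last by rewrite mxE eqxx andbF scale0r.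
by rewrite mxE eqxx val_inord1_frame eqxx scale1r addr0 subr0.
Qed.

Lemma frame_eq_E1 s : I s ->
  flow_derivative B flow c (E^~ i1) s = - F s i1.
Proof.
move=> Is; rewrite (cf_dotE EF Is).
rewrite big1 => [|j _]; last by rewrite mxE val_inord1_frame scale0r.
rewrite (bigD1 i1) //= big1 => [|j j1]; last first.
  by rewrite mxE eq_sym (negbTE j1) scale0r.
by rewrite mxE eqxx val_inord1_frame scale1r addr0 sub0r.
Qed.

Lemma frame_eq_F1 s : I s ->
  lsubmx (flow_derivative B flow c (F^~ i1) s) = - lsubmx (F s i0).
Proof.
move=> Is; rewrite (cf_dotF EF Is) linearB linear_sum big1 => [|j _]; last first.
  by rewrite linearZ /= frame_E_vertical // scaler0.
rewrite sub0r; congr (- _).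
rewrite (bigD1 i0) //= big1 => [|j j0]; last first.
  rewrite !mxE; case: eqP => [j0'|_]; last by rewrite scale0r.
  by case/negP: j0; apply/eqP/val_inj.
by rewrite !mxE eqxx val_inord1_frame eqxx scale1r addr0.
Qed.

Variable t0 : R.
Hypothesis It0 : I t0.
Local Notation l := (flow t0 lambda).
Local Notation a := (flow t0 lambda).1.
Local Notation V := (field_in_chart B l Hvec).

Definition chart_position (s : R) : 'rV[R]_n := lsubmx (cmap B l (c s)).
Definition chart_momentum (s : R) : 'rV[R]_n := rsubmx (cmap B l (c s)).
Definition frame_position (Z : R -> 'I_n -> 'rV[R]_(n + n)) mu s : 'rV[R]_n :=
  lsubmx (change B (c s) l (c s) (Z s mu)).
Definition frame_momentum (Z : R -> 'I_n -> 'rV[R]_(n + n)) mu s : 'rV[R]_n :=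
  rsubmx (change B (c s) l (c s) (Z s mu)).
Local Notation q := chart_position.
Local Notation p := chart_momentum.
Local Notation e0 := (frame_momentum E i0).
Local Notation e1 := (frame_momentum E i1).
Local Notation f0 := (frame_position F i0).
Local Notation f1 := (frame_position F i1).
Local Notation k1 := (frame_momentum F i1).

(** The equations of the canonical frame that do not involve the curvature
    matrix, split into position and momentum, together with Hamilton's
    equations; all in the chart at [l], for times [s] near [t0]. *)
Record frame_equations (s : R) : Prop := FrameEquations {
  fe_I : I s;
  fe_dom : cdom B l (c s);
  fe_near : \forall q' \near q s,
    cdom A a (cinv A a q') /\ cmap A a (cinv A a q') = q';
  fe_S : differentiable (S a) (q s);
  fe_form : differentiable (form_in_chart A omega a) (q s);
  fe_reeb : differentiable (field_in_chart A a X0) (q s);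
  fe_q : has_D q s (fun h => h *: (p s *m S a (q s)));
  fe_dp : differentiable p s;
  fe_p : forall v, pairing ('D_1 p s) v =
    - (2^-1 * pairing (p s) (p s *m 'D_v (S a) (q s)));
  fe_de0 : differentiable e0 s;
  fe_de1 : differentiable e1 s;
  fe_df1 : differentiable f1 s;
  fe_E0q : e0 s *m S a (q s) = 0;
  fe_E0p : forall v, pairing (e1 s) v =
    pairing ('D_1 e0 s) v + pairing (e0 s) (p s *m 'D_v (S a) (q s));
  fe_E1q : f1 s = e1 s *m S a (q s);
  fe_E1p : forall v, - pairing (k1 s) v =
    pairing ('D_1 e1 s) v + pairing (e1 s) (p s *m 'D_v (S a) (q s));
  fe_F1q : - f0 s =
    'D_1 f1 s - (k1 s *m S a (q s) + p s *m 'D_(f1 s) (S a) (q s)) }.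

(** The vectors [E_mu] are vertical at all times, so their positions have zero
    derivative; the three equations of the frame then split with the linearized
    Hamiltonian field. *)
Lemma frame_equations_near : \forall s \near t0, frame_equations s.
Proof.
have bb := da_center Bat l.
have cI : is_integral_curve B Hvec I c.
  by move=> t It; apply: (flow_curve flowP); apply: I_dom.
have smE mu := (cf_smooth EF It0 mu).1.
have smF mu := (cf_smooth EF It0 mu).2.
have LE mu := flow_derivative_in_chart Bat flowP I_open I_itv I_dom It0 (smE mu).
have LF mu := flow_derivative_in_chart Bat flowP I_open I_itv I_dom It0 (smF mu).
have [_ Dz0] := curve_in_chart Bat cI It0 bb.
have Dq0 := has_D_linear (lsubmx : {linear 'M[R]_(1, n + n) -> 'M[R]_(1, n)}) Dz0.
have q0E : lsubmx (cmap B l (c t0)) = cmap A a a.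
  by rewrite cotangent_cmapE row_mxKl.
have aa := da_center Aat a.
have N1 := near_near (da_near Aat aa).
have N2 := near_and (sharp_mx_differentiable Aman flowP a)
  (near_and (form_in_chart_differentiable omega_smooth a)
            (reeb_in_chart_differentiable X0_smooth a)).
rewrite -q0E in N1 N2.
have {}N1 := near_has_D Dq0 N1; have {}N2 := near_has_D Dq0 N2.
have NE := near_near (near_and (LE i0) (LE i1)).
apply: near_imp3 (near_and N1 N2) NE (LF i1) _ => s.
move=> [nq [dS [dw dX]]] NEs [Is bs dYF dV LF1].
have [[_ _ dYE0 _ LE0] [_ _ dYE1 _ LE1]] := near_self NEs.
have zE : row_mx (q s) (p s) = cmap B l (c s) by rewrite hsubmxK.
have nq' : \forall q' \near q s, cdom A a (cinv A a q').
  by apply: near_imp nq _ => q' [].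
have [lq lqE] := near_self nq.
have cc := da_center Aat (c s).1.
have vert mu r : I r -> cdom B l (c r) -> frame_position E mu r = 0.
  move=> Ir br.
  apply: etrans (lsubmx_cotangent_change Aman _ (da_center Aat (c r).1) br) _.
  by rewrite frame_E_vertical // change0.
have [_ Dz] := curve_in_chart Bat cI Is bs.
have zV : change B (c s) l (c s) (Hvec (c s)) = V (row_mx (q s) (p s)).
  by rewrite zE /field_in_chart (da_coordK Bat bs).
rewrite zV in Dz; rewrite -zE in dV LF1 LE0 LE1.
have Dq := has_D_linear (lsubmx : {linear 'M[R]_(1, n + n) -> 'M[R]_(1, n)}) Dz.
have Dp := has_D_linear (rsubmx : {linear 'M[R]_(1, n + n) -> 'M[R]_(1, n)}) Dz.
have DE0 := has_D_linear (rsubmx : {linear 'M[R]_(1, n + n) -> 'M[R]_(1, n)})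
  (has_D_self dYE0).
have DE1 := has_D_linear (rsubmx : {linear 'M[R]_(1, n + n) -> 'M[R]_(1, n)})
  (has_D_self dYE1).
have DE0l := has_D_linear (lsubmx : {linear 'M[R]_(1, n + n) -> 'M[R]_(1, n)})
  (has_D_self dYE0).
have DE1l := has_D_linear (lsubmx : {linear 'M[R]_(1, n + n) -> 'M[R]_(1, n)})
  (has_D_self dYE1).
have DF1 := has_D_linear (lsubmx : {linear 'M[R]_(1, n + n) -> 'M[R]_(1, n)})
  (has_D_self dYF).
have vertD mu : 'D_1 (frame_position E mu) s = 0.
  have N : \forall r \near s, (fun _ => 0 : 'rV[R]_n) r = frame_position E mu r.
    by apply: near_imp NEs _ => r [[Ir br _ _ _] _]; rewrite vert.
  exact: (has_D_near N (has_D_cst (0 : 'rV[R]_n) s)).2.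
have Yvert mu : change B (c s) l (c s) (E s mu) =
    row_mx 0 (frame_momentum E mu s).
  by rewrite -[LHS]hsubmxK -/(frame_position E mu s) (vert mu s Is bs).
have LE0' : change B (c s) l (c s) (E s i1) =
    'D_1 (fun s => change B (c s) l (c s) (E s i0)) s -
    'D_(row_mx 0 (e0 s)) V (row_mx (q s) (p s)).
  apply: etrans (f_equal (change B (c s) l (c s)) (esym (frame_eq_E0 Is))) _.
  apply: etrans LE0 _.
  exact: (f_equal (fun r =>
    'D_1 (fun s => change B (c s) l (c s) (E s i0)) s -
    'D_r V (row_mx (q s) (p s))) (Yvert i0)).
have LE1' : change B (c s) l (c s) (- F s i1) =
    'D_1 (fun s => change B (c s) l (c s) (E s i1)) s -
    'D_(row_mx 0 (e1 s)) V (row_mx (q s) (p s)).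
  apply: etrans (f_equal (change B (c s) l (c s)) (esym (frame_eq_E1 Is))) _.
  apply: etrans LE1 _.
  exact: (f_equal (fun r =>
    'D_1 (fun s => change B (c s) l (c s) (E s i1)) s -
    'D_r V (row_mx (q s) (p s))) (Yvert i1)).
have neg : change B (c s) l (c s) (- F s i1) = - change B (c s) l (c s) (F s i1).
  by rewrite -scaleN1r (changeZ Bat) ?scaleN1r //; exact: (da_center Bat).
have VD b := lsubmx_derive_field Aman g_metric X0_unit H_def Hvec_def
  (l := l) (p := p s) b _ nq' dS dV.
have VR b v := rsubmx_derive_field Aman g_metric X0_unit H_def Hvec_def flowP
  b v nq dS dV.
split; [exact: Is|exact: bs|exact: nq|exact: dS|exact: dw|exact: dX
  | | | | | | | | | | |].
- apply: has_D_eq Dq _ => h; rewrite linearZ /=; congr (_ *: _).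
  have lz : cdom A l.1 (cinv A l.1 (lsubmx (row_mx (q s) (p s)))).
    by rewrite row_mxKl.
  apply: etrans (lsubmx_field_in_chart Aman Hvec lz) _.
  rewrite row_mxKl row_mxKr.
  by rewrite (sharp_mxE Aman g_metric X0_unit H_def Hvec_def _ lq).
- by case: Dp.
- move=> v; have -> : 'D_1 p s = rsubmx (V (row_mx (q s) (p s))).
    by apply: etrans (Dp.2 1) _; rewrite scale1r.
  exact: (rsubmx_field_in_chart Aman g_metric X0_unit H_def Hvec_def flowP).
- by case: DE0.
- by case: DE1.
- by case: DF1.
- have H1 := f_equal lsubmx LE0'.
  have H2 : 0 = 'D_1 (frame_position E i0) s - (e0 s *m S a (q s)).
    rewrite -(vert i1 s Is bs); apply: etrans H1 _.
    rewrite linearB /=; congr (_ - _); first exact: esym (DE0l.2 1).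
    by apply: etrans (VD _ _) _; rewrite derive0 mulmx0 addr0.
  rewrite vertD sub0r in H2.
  by apply/eqP; rewrite -oppr_eq0 -H2.
- move=> v.
  have H1 := f_equal (fun r => pairing (rsubmx r) v) LE0'.
  apply: etrans H1 _; rewrite linearB pairingBl.
  have H2 : pairing (rsubmx ('D_1 (fun s => change B (c s) l (c s) (E s i0)) s)) v
     = pairing ('D_1 e0 s) v.
    by apply: (f_equal (fun r => pairing r v)); exact: esym (DE0.2 1).
  apply: etrans (f_equal2 (fun r1 r2 => r1 - r2) H2 (VR (e0 s) v)) _.
  by rewrite opprK.
- have H1 := f_equal lsubmx LE1'; rewrite neg linearN in H1.
  have H2 : - f1 s = 'D_1 (frame_position E i1) s - (e1 s *m S a (q s)).
    apply: etrans H1 _.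
    rewrite linearB /=; congr (_ - _); first exact: esym (DE1l.2 1).
    by apply: etrans (VD _ _) _; rewrite derive0 mulmx0 addr0.
  by rewrite vertD sub0r in H2; exact: oppr_inj H2.
- move=> v.
  have H1 := f_equal (fun r => pairing (rsubmx r) v) LE1'.
  rewrite neg linearN pairingNl in H1.
  apply: etrans H1 _; rewrite linearB pairingBl.
  have H2 : pairing (rsubmx ('D_1 (fun s => change B (c s) l (c s) (E s i1)) s)) v
     = pairing ('D_1 e1 s) v.
    by apply: (f_equal (fun r => pairing r v)); exact: esym (DE1.2 1).
  apply: etrans (f_equal2 (fun r1 r2 => r1 - r2) H2 (VR (e1 s) v)) _.
  by rewrite opprK.
- have H1 := f_equal lsubmx LF1; rewrite linearB in H1.
  have H2 : lsubmx (change B (c s) l (c s) (flow_derivative B flow c (F^~ i1) s))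
      = - f0 s.
    apply: etrans (lsubmx_cotangent_change Aman _ cc bs) _.
    apply: etrans (f_equal (change A (c s).1 a (c s).1) (frame_eq_F1 Is)) _.
    have N : change A (c s).1 a (c s).1 (- lsubmx (F s i0)) =
        - change A (c s).1 a (c s).1 (lsubmx (F s i0)).
      by rewrite -scaleN1r (changeZ Aat (-1) _ cc bs) scaleN1r.
    apply: etrans N _.
    exact: (f_equal -%R (esym (lsubmx_cotangent_change Aman (F s i0) cc bs))).
  apply: etrans (esym H2) _; apply: etrans H1 _; congr (_ - _).
    exact: esym (DF1.2 1).
  have YF : change B (c s) l (c s) (F s i1) = row_mx (f1 s) (k1 s).
    exact: esym (hsubmxK (change B (c s) l (c s) (F s i1))).
  have G1 := VD (k1 s) (f1 s).
  have G2 : 'D_(change B (c s) l (c s) (F s i1)) V (row_mx (q s) (p s)) =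
    'D_(row_mx (f1 s) (k1 s)) V (row_mx (q s) (p s)).
    exact: (f_equal (fun r => 'D_r V (row_mx (q s) (p s))) YF).
  apply: etrans _ G1.
  exact: (f_equal (fun r : 'rV[R]_(n + n) => lsubmx r) G2).
Qed.

End FrameEquationsSection.

(** * The direction of the Reeb component *)

Section ReebDirectionAlgebra.
Context {R : realType} {n : nat}.
Implicit Types u v w p alpha beta : 'rV[R]_n.

(** The linear algebra of the last frame equation. [S] is the cometric at a
    point, [DS] its derivative, [Gamma] the Christoffel symbols of a connection
    preserving it with torsion [Om], the exterior derivative of the contact
    form, and [- K] is the matrix of the endomorphism [J]; primes are time
    derivatives. Each vector is tested against a covector [beta], and the
    derivative of the cometric is replaced by Christoffel symbols. What remains
    of them are torsions and the three quantities
      [u' = - Gamma u u - p X u K], the geodesic equation,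
      [f1' = - kappa Q - Gamma u f1 + kappa p X u], and
      [Gamma u f1 - Gamma f1 u = kappa X]. *)
Lemma reeb_direction (S K DK : 'M[R]_n) (DS : 'rV[R]_n -> 'M[R]_n)
    (Gamma : 'rV[R]_n -> 'rV[R]_n -> 'rV[R]_n) (Om : 'rV[R]_n -> 'rV[R]_n -> R)
    (X Q u u' p p' e1 e1' k1 f0 f1 f1' : 'rV[R]_n) (kappa : R) :
  (forall alpha beta, pairing alpha (beta *m S) = pairing beta (alpha *m S)) ->
  (forall w c v1 v2, Gamma w (c *: v1 + v2) = c *: Gamma w v1 + Gamma w v2) ->
  (forall w alpha beta, pairing alpha (beta *m DS w) =
     - pairing alpha (Gamma w (beta *m S)) -
       pairing beta (Gamma w (alpha *m S))) ->
  (forall alpha beta, Gamma (alpha *m S) (beta *m S) -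
     Gamma (beta *m S) (alpha *m S) = Om (alpha *m S) (beta *m S) *: X) ->
  (forall v beta, Om v (beta *m S) = pairing beta (v *m K)) ->
  u = p *m S -> u *m K *m K = - u ->
  (forall v, pairing e1 v = kappa * Om u v) -> Om u X = 0 ->
  f1 = e1 *m S -> pairing e1 f1 = 1 -> kappa * kappa = 1 ->
  (forall v, - pairing k1 v = pairing e1' v + pairing e1 (p *m DS v)) ->
  - f0 = f1' - (k1 *m S + p *m DS f1) ->
  f1' = e1' *m S + e1 *m DS u ->
  f1' = kappa *: (u' *m K + u *m DK) ->
  (forall v, pairing p' v = - (2^-1 * pairing p (p *m DS v))) ->
  u' = p' *m S + p *m DS u ->
  Q = - (u *m DK) + Gamma u (- (u *m K)) + Gamma u u *m K ->
  f0 = kappa *: (X + 2 *: Q - pairing p X *: u).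
Proof.
move=> symS Glin G T OmK uE KK e1E OmX f1E e1f1 kk k1E f0E f1'S f1'K p'E u'E QE.
have Tu beta : Gamma u (beta *m S) - Gamma (beta *m S) u =
    Om u (beta *m S) *: X by rewrite uE.
have Tf1 beta : Gamma f1 (beta *m S) - Gamma (beta *m S) f1 =
    Om f1 (beta *m S) *: X by rewrite f1E.
have f1K : f1 = kappa *: (u *m K).
  apply: pairing_inj => beta; rewrite ![pairing _ beta]pairingC.
  by rewrite f1E symS e1E OmK pairingZr.
have uS (beta : 'rV[R]_n) : pairing p (Gamma u (beta *m S)) -
    pairing p (Gamma (beta *m S) u) = pairing beta (u *m K) * pairing p X.
  by rewrite -pairingBr Tu OmK pairingZr.
have u'P : u' = - Gamma u u - pairing p X *: (u *m K).
  apply: pairing_inj => beta; rewrite ![pairing _ beta]pairingC.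
  rewrite u'E pairingDr symS p'E !G -!uE pairingBr pairingNr pairingZr.
  have := uS beta; rewrite mulrC => E; lra.
have f1'P : f1' = - kappa *: Q - Gamma u f1 + (kappa * pairing p X) *: u.
  have Gk : Gamma u f1 = kappa *: Gamma u (u *m K).
    have := Glin u kappa (u *m K) 0; have := Glin u 1 0 0.
    rewrite scaler0 addr0 scale1r => /eqP.
    rewrite -subr_eq0 opprD addrA subrr sub0r oppr_eq0 => /eqP ->.
    by rewrite !addr0 -f1K.
  have Gn : Gamma u (- (u *m K)) = - Gamma u (u *m K).
    have := Glin u (-1) (u *m K) 0; have := Glin u 1 0 0.
    rewrite scaler0 addr0 scale1r => /eqP.
    rewrite -subr_eq0 opprD addrA subrr sub0r oppr_eq0 => /eqP ->.
    by rewrite !addr0 !scaleN1r.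
  rewrite f1'K u'P Gk QE Gn mulmxBl mulNmx -scalemxAl KK.
  by apply/rowP => i; rewrite !mxE; ring.
have OmF : Om u f1 = kappa.
  by move: e1f1; rewrite e1E => /(f_equal ( *%R kappa)); rewrite mulrA kk mul1r mulr1.
have Tf : Gamma u f1 - Gamma f1 u = kappa *: X.
  by have := T p e1; rewrite -uE -f1E OmF.
apply: pairing_inj => beta; rewrite ![pairing _ beta]pairingC.
have F0 : pairing beta f0 = pairing beta (k1 *m S) +
    pairing beta (p *m DS f1) - pairing beta f1'.
  have : f0 = k1 *m S + p *m DS f1 - f1'.
    by rewrite -[LHS]opprK f0E opprB.
  by move=> ->; rewrite pairingBr pairingDr.
have K1 : pairing beta (k1 *m S) = - pairing e1' (beta *m S) -
    pairing e1 (p *m DS (beta *m S)).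
  by rewrite symS -[LHS]opprK k1E opprD.
have E1 : pairing e1' (beta *m S) = pairing beta f1' - pairing beta (e1 *m DS u).
  by rewrite f1'S pairingDr addrK symS.
have F1S : pairing p (Gamma f1 (beta *m S)) - pairing p (Gamma (beta *m S) f1) =
    - kappa * pairing beta u * pairing p X.
  rewrite -pairingBr Tf1 OmK pairingZr f1K -scalemxAl KK.
  by rewrite pairingZr pairingNr; ring.
have E1S : pairing e1 (Gamma u (beta *m S)) = pairing e1 (Gamma (beta *m S) u).
  apply/eqP; rewrite -subr_eq0 -pairingBr Tu pairingZr e1E OmX.
  by rewrite mulr0 mulr0.
have TfB : pairing beta (Gamma u f1) - pairing beta (Gamma f1 u) =
    kappa * pairing beta X by rewrite -pairingBr Tf pairingZr.
have FB : pairing beta f1' = - kappa * pairing beta Q - pairing beta (Gamma u f1)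
   + kappa * pairing p X * pairing beta u.
  by rewrite f1'P pairingDr pairingBr !pairingZr.
rewrite F0 K1 E1 !G -!uE -!f1E FB pairingZr pairingBr pairingDr !pairingZr.
lra.
Qed.

End ReebDirectionAlgebra.

(** * Splitting along a basis *)

Section DualBasis.
Context {R : realType} {n : nat}.
Variables e f : 'I_n.+1 -> 'rV[R]_n.+1.
Hypothesis ef : forall i j, pairing (e i) (f j) = (i == j)%:R.
Hypothesis n_gt0 : (0 < n)%N.
Local Notation i1 := (inord 1 : 'I_n.+1).

(** A left inverse of a square matrix is a right inverse. *)
Lemma dual_expansion v : v = \sum_i pairing (e i) v *: f i.
Proof.
pose P := \matrix_(i < n.+1, j < n.+1) e i 0 j.
pose Q := \matrix_(i < n.+1, j < n.+1) f i 0 j.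
have PQ : P *m Q^T = 1%:M.
  apply/matrixP => i j; rewrite !mxE -ef pairingE; apply: eq_bigr => k _.
  by rewrite !mxE.
have QP : P^T *m Q = 1%:M.
  by have := mulmx1C PQ => /(f_equal trmx); rewrite trmx_mul trmxK trmx1.
rewrite -[LHS]mulmx1 -QP mulmxA.
apply/rowP => j; rewrite mxE summxE; apply: eq_bigr => i _.
rewrite !mxE pairingE; congr (_ * _); apply: eq_bigr => k _.
by rewrite !mxE mulrC.
Qed.

Lemma split_c_mem (i : 'I_n.+1) : (1 < i)%N -> f i \in split_c f.
Proof.
move=> i1; apply: memv_span; apply/mapP; exists i => //.
by rewrite mem_filter i1 mem_enum.
Qed.

Lemma val_inord1 : i1 = 1%N :> nat. Proof. by rewrite inordK // ltnS. Qed.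

Lemma ord_cases (i : 'I_n.+1) : [\/ i = ord0, i = i1 | (1 < i)%N].
Proof.
case: (ltnP 1 i) => [|i1]; first by constructor 3.
have [i0|i0] := eqVneq (i : nat) 0%N.
  by constructor 1; apply/val_inj.
constructor 2; apply/val_inj; rewrite /= val_inord1.
by apply/eqP; rewrite eqn_leq i1 lt0n.
Qed.

(** Membership in the span of a part of a basis is the vanishing of the other
    coordinates, which are the pairings with the dual basis. *)
Lemma mem_split_c v : v \in split_c f <->
  pairing (e ord0) v = 0 /\ pairing (e i1) v = 0.
Proof.
have n01 : (ord0 == i1 :> 'I_n.+1) = false.
  by rewrite -(inj_eq val_inj) /= val_inord1.
split.
  have ker (i : 'I_n.+1) : (forall j : 'I_n.+1, (1 < j)%N -> i != j) ->
      v \in split_c f -> pairing (e i) v = 0.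
    move=> ij vc.
    have plin : linear (fun u : 'rV[R]_n.+1 => pairing (e i) u : R^o).
      by move=> c u w; rewrite pairingDr pairingZr.
    pose pM := GRing.isLinear.Build _ _ _ _
      (fun u : 'rV[R]_n.+1 => pairing (e i) u : R^o) plin.
    pose pL : {linear 'rV[R]_n.+1 -> R^o} :=
      HB.pack (fun u : 'rV[R]_n.+1 => pairing (e i) u : R^o) pM.
    suff : v \in lker (linfun pL) by rewrite memv_ker lfunE => /eqP.
    apply: (subvP _ _ vc); apply/span_subvP => w /mapP[j + ->].
    rewrite mem_filter => /andP[j1 _].
    by rewrite memv_ker lfunE /= ef (negbTE (ij j j1)).
  move=> vc; split; apply: ker => // j j1.
    by apply: contraTneq j1 => <-.
  by apply: contraTneq j1 => <-; rewrite val_inord1.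
move=> [v0 v1]; rewrite (dual_expansion v); apply: memv_suml => i _.
case: (ord_cases i) => [->|->|i1]; rewrite ?v0 ?v1 ?scale0r ?mem0v //.
by apply: memvZ; apply: split_c_mem.
Qed.

Lemma mem_split_bc v : v \in (split_b f + split_c f)%VS <->
  pairing (e ord0) v = 0.
Proof.
have n01 : (ord0 == i1 :> 'I_n.+1) = false.
  by rewrite -(inj_eq val_inj) /= val_inord1.
split.
  move=> /memv_addP[b bB [w wC ->]].
  have [w0 _] := (mem_split_c w).1 wC.
  have /vlineP[k ->] := bB.
  by rewrite pairingDr pairingZr ef n01 mulr0 w0 addr0.
move=> v0; rewrite (dual_expansion v); apply: memv_suml => i _.
case: (ord_cases i) => [->|->|i1]; first by rewrite v0 scale0r mem0v.
  by apply: memvZ; apply: (subvP (addvSl _ _)); exact: memv_line.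
by apply: memvZ; apply: (subvP (addvSr _ _)); exact: split_c_mem.
Qed.

Lemma split_full : (split_a f + split_b f + split_c f)%VS = fullv.
Proof.
apply/eqP; rewrite eqEsubv subvf /=; apply/subvP => v _.
rewrite (dual_expansion v); apply: memv_suml => i _; apply: memvZ.
case: (ord_cases i) => [->|->|i1].
- apply: (subvP (addvSl _ _)); apply: (subvP (addvSl _ _)); exact: memv_line.
- apply: (subvP (addvSl _ _)); apply: (subvP (addvSr _ _)); exact: memv_line.
- by apply: (subvP (addvSr _ _)); exact: split_c_mem.
Qed.

Lemma size_split_c :
  size [seq f mu | mu : 'I_n.+1 <- enum 'I_n.+1 & (1 < mu)%N] = (n - 1)%N.
Proof.
rewrite size_map size_filter -(count_map val (ltn 1)) val_enum_ord.
rewrite -{1}(prednK n_gt0) /= add0n subn1.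
rewrite (@eq_in_count _ _ predT) ?count_predT ?size_iota // => i.
by rewrite mem_iota => /andP[].
Qed.

(** The generators are as many as the dimension, so every bound on a dimension
    obtained by counting generators is attained. *)
Lemma split_dims : [/\ \dim (split_a f) = 1%N, \dim (split_b f) = 1%N,
  \dim (split_c f) = (n - 1)%N, directv (split_a f + split_b f + split_c f)%VS &
  directv (split_b f + split_c f)%VS].
Proof.
have da : (\dim (split_a f) <= 1)%N by rewrite dim_vline leq_b1.
have db : (\dim (split_b f) <= 1)%N by rewrite dim_vline leq_b1.
have dc : (\dim (split_c f) <= n - 1)%N.
  by apply: leq_trans (dim_span _) _; rewrite size_split_c.
have df : \dim (split_a f + split_b f + split_c f)%VS = n.+1.
  by rewrite split_full dimvf; apply: etrans (dim_matrix _ _ _) (mul1n _).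
have [h1 _] := dimv_add_leqif (split_a f + split_b f)%VS (split_c f).
have [h2 _] := dimv_add_leqif (split_a f) (split_b f).
have [h3 _] := dimv_add_leqif (split_a f) (split_b f + split_c f)%VS.
have [h4 _] := dimv_add_leqif (split_b f) (split_c f).
rewrite addvA in h3; rewrite df in h1 h3.
have ea : \dim (split_a f) = 1%N by lia.
have eb : \dim (split_b f) = 1%N by lia.
have ec : \dim (split_c f) = (n - 1)%N by lia.
have ebc : \dim (split_b f + split_c f)%VS = n by lia.
split=> //; rewrite directvE /=; apply/eqP.
  have e1 : n.+1 = (1 + 1 + (n - 1))%N by lia.
  exact: etrans (etrans df e1) (esym (f_equal2 addn (f_equal2 addn ea eb) ec)).
have e2 : n = (1 + (n - 1))%N by lia.
exact: etrans (etrans ebc e2) (esym (f_equal2 addn eb ec)).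
Qed.

End DualBasis.

(** * Positions and momenta of the first frame vectors *)

Section FrameVectors.
Context {R : realType} {d : nat} {M : topologicalType}.
Local Notation n := (d.*2.+1).
Variable A : atlas R n M.
Hypothesis Aman : is_smooth_manifold A.
Let Aat := manifold_diff_atlas Aman.
Variable omega : M -> 'rV[R]_n.
Hypothesis omega_smooth : forall x, smooth_form_at A omega x.
Variable g : M -> 'rV[R]_n -> 'rV[R]_n -> R.
Hypothesis g_metric : is_horizontal_metric A omega g.
Variable X0 : M -> 'rV[R]_n.
Hypothesis X0_smooth : forall x, smooth_field_at A X0 x.
Hypothesis X0_unit : forall x, pairing (omega x) (X0 x) = 1.
Local Notation B := (cotangent_atlas A).
Variable H : M * 'rV[R]_n -> R.
Hypothesis H_def : is_hamiltonian omega g H.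
Variable Hvec : M * 'rV[R]_n -> 'rV[R]_(n + n).
Hypothesis Hvec_def : is_hamiltonian_field A H Hvec.
Variables (W : set (R * (M * 'rV[R]_n)))
  (flow : R -> M * 'rV[R]_n -> M * 'rV[R]_n).
Hypothesis flowP : is_flow B Hvec W flow.
Let Bat := cotangent_diff_atlas Aman.
Local Notation sharp := (sharp Hvec).

Local Notation S := (sharp_mx A Hvec).
Hypothesis X0_ker : forall x v, ext_deriv A omega x (X0 x) v = 0.
Variable J : M -> 'rV[R]_n -> 'rV[R]_n.
Hypothesis J_def : is_contact_endomorphism A omega X0 g J.
Hypothesis JJ : forall x v, horizontal omega x v -> J x (J x v) = - v.
Local Notation gg := (extended_metric omega X0 g).
Hypothesis d_gt0 : (0 < d)%N.
Variable lambda : M * 'rV[R]_n.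
Hypothesis unit_speed : 2 * H lambda = 1.
Variable I : set R.
Hypotheses (I_open : open I) (I_itv : is_interval I).
Hypothesis I_dom : forall t, I t -> W (t, lambda).
Variables (E F : R -> 'I_n -> 'rV[R]_(n + n)) (Rm : R -> 'M[R]_n).
Local Notation c := (fun t => flow t lambda).
Hypothesis EF : is_canonical_frame A flow c I E F Rm.
Local Notation i0 := (ord0 : 'I_n).
Local Notation i1 := (inord 1 : 'I_n).

(** The Hamiltonian is constant along the whole extremal, which starts at the
    time 0 where the speed is known. *)
Lemma energy t : I t -> 2 * H (c t) = 1.
Proof.
move=> It.
suff E0 : H (c t) = H lambda by apply: etrans unit_speed; rewrite E0.
pose h s := H (c s).
have cI : is_integral_curve B Hvec [set s | W (s, lambda)] c.
  by move=> s Ws; apply: (flow_curve flowP).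
have Dh s : W (s, lambda) -> has_D h s (fun _ => 0).
  move=> Ws; have ss := da_center Bat (c s).
  have [near_s Dz] := curve_in_chart Bat cI Ws ss.
  have dH := hamiltonian_differentiable Aman g_metric X0_unit H_def Hvec_def flowP
    (c s).
  have D := @has_D_comp _ _ _ _ (fun r => cmap B (c s) (c r))
    (H \o cinv B (c s)) s _ _ Dz (has_D_self dH).
  apply: has_D_eq (has_D_near _ D) _ => [|r].
    apply: near_imp near_s _ => r sr.
    exact: (f_equal H (da_coordK Bat sr)).
  have E1 := Hvec_def (c s) (r *: Hvec (c s)).
  rewrite (change_id Bat _ ss); apply: etrans E1 _.
  have symZ (Z : 'rV[R]_(n + n)) : symplectic (r *: Z) Z = 0.
    by rewrite /symplectic !linearZ /= pairingZl pairingZr subrr.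
  exact: symZ.
have Dh1 s : W (s, lambda) -> is_derive s 1 h 0.
  by move=> /Dh [dh D0]; apply: DeriveDef; [exact: diff_derivable|exact: D0].
have W0 : W (0, lambda) := flow_dom0 flowP lambda.
have Wt := I_dom It.
have Witv := @flow_interval _ _ _ _ _ _ _ flowP lambda.
have cst r s : r <= s -> W (r, lambda) -> W (s, lambda) -> h s = h r.
  move=> rs Wr Ws.
  have Wx x : x \in `[r, s]%R -> W (x, lambda).
    by rewrite in_itv /= => xrs; exact: (Witv r s Wr Ws x xrs).
  have [||x _] := @MVT_segment R h (fun _ => 0) r s rs.
  - by move=> x xrs; apply: Dh1; apply: Wx; apply: subset_itv_oo_cc.
  - by apply: derivable_within_continuous => y /Wx /Dh1 [].
  - by rewrite mul0r => /eqP; rewrite subr_eq0 => /eqP.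
have c0 : h 0 = H lambda by rewrite /h (flow0 flowP).
rewrite -[LHS]/(h t) -c0; case: (leP 0 t) => [t0|/ltW t0]; first exact: cst.
by apply: esym; exact: cst.
Qed.

Section FixedChart.
Variable t0 : R.
Hypothesis It0 : I t0.
Local Notation l := (flow t0 lambda).
Local Notation a := (flow t0 lambda).1.
Local Notation q := (chart_position A flow lambda t0).
Local Notation p := (chart_momentum A flow lambda t0).
Local Notation e0 := (frame_momentum A flow lambda t0 E i0).
Local Notation e1 := (frame_momentum A flow lambda t0 E i1).
Local Notation f0 := (frame_position A flow lambda t0 F i0).
Local Notation f1 := (frame_position A flow lambda t0 F i1).
Local Notation k1 := (frame_momentum A flow lambda t0 F i1).
Local Notation FE := (frame_equations A omega X0 Hvec flow lambda I E F t0).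
Local Notation w := (form_in_chart A omega a).
Local Notation X := (field_in_chart A a X0).
Local Notation u s := (p s *m S a (q s)).

(** The factor between the covector of [E_0] and the contact form; it will turn
    out to be a constant sign, the one left free by the canonical frame. *)
Definition frame_scale (s : R) : R := pairing (e0 s) (X (q s)).
Local Notation kappa := frame_scale.

(** As [E_1], the derivative of [E_0], is vertical, the covector of [E_0] is in
    the kernel of the cometric. *)
Lemma momentum_E0 s : FE s -> e0 s = kappa s *: w (q s).
Proof.
move=> fe; have [aq _] := near_self (fe_near fe).
apply: (sharp_chart_eq0 Aman g_metric X0_unit H_def Hvec_def aq).
rewrite -(sharp_mxE Aman g_metric X0_unit H_def Hvec_def _ aq).
exact: fe_E0q fe.
Qed.

Lemma form_sharp_mx q' b : cdom A a (cinv A a q') ->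
  pairing (w q') (b *m S a q') = 0.
Proof.
move=> aq; rewrite (sharp_mxE Aman g_metric X0_unit H_def Hvec_def _ aq).
exact: (sharp_chart_hor Aman g_metric X0_unit H_def Hvec_def).
Qed.

Lemma form_mul_sharp_mx q' : cdom A a (cinv A a q') -> w q' *m S a q' = 0.
Proof.
move=> aq; apply: pairing_inj => b; rewrite pairing0l pairingC.
rewrite (sharp_mx_symmetric Aman g_metric X0_unit H_def Hvec_def) //.
exact: form_sharp_mx.
Qed.

Lemma frame_scale_differentiable s : FE s -> differentiable kappa s.
Proof.
move=> fe.
have DX := has_D_comp (fe_q fe) (has_D_self (fe_reeb fe)).
by have [] := has_D_pairing (has_D_self (fe_de0 fe)) DX.
Qed.

(** In the derivative of the covector [kappa w] of [E_0] along the extremal, the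
    factor [w] contributes ['D_u w]. The derivative of the cometric contributes
    the transposed term, because [w] is in its kernel at all points; the two
    make up the exterior derivative. *)
Lemma momentum_E1 s : (\forall r \near s, FE r) -> forall v,
  pairing (e1 s) v = 'D_1 kappa s * pairing (w (q s)) v
    + kappa s * ext_deriv_in_chart A omega a (q s) (u s) v.
Proof.
move=> nfe v; have fe := near_self nfe.
have dk := frame_scale_differentiable fe.
have Dw := has_D_comp (fe_q fe) (has_D_self (fe_form fe)).
have D0 := has_D_scaler (has_D_self dk) Dw.
have E0 : 'D_1 e0 s = 'D_1 kappa s *: w (q s) + kappa s *: 'D_(u s) w (q s).
  have N : \forall r \near s, kappa r *: w (q r) = e0 r.
    by apply: near_imp nfe _ => r /momentum_E0.
  apply: etrans ((has_D_near N D0).2 1) _.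
  by rewrite scale1r.
have E1 : pairing (w (q s)) (p s *m 'D_v (S a) (q s)) =
    - pairing ('D_v w (q s)) (u s).
  have [_ D] := has_D_pairing (has_D_self (fe_form fe))
    (has_D_mulmx (has_D_cst (p s) (q s)) (has_D_self (fe_S fe))).
  have Dv := D v; rewrite mul0mx add0r in Dv.
  have N : \forall q' \near q s, (fun _ => 0 : R) q' =
      pairing (w q') (p s *m S a q').
    by apply: near_imp (fe_near fe) _ => q' [aq _]; rewrite form_sharp_mx.
  have Z := (has_D_near N (has_D_cst (0 : R) (q s))).2 v.
  have Z2 := etrans (esym Dv) Z.
  by apply/eqP; rewrite -subr_eq0 opprK addrC; apply/eqP.
apply: etrans (fe_E0p fe v) _.
have E2 : pairing ('D_1 e0 s) v = 'D_1 kappa s * pairing (w (q s)) v +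
    kappa s * pairing ('D_(u s) w (q s)) v.
  apply: etrans (f_equal (fun r => pairing r v) E0) _.
  by rewrite pairingDl !pairingZl.
have E3 : pairing (e0 s) (p s *m 'D_v (S a) (q s)) =
    - (kappa s * pairing ('D_v w (q s)) (u s)).
  apply: etrans (f_equal (fun r => pairing r (p s *m 'D_v (S a) (q s)))
    (momentum_E0 fe)) _.
  by rewrite pairingZl E1 mulrN.
apply: etrans (f_equal2 +%R E2 E3) _.
by rewrite -addrA -mulrBr.
Qed.

Lemma momentum_E1_row s : (\forall r \near s, FE r) ->
  e1 s = 'D_1 kappa s *: w (q s) + kappa s *: (u s *m ext_mx A omega a (q s)).
Proof.
move=> nfe; have fe := near_self nfe; apply: pairing_inj => v.
rewrite (momentum_E1 nfe) pairingDl !pairingZl.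
by rewrite (pairing_ext_mx _ _ (fe_form fe)).
Qed.

Lemma position_F1 s : (\forall r \near s, FE r) ->
  f1 s = kappa s *: (u s *m (ext_mx A omega a (q s) *m S a (q s))).
Proof.
move=> nfe; have fe := near_self nfe; have [aq _] := near_self (fe_near fe).
rewrite (fe_E1q fe) (momentum_E1_row nfe) mulmxDl -!scalemxAl.
by rewrite form_mul_sharp_mx // scaler0 add0r mulmxA.
Qed.

(** The scale is the value of the covector of [E_0] on the Reeb field, which
    involves no chart. *)
Lemma frame_scaleE s : FE s ->
  kappa s = pairing (rsubmx (E s i0)) (X0 (c s).1).
Proof.
move=> fe; have ls := fe_dom fe; have cc := da_center Aat (c s).1.
have P := pairing_rsubmx_cotangent_change Aman (E s i0) (X (q s)) cc ls.
apply: etrans P _.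
have -> : lsubmx (E s i0) = 0 := frame_E_vertical Aman EF i0 (fe_I fe).
rewrite change0 derive0 pairing0r addr0; congr (pairing _ _).
have qE : q s = cmap A a (c s).1.
  by rewrite /chart_position cotangent_cmapE row_mxKl.
rewrite qE /field_in_chart (da_coordK Aat ls).
exact: (changeK Aat).
Qed.

Let nearFE : \forall s \near t0, FE s :=
  frame_equations_near Aman omega_smooth g_metric X0_smooth X0_unit H_def
    Hvec_def flowP d_gt0 I_open I_itv I_dom EF It0.

Lemma chart_position_center : q t0 = cmap A a a.
Proof. by rewrite /chart_position cotangent_cmapE row_mxKl. Qed.

Lemma chart_momentum_center : p t0 = l.2.
Proof.
rewrite /chart_momentum cotangent_cmapE row_mxKr.
by apply: (cochange_id Aman); exact: (da_center Aat).
Qed.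

Lemma frame_momentum_center Z mu : frame_momentum A flow lambda t0 Z mu t0 =
  rsubmx (Z t0 mu).
Proof. by rewrite /frame_momentum (change_id Bat) //; exact: (da_center Bat). Qed.

Lemma frame_position_center Z mu : frame_position A flow lambda t0 Z mu t0 =
  lsubmx (Z t0 mu).
Proof. by rewrite /frame_position (change_id Bat) //; exact: (da_center Bat). Qed.

Local Notation K := (ext_mx A omega a (q t0) *m S a (q t0)).

Lemma velocity_sharp : u t0 = sharp a l.2.
Proof.
rewrite chart_position_center chart_momentum_center.
exact: (sharp_mx_center Aman g_metric X0_unit H_def Hvec_def).
Qed.

Lemma velocity_horizontal : horizontal omega a (u t0).
Proof.
rewrite velocity_sharp /horizontal /=.
exact: (sharp_hor Aman g_metric X0_unit H_def Hvec_def).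
Qed.

Lemma velocity_unit : gg a (u t0) (u t0) = 1.
Proof.
rewrite {1}velocity_sharp (extended_metric_sharp Aman g_metric X0_unit H_def Hvec_def).
rewrite (velocity_horizontal : _ = _) mul0r subr0 velocity_sharp -(energy It0).
have := hamiltonian_sharp Aman g_metric X0_unit H_def Hvec_def a l.2.
by rewrite -surjective_pairing => ->; rewrite mulrA mulfV ?mul1r // pnatr_eq0.
Qed.

Lemma ext_mx_center v : v *m ext_mx A omega a (q t0) = ext_row A omega a v.
Proof.
apply: pairing_inj => b; rewrite chart_position_center.
have dw := near_self (form_in_chart_differentiable omega_smooth a).
apply: etrans (pairing_ext_mx v b dw) _.
apply: etrans (esym (ext_derivE Aman v b dw)) _.
exact: esym (pairing_ext_row Aman omega_smooth a v b).
Qed.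

Lemma pairing_ext_mx_center v b :
  pairing (v *m ext_mx A omega a (q t0)) b = ext_deriv A omega a v b.
Proof. by rewrite ext_mx_center (pairing_ext_row Aman omega_smooth). Qed.

Lemma endomorphism_center v : J a v = - (v *m K).
Proof.
rewrite (contact_endomorphismE Aman omega_smooth g_metric X0_unit H_def Hvec_def
  X0_ker J_def) mulmxA ext_mx_center; congr (- _).
by rewrite chart_position_center (sharp_mx_center Aman g_metric X0_unit H_def Hvec_def).
Qed.

(** The normalization [symplectic E_1 F_1 = 1] says that the scale squared times
    the squared speed is 1. *)
Lemma frame_scale_sqr : kappa t0 * kappa t0 = 1.
Proof.
have [_ _ EF1] := cf_darboux EF It0 i1 i1.
have {}EF1 : pairing (e1 t0) (f1 t0) = 1.
  rewrite frame_momentum_center frame_position_center.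
  move: EF1; rewrite /symplectic (frame_E_vertical Aman EF i1 It0) pairing0r subr0.
  by rewrite eqxx => /eqP; rewrite subr_eq0 => /eqP.
have nfe := near_near nearFE; have nfe0 := near_self nfe.
have fe := near_self nearFE; have [aq _] := near_self (fe_near fe).
have f1E := position_F1 nfe0.
have e1E := momentum_E1_row nfe0.
rewrite e1E f1E pairingDl !pairingZl !pairingZr mulmxA in EF1.
rewrite (form_sharp_mx _ aq) !mulr0 add0r in EF1.
have G : pairing (u t0 *m ext_mx A omega a (q t0))
    (u t0 *m ext_mx A omega a (q t0) *m S a (q t0)) = 1.
  rewrite pairing_ext_mx_center -mulmxA.
  have -> : u t0 *m K = - J a (u t0) by rewrite endomorphism_center opprK.
  rewrite -[- J a _]scaleN1r (inner_scaler (ext_deriv_linear Aman omega_smooth a)).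
  rewrite mulN1r -J_def JJ; last exact: velocity_horizontal.
  rewrite -[- u t0]scaleN1r (inner_scaler (extended_metric_linear g_metric X0_unit a)).
  by rewrite mulN1r opprK velocity_unit.
by rewrite G mulr1 in EF1.
Qed.

End FixedChart.

Lemma frame_scale_invariant t : I t ->
  pairing (rsubmx (E t i0)) (X0 (c t).1) ^+ 2 = 1.
Proof.
move=> It.
have fe := near_self (frame_equations_near Aman omega_smooth g_metric X0_smooth
  X0_unit H_def Hvec_def flowP d_gt0 I_open I_itv I_dom EF It).
by rewrite -(frame_scaleE fe) expr2 frame_scale_sqr.
Qed.

End FrameVectors.

Section SplittingVectors.
Context {R : realType} {d : nat} {M : topologicalType}.
Local Notation n := (d.*2.+1).
Variable A : atlas R n M.
Hypothesis Aman : is_smooth_manifold A.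
Let Aat := manifold_diff_atlas Aman.
Variable omega : M -> 'rV[R]_n.
Hypothesis omega_smooth : forall x, smooth_form_at A omega x.
Variable g : M -> 'rV[R]_n -> 'rV[R]_n -> R.
Hypothesis g_metric : is_horizontal_metric A omega g.
Variable X0 : M -> 'rV[R]_n.
Hypothesis X0_smooth : forall x, smooth_field_at A X0 x.
Hypothesis X0_unit : forall x, pairing (omega x) (X0 x) = 1.
Local Notation B := (cotangent_atlas A).
Variable H : M * 'rV[R]_n -> R.
Hypothesis H_def : is_hamiltonian omega g H.
Variable Hvec : M * 'rV[R]_n -> 'rV[R]_(n + n).
Hypothesis Hvec_def : is_hamiltonian_field A H Hvec.
Variables (W : set (R * (M * 'rV[R]_n)))
  (flow : R -> M * 'rV[R]_n -> M * 'rV[R]_n).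
Hypothesis flowP : is_flow B Hvec W flow.
Let Bat := cotangent_diff_atlas Aman.
Local Notation sharp := (sharp Hvec).

Local Notation S := (sharp_mx A Hvec).
Hypothesis X0_ker : forall x v, ext_deriv A omega x (X0 x) v = 0.
Variable J : M -> 'rV[R]_n -> 'rV[R]_n.
Hypothesis J_def : is_contact_endomorphism A omega X0 g J.
Hypothesis JJ : forall x v, horizontal omega x v -> J x (J x v) = - v.
Local Notation gg := (extended_metric omega X0 g).
Hypothesis d_gt0 : (0 < d)%N.
Variable lambda : M * 'rV[R]_n.
Hypothesis unit_speed : 2 * H lambda = 1.
Variable I : set R.
Hypotheses (I_open : open I) (I_itv : is_interval I).
Hypothesis I_dom : forall t, I t -> W (t, lambda).
Variables (E F : R -> 'I_n -> 'rV[R]_(n + n)) (Rm : R -> 'M[R]_n).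
Local Notation c := (fun t => flow t lambda).
Hypothesis EF : is_canonical_frame A flow c I E F Rm.
Local Notation i0 := (ord0 : 'I_n).
Local Notation i1 := (inord 1 : 'I_n).

Variable nabla : M -> 'rV[R]_n -> (M -> 'rV[R]_n) -> 'rV[R]_n.
Hypothesis nabla_tanno : is_tanno_connection A omega X0 g J nabla.
Variable t0 : R.
Hypothesis It0 : I t0.
Local Notation l := (flow t0 lambda).
Local Notation a := (flow t0 lambda).1.
Local Notation q := (chart_position A flow lambda t0).
Local Notation p := (chart_momentum A flow lambda t0).
Local Notation e0 := (frame_momentum A flow lambda t0 E i0).
Local Notation e1 := (frame_momentum A flow lambda t0 E i1).
Local Notation f0 := (frame_position A flow lambda t0 F i0).
Local Notation f1 := (frame_position A flow lambda t0 F i1).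
Local Notation k1 := (frame_momentum A flow lambda t0 F i1).
Local Notation FE := (frame_equations A omega X0 Hvec flow lambda I E F t0).
Local Notation w := (form_in_chart A omega a).
Local Notation X := (field_in_chart A a X0).
Local Notation u s := (p s *m S a (q s)).

Local Notation kappa := (frame_scale A X0 flow lambda E t0).

Let nearFE : \forall s \near t0, FE s :=
  frame_equations_near Aman omega_smooth g_metric X0_smooth X0_unit H_def
    Hvec_def flowP d_gt0 I_open I_itv I_dom EF It0.

(** [frame_scale_sqr] holds at each time in the chart at this time, and
    [frame_scaleE] makes it independent of the chart. *)
Lemma frame_scale_sqr_near : \forall s \near t0, kappa s * kappa s = 1.
Proof.
apply: near_imp nearFE _ => s fe.
rewrite (frame_scaleE Aman EF fe) -expr2.
exact: (frame_scale_invariant Aman omega_smooth g_metric X0_smooth X0_unit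
  H_def Hvec_def flowP X0_ker J_def JJ d_gt0 unit_speed I_open I_itv I_dom EF
  (fe_I fe)).
Qed.

Lemma frame_scale_constant : \forall s \near t0, 'D_1 kappa s = 0.
Proof.
apply: near_imp2 (near_near frame_scale_sqr_near) nearFE _ => s ks fe.
have dk := has_D_self (frame_scale_differentiable fe).
have [_ D] := has_D_mul dk dk.
have N : \forall r \near s, (fun _ => 1 : R) r = kappa r * kappa r.
  by apply: near_imp ks _ => r ->.
have Z := etrans (esym (D 1)) ((has_D_near N (has_D_cst (1 : R) s)).2 1).
have k0 : kappa s != 0.
  by apply/eqP => k0; have /eqP := near_self ks; rewrite k0 mul0r eq_sym oner_eq0.
have Z2 : kappa s * 'D_1 kappa s = 0.
  have key (x y : R) : x * y + y * x = 0 -> y * x = 0 by move=> ?; lra.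
  exact: key Z.
by move/eqP: Z2; rewrite mulf_eq0 (negbTE k0) => /eqP.
Qed.

Let K q' := ext_mx A omega a q' *m S a q'.

(** Up to a vertical vector [F_0] is minus the derivative of [F_1]. The position
    of [F_1] is differentiated in two ways, as the vector dual to the covector
    of [E_1] and as a multiple of [J u]; [reeb_direction] compares the results. *)
Lemma position_F0 : lsubmx (F t0 i0) = kappa t0 *: (X0 a +
    2 *: tanno_tensor A J nabla a (u t0) (u t0) -
    pairing (p t0) (X0 a) *: u t0).
Proof.
have aa := da_center Aat a.
have q0 := chart_position_center A flow lambda t0.
have fe := near_self nearFE.
have nfe0 := near_self (near_near nearFE).
have [aq _] := near_self (fe_near fe).
have k0 := near_self frame_scale_constant.
have dS := fe_S fe.
have dext : differentiable (ext_mx A omega a) (q t0).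
  by rewrite q0; exact: near_self (ext_mx_differentiable omega_smooth a).
have DKq := has_D_mulmx (has_D_self dext) (has_D_self dS).
have dK : differentiable K (q t0) by case: DKq.
have endoE v : J a v = - (v *m K (q t0)).
  exact: (endomorphism_center Aman omega_smooth g_metric X0_unit H_def Hvec_def
    flow X0_ker J_def lambda t0).
have symS b1 b2 : pairing b1 (b2 *m S a (q t0)) = pairing b2 (b1 *m S a (q t0)).
  exact: (sharp_mx_symmetric Aman g_metric X0_unit H_def Hvec_def).
have Du := has_D_mulmx (has_D_self (fe_dp fe))
  (has_D_comp (fe_q fe) (has_D_self dS)).
have uhor : horizontal omega a (u t0).
  exact: (velocity_horizontal Aman g_metric X0_unit H_def Hvec_def).
have F0E := frame_position_center Aman flow lambda t0 F i0.
apply: etrans (esym F0E) _.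
apply: (@reeb_direction R n (S a (q t0)) (K (q t0)) ('D_(u t0) K (q t0))
  (fun w => 'D_w (S a) (q t0)) (christoffel A nabla a) (ext_deriv A omega a)
  (X0 a) (tanno_tensor A J nabla a (u t0) (u t0)) (u t0)
  ('D_1 (fun s => u s) t0) (p t0) ('D_1 p t0) (e1 t0) ('D_1 e1 t0)
  (k1 t0) (f0 t0) (f1 t0) ('D_1 f1 t0) (kappa t0)).
- exact: symS.
- by move=> w c v1 v2; exact: christoffel_linear.
- move=> w b1 b2; rewrite q0.
  exact: (derive_sharp_mx Aman g_metric X0_unit H_def Hvec_def flowP nabla_tanno).
- move=> b1 b2; rewrite q0.
  exact: (christoffel_torsion Aman g_metric X0_unit H_def Hvec_def flowP
    nabla_tanno).
- move=> v b.
  have P := pairing_ext_mx_center Aman omega_smooth flow lambda t0 v (b *m S a (q t0)).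
  by apply: etrans (esym P) _; rewrite symS /K mulmxA.
- by [].
- have := JJ uhor; rewrite !endoE mulNmx opprK.
  by [].
- move=> v; apply: etrans (momentum_E1 Aman g_metric X0_unit H_def Hvec_def nfe0 v) _.
  rewrite k0 mul0r add0r; congr (_ * _).
  apply: etrans (esym (pairing_ext_mx (u t0) v (fe_form fe))) _.
  exact: pairing_ext_mx_center.
- by rewrite (ext_deriv_anti Aman omega_smooth) X0_ker oppr0.
- exact: fe_E1q fe.
- have [_ _ EF1] := cf_darboux EF It0 i1 i1.
  have E1 := frame_momentum_center Aman flow lambda t0 E i1.
  have F1 := frame_position_center Aman flow lambda t0 F i1.
  rewrite E1 F1.
  move: EF1; rewrite /symplectic (frame_E_vertical Aman EF i1 It0) pairing0r subr0.
  by rewrite eqxx => /eqP; rewrite subr_eq0 => /eqP.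
- exact: near_self frame_scale_sqr_near.
- by move=> v; exact: fe_E1p fe v.
- exact: fe_F1q fe.
- have D := has_D_mulmx (has_D_self (fe_de1 fe))
    (has_D_comp (fe_q fe) (has_D_self dS)).
  have N : \forall r \near t0, e1 r *m S a (q r) = f1 r.
    by apply: near_imp nearFE _ => r fr; rewrite (fe_E1q fr).
  by apply: etrans ((has_D_near N D).2 1) _; rewrite scale1r.
- have Dk := has_D_self (frame_scale_differentiable fe).
  have D := has_D_scaler Dk (has_D_mulmx (has_D_self Du.1)
    (has_D_comp (fe_q fe) (has_D_self dK))).
  have N : \forall r \near t0, kappa r *: (u r *m K (q r)) = f1 r.
    apply: near_imp (near_near nearFE) _ => r fr.
    by rewrite (position_F1 Aman g_metric X0_unit H_def Hvec_def fr).
  apply: etrans ((has_D_near N D).2 1) _.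
  rewrite [in X in X *: _ + _]k0 scale0r add0r scale1r.
  by [].
- by move=> v; exact: fe_p fe v.
- by apply: etrans (Du.2 1) _; rewrite scale1r.
- have Jsm := endomorphism_field_smooth Aman omega_smooth g_metric X0_unit H_def
    Hvec_def flowP X0_ker J_def.
  rewrite (tanno_tensorE Aman nabla_tanno Jsm) !endoE opprK; congr (_ + _ + _).
  have N := endomorphism_in_chart Aman omega_smooth g_metric X0_unit H_def
    Hvec_def X0_ker J_def a.
  have N2 : \forall q' \near cmap A a a, - (u t0 *m K q') =
      field_in_chart A a (fun y => J y (const_field A a (u t0) y)) q'.
    by apply: near_imp N _ => q' ->; rewrite mulmxA.
  rewrite q0 in dK *.
  have D := has_D_opp (has_D_mulmx (has_D_cst (u t0) (cmap A a a)) (has_D_self dK)).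
  rewrite q0 in N2 D.
  apply: etrans ((has_D_near N2 D).2 _) _.
  by rewrite mul0mx add0r.
Qed.

End SplittingVectors.

(** * The canonical splitting *)

Unset Implicit Arguments.

Theorem theorem1p6 (R : realType) (d : nat) (d_gt0 : (0 < d)%N)
  (M : topologicalType) (A : atlas R d.*2.+1 M)
  (M_manifold : is_smooth_manifold A)
  (omega : M -> 'rV[R]_(d.*2.+1)) (omega_contact : is_contact_form A omega)
  (g : M -> 'rV[R]_(d.*2.+1) -> 'rV[R]_(d.*2.+1) -> R)
  (g_metric : is_horizontal_metric A omega g)
  (X0 : M -> 'rV[R]_(d.*2.+1)) (X0_reeb : is_reeb A omega X0)
  (J : M -> 'rV[R]_(d.*2.+1) -> 'rV[R]_(d.*2.+1))
  (J_def : is_contact_endomorphism A omega X0 g J)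
  (J_compatible : is_compatible omega X0 J)
  (nabla : M -> 'rV[R]_(d.*2.+1) -> (M -> 'rV[R]_(d.*2.+1)) ->
     'rV[R]_(d.*2.+1))
  (nabla_tanno : is_tanno_connection A omega X0 g J nabla)
  (H : M * 'rV[R]_(d.*2.+1) -> R) (H_def : is_hamiltonian omega g H)
  (Hvec : M * 'rV[R]_(d.*2.+1) -> 'rV[R]_(d.*2.+1 + d.*2.+1))
  (Hvec_def : is_hamiltonian_field A H Hvec)
  (W : set (R * (M * 'rV[R]_(d.*2.+1))))
  (flow : R -> M * 'rV[R]_(d.*2.+1) -> M * 'rV[R]_(d.*2.+1))
  (flow_def : is_flow (cotangent_atlas A) Hvec W flow)
  (lambda : M * 'rV[R]_(d.*2.+1)) (unit_speed : 2 * H lambda = 1)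
  (I : set R) (I_open : open I) (I_interval : is_interval I)
  (I_dom : forall t, I t -> W (t, lambda))
  (E F : R -> 'I_(d.*2.+1) -> 'rV[R]_(d.*2.+1 + d.*2.+1))
  (Rm : R -> 'M[R]_(d.*2.+1))
  (EF_canonical :
     is_canonical_frame A flow (fun t => flow t lambda) I E F Rm) :
  forall t, I t ->
  let gamma := fun s => (flow s lambda).1 in
  let x := gamma t in
  let dgamma := velocity A gamma t in
  let h0 := pairing (flow t lambda).2 (X0 x) in
  let f := fun mu =>
    differential (cotangent_atlas A) A fst (flow t lambda) (F t mu) in
  let Sa := split_a f in
  let Sb := split_b f in
  let Sc := split_c f in
  [/\ (Sa + Sb + Sc)%VS = fullv /\ directv (Sa + Sb + Sc)%VS,
      Sa = <[X0 x + 2 *: tanno_tensor A J nabla x dgamma dgamma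
             - h0 *: dgamma]>%VS /\ \dim Sa = 1%N,
      Sb = <[J x dgamma]>%VS /\ \dim Sb = 1%N,
      (forall v, v \in Sc <->
         extended_metric omega X0 g x (J x dgamma) v = 0 /\
         horizontal omega x v) /\ \dim Sc = (d.*2 - 1)%N &
      [/\ (forall v, v \in (Sb + Sc)%VS <-> horizontal omega x v),
          directv (Sb + Sc)%VS &
          dgamma \in Sc]].
Proof.
move=> t It gamma x dgamma h0 f Sa Sb Sc.
have Aat := manifold_diff_atlas M_manifold.
have Bat := cotangent_diff_atlas M_manifold.
have [omega_smooth _] := omega_contact.
have X0_smooth := reeb_smooth X0_reeb.
have X0_unit := reeb_unit X0_reeb.
have X0_ker := reeb_ker X0_reeb.
have JJ := J_compatible.1.
have n_gt0 : (0 < d.*2)%N by rewrite double_gt0.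
have nearFE := frame_equations_near M_manifold omega_smooth g_metric X0_smooth
  X0_unit H_def Hvec_def flow_def d_gt0 I_open I_interval I_dom EF_canonical It.
have fe := near_self nearFE.
have nfe0 := near_self (near_near nearFE).
pose u := sharp Hvec x (flow t lambda).2.
have uE : chart_momentum A flow lambda t t *m
    sharp_mx A Hvec x (chart_position A flow lambda t t) = u.
  exact: (velocity_sharp M_manifold g_metric X0_unit H_def Hvec_def).
have u_hor : horizontal omega x u.
  exact: (sharp_hor M_manifold g_metric X0_unit H_def Hvec_def).
have dgammaE : dgamma = u.
  have cI : is_integral_curve (cotangent_atlas A) Hvec
      [set s | W (s, lambda)] (flow^~ lambda).
    by move=> s; apply: (flow_curve flow_def).
  have [_ D] := cI t (I_dom t It).
  have D2 := has_D_linear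
    (lsubmx : {linear 'M[R]_(1, d.*2.+1 + d.*2.+1) -> 'M[R]_(1, d.*2.+1)})
    (derive1_is_derive D).
  apply: has_D_derive1; apply: has_D_eq (has_D_ext _ D2) _ => s.
    by rewrite /= row_mxKl.
  by rewrite linearZ /= /u /sharp -surjective_pairing.
pose kappa := frame_scale A X0 flow lambda E t t.
have kk : kappa * kappa = 1.
  exact: (frame_scale_sqr M_manifold omega_smooth g_metric X0_smooth X0_unit
    H_def Hvec_def flow_def X0_ker J_def JJ d_gt0 unit_speed I_open I_interval
    I_dom EF_canonical It).
have k0 : kappa != 0.
  by apply/eqP => k0; move/eqP: kk; rewrite k0 mul0r eq_sym oner_eq0.
pose e mu := rsubmx (E t mu).
have fE mu : f mu = lsubmx (F t mu) := differential_fst M_manifold _ _.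
have ef mu nu : pairing (e mu) (f nu) = (mu == nu)%:R.
  have [_ _] := cf_darboux EF_canonical It mu nu.
  rewrite /symplectic (frame_E_vertical M_manifold EF_canonical mu It) pairing0r subr0.
  by rewrite fE => /eqP; rewrite subr_eq0 => /eqP.
have e0E v : pairing (e ord0) v = kappa * pairing (omega x) v.
  rewrite /e -(frame_momentum_center M_manifold flow lambda t E ord0).
  rewrite (momentum_E0 M_manifold g_metric X0_unit H_def Hvec_def fe) pairingZl.
  congr (_ * pairing _ _); rewrite (chart_position_center A flow lambda t).
  have xx := da_center Aat x.
  rewrite /form_in_chart (da_coordK Aat xx).
  exact: (cochange_id M_manifold).
have e1E v : pairing (e (inord 1)) v = kappa * ext_deriv A omega x u v.
  rewrite /e -(frame_momentum_center M_manifold flow lambda t E (inord 1)).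
  have kc := near_self (frame_scale_constant M_manifold omega_smooth g_metric
    X0_smooth X0_unit H_def Hvec_def flow_def X0_ker J_def JJ d_gt0 unit_speed
    I_open I_interval I_dom EF_canonical It).
  have P := momentum_E1 M_manifold g_metric X0_unit H_def Hvec_def nfe0 v.
  rewrite kc mul0r add0r uE in P; apply: etrans P _; congr (_ * _).
  apply: etrans (esym (pairing_ext_mx u v (fe_form fe))) _.
  exact: (pairing_ext_mx_center M_manifold omega_smooth flow lambda t u v).
have JuE v : extended_metric omega X0 g x (J x u) v = - ext_deriv A omega x u v.
  rewrite (extended_metric_sym g_metric X0_unit) J_def.
  exact: (ext_deriv_anti M_manifold omega_smooth).
have f0E : f ord0 = kappa *: (X0 x +
    2 *: tanno_tensor A J nabla x dgamma dgamma - h0 *: dgamma).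
  rewrite fE (position_F0 M_manifold omega_smooth g_metric X0_smooth X0_unit
    H_def Hvec_def flow_def X0_ker J_def JJ d_gt0 unit_speed I_open I_interval
    I_dom EF_canonical nabla_tanno It) uE dgammaE.
  by rewrite (chart_momentum_center M_manifold flow lambda t).
have f1E : f (inord 1) = - kappa *: J x dgamma.
  rewrite fE -(frame_position_center M_manifold flow lambda t F (inord 1)).
  rewrite (position_F1 M_manifold g_metric X0_unit H_def Hvec_def nfe0) uE.
  rewrite dgammaE (endomorphism_center M_manifold omega_smooth g_metric X0_unit
    H_def Hvec_def flow X0_ker J_def lambda t u).
  by rewrite scaleNr scalerN opprK.
have lineZ (k : R) (v : 'rV[R]_(d.*2.+1)) : k != 0 -> <[k *: v]>%VS = <[v]>%VS.
  move=> kn0; apply/eqP; rewrite eqEsubv -!memvE memvZ ?memv_line //=.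
  by apply/vlineP; exists k^-1; rewrite scalerA mulVf // scale1r.
have [da db dc dabc dbc] := split_dims ef n_gt0.
have full := split_full ef n_gt0.
have memc := mem_split_c ef n_gt0.
have membc := mem_split_bc ef n_gt0.
have cP v : v \in Sc <->
    extended_metric omega X0 g x (J x dgamma) v = 0 /\ horizontal omega x v.
  rewrite dgammaE JuE; split.
    move=> /(memc v).1; rewrite e0E e1E => -[/eqP + /eqP].
    rewrite !mulf_eq0 (negbTE k0) /= => /eqP w0 /eqP ->.
    by rewrite oppr0.
  move=> [/eqP + vh]; rewrite oppr_eq0 => /eqP v0; apply/(memc v).2.
  by rewrite e0E e1E v0 (vh : _ = _) mulr0.
split.
- by split.
- split; last exact: da.
  exact: etrans (f_equal (fun v => <[v]>%VS) f0E) (lineZ _ _ k0).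
- split; last exact: db.
  have nk0 : - kappa != 0 by rewrite oppr_eq0.
  exact: etrans (f_equal (fun v => <[v]>%VS) f1E) (lineZ _ _ nk0).
- by split.
- split; [|exact: dbc|].
  + move=> v; split=> [/(membc v).1|vh].
      by rewrite e0E => /eqP; rewrite mulf_eq0 (negbTE k0) => /eqP.
    by apply/(membc v).2; rewrite e0E (vh : _ = _) mulr0.
  + apply/(cP dgamma).2; rewrite dgammaE; split; last exact: u_hor.
    rewrite JuE; have A0 := ext_deriv_anti M_manifold omega_smooth x u u.
    have key (r : R) : r = - r -> - r = 0 by move=> ?; lra.
    exact: key A0.
Qed.
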